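(* Let $f$ be a smooth probability density on $\mathbb{R}^n$ with respect to $\gamma$, let $d\mu=f\,d\gamma$, and assume $\int_{\mathbb{R}^n}|x|^2\,d\mu<\infty$. Assume that $\mu$ has barycenter $b$ and that $\mathrm{I}(f)<\infty$. Then $$\delta(f)\;\ge\;c(f)\,\mathcal{D}(\mu_b,\gamma)^4$$ where $c(f)>0$ is a constant depending on $f$ only via the uniform integrability of the family of measures $(\alpha\cdot x)^2\,d\mu(x)$, where $\alpha$ runs over the unit sphere of $\mathbb{R}^n$.
   Context: $\gamma$ is the standard Gaussian measure on $\mathbb{R}^n$. For a probability density $g$ with respect to $\gamma$: $\mathrm{H}(g)=\int g\log g\,d\gamma$, $\mathrm{I}(g)=\int \frac{|\nabla g|^2}{g}\,d\gamma$, and $\delta(g)=\frac12\mathrm{I}(g)-\mathrm{H}(g)$. The shifted density is $f_b(x)=f(x+b)\,e^{-(b\cdot x+|b|^2/2)}$ and $d\mu_b=f_b\,d\gamma$. For a probability $\nu$ with finite mean, $\mathcal{D}(\nu,\gamma)=\sup_{\varphi\in\mathcal{B}}\left|\int[x\varphi-\nabla\varphi]\,d\nu\right|$, where $\mathcal{B}$ is the class of smooth $\varphi:\mathbb{R}^n\to\mathbb{R}$ with $\|\varphi\|_\infty\le1$, $\|\nabla\varphi\|_\infty\le1$, $\|\mathrm{Hess}(\varphi)\|_\infty\le1$ (Euclidean / Hilbert–Schmidt norms). *)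

(* Defs.v *)
From HB Require Import structures.
From mathcomp Require Import all_boot all_order all_algebra.
From mathcomp Require Import all_classical all_reals all_analysis.
Set Implicit Arguments. Unset Strict Implicit. Unset Printing Implicit Defensive.
Import Order.TTheory GRing.Theory Num.Theory.
Import numFieldNormedType.Exports.
Local Open Scope classical_set_scope.
Local Open Scope ring_scope.

Section GaussDefs.
Context {R : realType} {n : nat}.

Definition dotp (u v : 'rV[R]_n) : R := \sum_(i < n) u 0 i * v 0 i.
Definition enorm (u : 'rV[R]_n) : R := Num.sqrt (dotp u u).

Definition ebasis (i : 'I_n) : 'rV[R]_n := \row_(j < n) (j == i)%:R.
Definition partial (i : 'I_n) (F : 'rV[R]_n -> R) : 'rV[R]_n -> R :=
  fun x => derive F x (ebasis i).
Definition grad (F : 'rV[R]_n -> R) (x : 'rV[R]_n) : 'rV[R]_n :=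
  \row_(i < n) partial i F x.
Definition hess_HS (F : 'rV[R]_n -> R) (x : 'rV[R]_n) : R :=
  Num.sqrt (\sum_(i < n) \sum_(j < n) (partial i (partial j F) x) ^+ 2).

Fixpoint Ck (k : nat) (F : 'rV[R]_n -> R) : Prop :=
  continuous F /\
  match k with
  | 0 => True
  | k'.+1 => (forall x, differentiable F x) /\ (forall i, Ck k' (partial i F))
  end.
Definition smooth (F : 'rV[R]_n -> R) : Prop := forall k, Ck k F.

End GaussDefs.

(* Lebesgue integral on R^n of a [0,+oo]-valued function, as an iterated
   integral over the coordinates (equal to the product-measure integral for
   Borel functions, by Tonelli). *)
Fixpoint leb_int {R : realType} (n : nat) : ('rV[R]_n -> \bar R) -> \bar R :=
  match n return ('rV[R]_n -> \bar R) -> \bar R with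
  | 0 => fun F => F 0
  | m.+1 => fun F =>
      (\int[@lebesgue_measure R]_(t in [set: R])
          leb_int (fun y : 'rV[R]_m => F (row_mx (const_mx t : 'rV[R]_1) y)))%E
  end.

Section Gauss.
Context {R : realType} {n : nat}.

Definition gauss_dens (x : 'rV[R]_n) : R :=
  (Num.sqrt (pi *+ 2)) ^- n * expR (- (dotp x x) / 2).

Definition gint_nn (F : 'rV[R]_n -> \bar R) : \bar R :=
  leb_int (fun x => ((gauss_dens x)%:E * F x)%E).

Definition gintE (F : 'rV[R]_n -> R) : \bar R :=
  (gint_nn (fun x => (Num.max (F x) 0)%:E) - gint_nn (fun x => (Num.max (- F x) 0)%:E))%E.
Definition gint (F : 'rV[R]_n -> R) : R := fine (gintE F).

Definition smooth_prob_density (f : 'rV[R]_n -> R) : Prop :=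
  smooth f /\ (forall x, 0 <= f x) /\ gint_nn (fun x => (f x)%:E) = 1%E.

Definition entropy (g : 'rV[R]_n -> R) : \bar R := gintE (fun x => g x * ln (g x)).
Definition fisher (g : 'rV[R]_n -> R) : \bar R :=
  gint_nn (fun x => (dotp (grad g x) (grad g x) / g x)%:E).
Definition deficit (g : 'rV[R]_n -> R) : \bar R :=
  ((2^-1)%:E * fisher g - entropy g)%E.

Definition barycenter (f : 'rV[R]_n -> R) : 'rV[R]_n :=
  \row_(i < n) gint (fun x => x 0 i * f x).

Definition shift_dens (f : 'rV[R]_n -> R) (b : 'rV[R]_n) : 'rV[R]_n -> R :=
  fun x => f (x + b) * expR (- (dotp b x + dotp b b / 2)).

Definition testB (phi : 'rV[R]_n -> R) : Prop :=
  smooth phi /\ (forall x, `|phi x| <= 1) /\ (forall x, enorm (grad phi x) <= 1)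
  /\ (forall x, hess_HS phi x <= 1).

Definition stein_vec (g phi : 'rV[R]_n -> R) : 'rV[R]_n :=
  \row_(i < n) gint (fun x => (x 0 i * phi x - partial i phi x) * g x).
Definition stein_disc (g : 'rV[R]_n -> R) : \bar R :=
  ereal_sup [set (enorm (stein_vec g phi))%:E | phi in testB].

Definition UI_tail (f : 'rV[R]_n -> R) (r : R) : \bar R :=
  ereal_sup [set gint_nn (fun x => (if r < `|dotp alpha x| then (dotp alpha x) ^+ 2 * f x
                                    else 0)%:E)
            | alpha in [set a : 'rV[R]_n | enorm a = 1]].

End Gauss.

(* Main.v *)
(* Ornstein-Uhlenbeck operators F |-> E F(a y + s Z), a^2 + s^2 = 1, interpolate between a
   density h and its mean.  Small steps, each controlled by a local second-order entropy expansion,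
   give the Gaussian logarithmic Sobolev inequality; one large step followed by that inequality
   gives it with the remainder
     Ent h + a^2/2 * E [sum_i variance of d_i h / h under the Mehler kernel] <= I(h)/2.
   For a test function eta supported in |x| <= 1/a with E[eta h] = 0, the Mehler kernel is bounded
   below on the support, and Cauchy-Schwarz bounds E[eta d_i h]^2 by a constant multiple of the
   variance.  By Gaussian integration by parts E[eta d_i h] is E[(x_i eta - d_i eta) h].
   With eta = chi * (phi - c), chi a cutoff at scale 1/a and c the chi-weighted mean of phi,
   this is the Stein vector of the centred density up to an error O(a), where the constant depends
   only on the second moments.  Hence a |Stein| <= C (sqrt delta + a^2) for all small a, and
   choosing a of order |Stein| gives |Stein|^4 <= C delta.
   At r = -1 the uniform integrability modulus is a bound on the second moments. *)
Require Import Defs.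
From HB Require Import structures.
From mathcomp Require Import all_boot all_order all_algebra.
From mathcomp Require Import all_classical all_reals all_analysis.
From mathcomp Require Import measurable_realfun ring lra.
Set Implicit Arguments. Unset Strict Implicit. Unset Printing Implicit Defensive.
Import Order.TTheory GRing.Theory Num.Theory.
Import numFieldNormedType.Exports.
Local Open Scope classical_set_scope.
Local Open Scope ring_scope.

(** * The standard Gaussian measure on row vectors *)

(** Finite steps replace differentiation along the semigroup. A step of size [s] costs an error of
    order [s^3 L^2], where [L] bounds the gradient and the Lipschitz constants of the function and
    of its gradient. Each step also multiplies [L] by [a], so the errors form a geometric series of
    total order [s], and the sharp factor 1/2 survives as [s] tends to 0. A density need be neither
    bounded nor bounded away from 0, which is why the inequality is first proved for truncations and
    then passed to the limit by Fatou's lemma.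

    The scale 1/a of the cutoff keeps the kernel bound uniform in [a]: for |x| <= 1/a the kernel is
    at least a constant times e^(-2|y|^2). The condition E[eta h] = 0 is forced by the use of a
    variance, which does not see constants added to d_i h / h. Subtracting [c] from [phi] is
    harmless for the Stein vector because the density is centred: E[(x_i - b_i) f] = 0. *)

Section RowMeasurable.
Context {R : realType} {n : nat}.

Let coor : 'I_n -> 'rV[R]_n -> R := fun i x => x 0 i.

Let rV_set0 : g_sigma_preimage coor set0.
Proof. exact: sigma_algebra0. Qed.

Let rV_setC A : g_sigma_preimage coor A -> g_sigma_preimage coor (~` A).
Proof. exact: sigma_algebraC. Qed.

Let rV_bigcup (F : (set 'rV[R]_n)^nat) : (forall i, g_sigma_preimage coor (F i)) ->
  g_sigma_preimage coor (\bigcup_i (F i)).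
Proof. exact: sigma_algebra_bigcup. Qed.

(** The sigma-algebra generated by the coordinates, so that measurability of a map into row vectors
    can be checked coordinate by coordinate. *)
HB.instance Definition _ := @isMeasurable.Build (measure_tuple_display default_measure_display)
  'rV[R]_n (g_sigma_preimage coor) rV_set0 rV_setC rV_bigcup.

Lemma measurable_coord (i : 'I_n) : measurable_fun [set: 'rV[R]_n] (fun x => x 0 i).
Proof.
move=> _ Y mY; rewrite setTI; apply: sub_sigma_algebra => /=.
rewrite -bigcup_seq/=; exists i => /=; first by rewrite mem_index_enum.
by exists Y => //; rewrite setTI.
Qed.

End RowMeasurable.

Lemma measurable_rV {R : realType} {n : nat} d (T : measurableType d) (f : T -> 'rV[R]_n) :
  (forall i, measurable_fun [set: T] (fun t => f t 0 i)) -> measurable_fun [set: T] f.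
Proof.
move=> mf.
suff prefS : g_sigma_preimage (fun i t => f t 0 i) `<=` @measurable _ T.
  move: prefS; rewrite (g_sigma_preimage_comp (fun (i : 'I_n) (x : 'rV[R]_n) => x 0 i) f).
  by move=> prefS _ A mA; apply: prefS; exists A.
apply: smallest_sub; first exact: sigma_algebra_measurable.
case: n f mf => [|m] f mf; first by rewrite big_ord0.
rewrite -bigcup_mkord_ord; apply: bigcup_sub => i Ii.
by move=> A [B mB <-]; exact: mf.
Qed.

Section Vcons.
Context {R : realType} {m : nat}.

Definition vcons (t : R) (y : 'rV[R]_m) : 'rV[R]_m.+1 :=
  row_mx (const_mx t : 'rV[R]_1) y.

Lemma vcons0 t y : vcons t y 0 ord0 = t.
Proof.
transitivity ((row_mx (const_mx t : 'rV[R]_1) y) 0 (lshift m (ord0 : 'I_1))).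
  by congr (row_mx _ _ _ _); exact/val_inj.
by rewrite row_mxEl mxE.
Qed.

Lemma vconsS t y i : vcons t y 0 (lift ord0 i) = y 0 i.
Proof.
transitivity ((row_mx (const_mx t : 'rV[R]_1) y) 0 (rshift 1 i)).
  by congr (row_mx _ _ _ _); exact/val_inj.
by rewrite row_mxEr.
Qed.

Lemma sum_vcons (F : R -> R) t y :
  \sum_(i < m.+1) F (vcons t y 0 i) = F t + \sum_(i < m) F (y 0 i).
Proof.
rewrite big_ord_recl vcons0; congr (_ + _).
by apply: eq_bigr => i _; rewrite vconsS.
Qed.

Lemma measurable_vcons :
  measurable_fun [set: R * 'rV[R]_m] (fun p => vcons p.1 p.2).
Proof.
apply: measurable_rV => i; case: (unliftP ord0 i) => [j ->|->].
  under eq_fun do rewrite vconsS.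
  exact: (measurableT_comp (measurable_coord j)).
under eq_fun do rewrite vcons0.
exact: measurable_fst.
Qed.

Lemma measurable_vconsr (t : R) : measurable_fun [set: 'rV[R]_m] (vcons t).
Proof.
apply: measurable_rV => i; case: (unliftP ord0 i) => [j ->|->].
  under eq_fun do rewrite vconsS.
  exact: measurable_coord.
under eq_fun do rewrite vcons0.
exact: measurable_cst.
Qed.

(** Uncurried [vcons] with its first factor typed as [measurableTypeR R], so that it can carry the
    measurable-function structure that [distribution] takes. *)
Definition vcons_pair (p : measurableTypeR R * 'rV[R]_m) : 'rV[R]_m.+1 := vcons p.1 p.2.

Lemma measurable_vcons_pair : measurable_fun setT vcons_pair.
Proof. exact: measurable_vcons. Qed.

HB.instance Definition _ :=
  isMeasurableFun.Build _ _ _ _ vcons_pair measurable_vcons_pair.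

End Vcons.

(** The recursion splits off the first coordinate exactly as [leb_int] does, so the two integrals
    can be compared by induction on the dimension. *)
Fixpoint gaussm {R : realType} (n : nat) : probability 'rV[R]_n R :=
  match n with
  | 0 => \d_(0 : 'rV[R]_0)
  | m.+1 => distribution ((@normal_prob R 0 1) \x gaussm m)%E (@vcons_pair R m)
  end.

Lemma ge0_integral_gaussmS {R : realType} (n : nat) (F : 'rV[R]_n.+1 -> \bar R) :
  measurable_fun [set: 'rV[R]_n.+1] F -> (forall x, 0 <= F x)%E ->
  (\int[gaussm n.+1]_x F x =
   \int[@normal_prob R 0 1]_t \int[gaussm n]_y F (vcons t y))%E.
Proof.
move=> mF F0.
rewrite [LHS](@ge0_integral_distribution _ _ _ _ _ _ (@vcons_pair R n))//.
have mG := measurableT_comp mF (@measurable_vcons_pair R n).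
by rewrite fubini_tonelli1// => p; exact: F0.
Qed.

(** The Radon-Nikodym derivative of [normal_prob] and [normal_pdf] have the same integral over every
    measurable set, hence agree almost everywhere. *)
Lemma ge0_integral_normal_prob {R : realType} (F : R -> \bar R) :
  measurable_fun [set: R] F -> (forall x, 0 <= F x)%E ->
  (\int[@normal_prob R 0 1]_x F x =
   \int[lebesgue_measure]_x ((normal_pdf 0 1 x)%:E * F x))%E.
Proof.
move=> mF F0.
have dom := @normal_prob_dominates R 0 1.
rewrite -(Radon_Nikodym_SigmaFinite.change_of_variables dom)//.
apply: ae_eq_integral => //.
- apply: emeasurable_funM => //; apply: (measurable_int lebesgue_measure).
  exact: Radon_Nikodym_SigmaFinite.f_integrable.
- apply: emeasurable_funM => //; apply/measurable_EFinP.
  exact: measurable_normal_pdf.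
- under [X in ae_eq _ _ _ X]eq_fun do rewrite muleC.
  apply: ae_eqe_mul2l => /=.
  apply: integral_ae_eq => //=.
  + exact: Radon_Nikodym_SigmaFinite.f_integrable.
  + by apply/measurable_EFinP; exact: measurable_normal_pdf.
  + by move=> E _ mE; rewrite -Radon_Nikodym_SigmaFinite.f_integral.
Qed.

Lemma dotp_vcons {R : realType} (n : nat) (t u : R) (x y : 'rV[R]_n) :
  dotp (vcons t x) (vcons u y) = t * u + dotp x y.
Proof.
rewrite /dotp big_ord_recl !vcons0; congr (_ + _).
by apply: eq_bigr => i _; rewrite !vconsS.
Qed.

Lemma normal_pdf01 {R : realType} (t : R) :
  normal_pdf 0 1 t = (Num.sqrt (pi *+ 2))^-1 * expR (- (t * t) / 2).
Proof.
rewrite normal_pdfE ?oner_neq0// /normal_peak /normal_fun expr1n mul1r subr0.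
by rewrite -expr2.
Qed.

Lemma gauss_dens_vcons {R : realType} (n : nat) (t : R) (y : 'rV[R]_n) :
  gauss_dens (vcons t y) = normal_pdf 0 1 t * gauss_dens y.
Proof.
rewrite /gauss_dens dotp_vcons normal_pdf01 opprD mulrDl expRD.
rewrite -!exprVn exprS; ring.
Qed.

Lemma measurable_integral_vcons {R : realType} (n : nat) (F : 'rV[R]_n.+1 -> \bar R) :
  measurable_fun [set: 'rV[R]_n.+1] F -> (forall x, 0 <= F x)%E ->
  measurable_fun [set: R] (fun t => \int[gaussm n]_y F (vcons t y))%E.
Proof.
move=> mF F0; pose G (p : R * 'rV[R]_n) := F (vcons p.1 p.2).
apply: (@measurable_fun_fubini_tonelli_F _ _ _ _ _ (gaussm n) G).
- exact: measurableT_comp mF measurable_vcons.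
- by move=> p; exact: F0.
Qed.

(** The constant [c] strengthens the induction: the density of the first coordinate is a constant
    for the remaining inner integral. *)
Lemma leb_int_gauss {R : realType} (n : nat) (F : 'rV[R]_n -> \bar R) (c : R) : 0 <= c ->
  measurable_fun [set: 'rV[R]_n] F -> (forall x, 0 <= F x)%E ->
  leb_int (fun x => ((c * gauss_dens x)%:E * F x)%E) = (c%:E * \int[gaussm n]_x F x)%E.
Proof.
elim: n F c => [|n IH] F c c0 mF F0.
  rewrite [LHS]/= integral_dirac//= diracT mul1e.
  by rewrite /gauss_dens /dotp big_ord0 oppr0 mul0r expR0 expr0 invr1 !mulr1.
have mFt t : measurable_fun [set: 'rV[R]_n] (fun y => F (vcons t y)).
  exact: measurableT_comp mF (measurable_vconsr t).
transitivity (\int[lebesgue_measure]_t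
    (c%:E * ((normal_pdf 0 1 t)%:E * \int[gaussm n]_y F (vcons t y))))%E.
  apply: eq_integral => t _; rewrite muleA -EFinM -IH//.
  - congr leb_int; apply/funext => y.
    by rewrite -/(vcons t y) gauss_dens_vcons mulrA.
  - by rewrite mulr_ge0// normal_pdf_ge0.
have mL := measurable_integral_vcons mF F0.
rewrite ge0_integralZl//.
- by rewrite -ge0_integral_normal_prob// ?ge0_integral_gaussmS// => t; exact: integral_ge0.
- apply: emeasurable_funM => //; apply/measurable_EFinP.
  exact: measurable_normal_pdf.
- by move=> t _; rewrite mule_ge0 ?integral_ge0// lee_fin normal_pdf_ge0.
Qed.

Lemma gint_nnE {R : realType} (n : nat) (F : 'rV[R]_n -> \bar R) :
  measurable_fun [set: 'rV[R]_n] F -> (forall x, 0 <= F x)%E ->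
  gint_nn F = (\int[gaussm n]_x F x)%E.
Proof.
move=> mF F0; rewrite -[RHS]mul1e -leb_int_gauss//.
by congr leb_int; apply/funext => x; rewrite mul1r.
Qed.

Lemma gintEE {R : realType} (n : nat) (F : 'rV[R]_n -> R) :
  measurable_fun [set: 'rV[R]_n] F -> gintE F = (\int[gaussm n]_x (F x)%:E)%E.
Proof.
move=> mF; rewrite /gintE integralE !gint_nnE.
- by congr (_ - _)%E; apply: eq_integral => x _; rewrite ?funeposE ?funenegE -?EFinN EFin_max.
- by apply/measurable_EFinP; apply: measurable_maxr => //; exact: measurableT_comp.
- by move=> x; rewrite lee_fin le_max lexx orbT.
- by apply/measurable_EFinP; apply: measurable_maxr.
- by move=> x; rewrite lee_fin le_max lexx orbT.
Qed.

Lemma gintR {R : realType} (n : nat) (F : 'rV[R]_n -> R) :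
  measurable_fun [set: 'rV[R]_n] F -> gint F = \int[gaussm n]_x F x.
Proof. by move=> mF; rewrite /gint gintEE. Qed.

(** The pushforward of Lebesgue measure by the affine map, scaled by [s], gives each half-open
    interval its length, so uniqueness of Lebesgue measure applies. *)
Lemma ge0_integral_affine {R : realType} (c s : R) (F : R -> \bar R) : 0 < s ->
  measurable_fun [set: R] F -> (forall x, 0 <= F x)%E ->
  (\int[lebesgue_measure]_x F x =
   s%:E * \int[lebesgue_measure]_x F (c + s * x)%R)%E.
Proof.
move=> s0 mF F0.
pose aff : R -> measurableTypeR R := fun x => c + s * x.
have maff : measurable_fun [set: R] aff.
  by apply: (@measurable_funD _ _ _ _ (cst c)) => //; apply: measurable_funM.
pose mu1 : {measure set (measurableTypeR R) -> \bar R} := pushforward lebesgue_measure aff.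
have s0' : 0 <= s by exact: ltW.
pose mu2 := mscale (NngNum s0') (mu1 maff).
transitivity (\int[mu2]_x F x)%E.
  apply: eq_measure_integral => A mA _; apply: lebesgue_measure_unique => //.
  move=> _ [[a b]] _ <- /=; rewrite /mscale /= /pushforward.
  have -> : aff @^-1` `]a, b]%classic = `](a - c) / s, (b - c) / s]%classic.
    apply/seteqP; split=> x /=; rewrite !in_itv /= /aff ltr_pdivrMr// ler_pdivlMr//.
      by rewrite ltrBlDl lerBrDl (mulrC x).
    by rewrite ltrBlDl lerBrDl (mulrC x).
  rewrite !lebesgue_measure_itv/= !lte_fin ltr_pM2r ?invr_gt0// ltrD2r.
  case: ifP => _; last by rewrite mule0.
  rewrite -!EFinD -EFinM; congr (_%:E); field; exact: lt0r_neq0.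
rewrite ge0_integral_mscale//; congr (_ * _)%E.
by rewrite ge0_integral_pushforward.
Qed.

Lemma ge0_integral_normal_affine {R : realType} (c s : R) (F : R -> \bar R) : 0 < s ->
  measurable_fun [set: R] F -> (forall x, 0 <= F x)%E ->
  (\int[@normal_prob R 0 1]_x F x =
   \int[@normal_prob R 0 1]_x
     ((s * expR (- ((c + s * x) * (c + s * x) - x * x) / 2))%:E * F (c + s * x)%R))%E.
Proof.
move=> s0 mF F0.
have maff : measurable_fun [set: R] (fun x => c + s * x).
  by apply: (@measurable_funD _ _ _ _ (cst c)) => //; apply: measurable_funM.
have mpdf : measurable_fun [set: R] (fun x => (normal_pdf 0 1 x)%:E).
  by apply/measurable_EFinP; exact: measurable_normal_pdf.
have p0 x : (0 <= (normal_pdf 0 1 x : R)%:E)%E by rewrite lee_fin normal_pdf_ge0.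
rewrite !ge0_integral_normal_prob//.
- rewrite (ge0_integral_affine c s0); last 2 first.
  + exact: emeasurable_funM.
  + by move=> x; rewrite mule_ge0.
  rewrite -ge0_integralZl//; last 3 first.
  + by apply: emeasurable_funM; [exact: measurableT_comp mpdf maff|exact: measurableT_comp mF maff].
  + by move=> x _; rewrite mule_ge0.
  + by rewrite lee_fin ltW.
  apply: eq_integral => x _; rewrite !muleA -!EFinM; congr (_%:E * _)%E.
  rewrite !normal_pdf01 mulrCA -!mulrA; congr (_ * _).
  rewrite mulrCA; congr (_ * _); rewrite -expRD; congr expR; ring.
- apply: emeasurable_funM; last exact: measurableT_comp mF maff.
  apply/measurable_EFinP; apply: measurable_funM => //.
  apply: measurableT_comp => //; apply: measurable_funM => //.
  apply: measurableT_comp => //; apply: measurable_funB; exact: measurable_funM.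
- by move=> x; rewrite mule_ge0// lee_fin mulr_ge0 ?expR_ge0// ltW.
Qed.

(* Jacobian-weighted likelihood ratio of x |-> c + s x under the Gaussian. *)
Definition affine_dens {R : realType} (n : nat) (c : 'rV[R]_n) (s : R) (x : 'rV[R]_n) : R :=
  s ^+ n * expR (- (dotp (c + s *: x) (c + s *: x) - dotp x x) / 2).

Lemma affine_dens_ge0 {R : realType} (n : nat) (c : 'rV[R]_n) (s : R) (x : 'rV[R]_n) :
  0 < s -> 0 <= affine_dens c s x.
Proof. by move=> s0; rewrite /affine_dens mulr_ge0 ?expR_ge0// exprn_ge0// ltW. Qed.

Lemma vcons_decomp {R : realType} (n : nat) (x : 'rV[R]_n.+1) :
  x = vcons (x 0 ord0) (\row_i x 0 (lift ord0 i)).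
Proof.
apply/rowP => i; case: (unliftP ord0 i) => [j ->|->].
  by rewrite vconsS mxE.
by rewrite vcons0.
Qed.

Lemma affine_vcons {R : realType} (n : nat) (c0 s t : R) (c y : 'rV[R]_n) :
  vcons c0 c + s *: vcons t y = vcons (c0 + s * t) (c + s *: y).
Proof.
apply/rowP => i; rewrite [LHS]mxE [X in _ + X = _]mxE.
case: (unliftP ord0 i) => [j ->|->].
  by rewrite !vconsS !mxE.
by rewrite !vcons0.
Qed.

Lemma affine_dens_vcons {R : realType} (n : nat) (c0 s t : R) (c y : 'rV[R]_n) :
  affine_dens (vcons c0 c) s (vcons t y) =
  s * expR (- ((c0 + s * t) * (c0 + s * t) - t * t) / 2) * affine_dens c s y.
Proof.
rewrite /affine_dens affine_vcons !dotp_vcons exprS -!mulrA; congr (_ * _).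
rewrite mulrCA; congr (_ * _); rewrite -expRD; congr expR; ring.
Qed.

Lemma measurable_dotp {R : realType} (n : nat) d (T : measurableType d)
  (u v : T -> 'rV[R]_n) : measurable_fun setT u -> measurable_fun setT v ->
  measurable_fun setT (fun x => dotp (u x) (v x)).
Proof.
move=> mu mv; apply: measurable_sum => i; apply: measurable_funM.
  exact: measurableT_comp (measurable_coord i) mu.
exact: measurableT_comp (measurable_coord i) mv.
Qed.

Lemma measurable_affine {R : realType} (n : nat) d (T : measurableType d) (a s : R)
  (u v : T -> 'rV[R]_n) : measurable_fun setT u -> measurable_fun setT v ->
  measurable_fun setT (fun x => a *: u x + s *: v x).
Proof.
move=> mu mv; apply: measurable_rV => i.
under eq_fun do rewrite !mxE.
apply: measurable_funD; apply: measurable_funM => //.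
  exact: measurableT_comp (measurable_coord i) mu.
exact: measurableT_comp (measurable_coord i) mv.
Qed.

Lemma measurable_affine_cst {R : realType} (n : nat) (c : 'rV[R]_n) (s : R) :
  measurable_fun setT (fun x : 'rV[R]_n => c + s *: x).
Proof.
rewrite (_ : (fun x => _) = (fun x : 'rV[R]_n => 1 *: cst c x + s *: id x)); last first.
  by apply/funext => x; rewrite scale1r.
by apply: measurable_affine; [exact: measurable_cst|exact: measurable_id].
Qed.

Lemma measurable_affine_dens {R : realType} (n : nat) (c : 'rV[R]_n) (s : R) :
  measurable_fun setT (affine_dens c s).
Proof.
have maff := measurable_affine_cst c s.
apply: measurable_funM => //; apply: measurableT_comp => //.
apply: measurable_funM => //; apply: measurableT_comp => //.
by apply: measurable_funB; apply: measurable_dotp.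
Qed.

Lemma measurable_affine_densM {R : realType} (n : nat) (c : 'rV[R]_n) (s : R)
  (F : 'rV[R]_n -> \bar R) : measurable_fun setT F ->
  measurable_fun setT (fun x => (affine_dens c s x)%:E * F (c + s *: x)%R)%E.
Proof.
move=> mF; apply: emeasurable_funM.
  by apply/measurable_EFinP; exact: measurable_affine_dens.
exact: measurableT_comp mF (measurable_affine_cst c s).
Qed.

Lemma ge0_integral_gauss_affine {R : realType} (n : nat) (c : 'rV[R]_n) (s : R)
  (F : 'rV[R]_n -> \bar R) : 0 < s ->
  measurable_fun setT F -> (forall x, 0 <= F x)%E ->
  (\int[gaussm n]_x F x = \int[gaussm n]_x ((affine_dens c s x)%:E * F (c + s *: x)%R))%E.
Proof.
move=> s0; elim: n c F => [|n IH] c F mF F0.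
  rewrite !integral_dirac//=; last first.
    exact: measurable_affine_densM.
  rewrite /affine_dens /dotp !big_ord0 subrr oppr0 mul0r expR0 expr0 mulr1 mul1e.
  by congr (_ * F _)%E; apply/rowP => -[].
rewrite [in RHS]ge0_integral_gaussmS; last 2 first.
- exact: measurable_affine_densM.
- by move=> x; rewrite mule_ge0// lee_fin affine_dens_ge0.
rewrite ge0_integral_gaussmS//.
rewrite (ge0_integral_normal_affine (c 0 ord0) s0); last 2 first.
- exact: measurable_integral_vcons.
- by move=> t; exact: integral_ge0.
apply: eq_integral => t _.
set c' := \row_i c 0 (lift ord0 i).
have mFt u : measurable_fun setT (fun y => F (vcons u y)).
  exact: measurableT_comp mF (measurable_vconsr u).
rewrite (IH c')//.
rewrite -ge0_integralZl//.
- apply: eq_integral => y _.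
  by rewrite [in RHS](vcons_decomp c) affine_dens_vcons affine_vcons -/c' EFinM muleA.
- exact: (measurable_affine_densM _ _ (mFt _)).
- by move=> y _; rewrite mule_ge0// lee_fin affine_dens_ge0.
- by rewrite lee_fin mulr_ge0 ?expR_ge0// ltW.
Qed.

(** An open set is a countable union of cubes with rational centres and radii 1/(k+1), and each cube
    is a finite intersection of coordinate conditions. *)
Lemma open_measurable_rV {R : realType} (n : nat) (U : set 'rV[R]_n) :
  open U -> measurable U.
Proof.
move=> oU.
pose B (p : 'rV[rat]_n * nat) := [set y : 'rV[R]_n | forall i, `|ratr (p.1 0 i) - y 0 i| < p.2.+1%:R^-1].
have mB p : measurable (B p).
  rewrite (_ : B p = \bigcap_(i in [set: 'I_n]) [set y : 'rV[R]_n | `|ratr (p.1 0 i) - y 0 i| < p.2.+1%:R^-1]); last first.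
    apply/seteqP; split=> y /=; first by move=> h i _; exact: h.
    by move=> h i; exact: h.
  apply: fin_bigcap_measurable; first exact: finite_finset.
  move=> i _.
  have mi : measurable_fun setT (fun y : 'rV[R]_n => `|ratr (p.1 0 i) - y 0 i| : R).
    apply: measurableT_comp => //; apply: measurable_funB => //; exact: measurable_coord.
  have := mi measurableT _ (measurable_itv `]-oo, (p.2.+1%:R^-1 : R)[).
  by rewrite setTI; congr measurable; apply/seteqP; split => y /=; rewrite in_itv.
rewrite (_ : U = \bigcup_(p in [set p | B p `<=` U]) B p); last first.
  apply/seteqP; split => [x Ux|x [p /= pU]]; last exact: pU.
  have /nbhs_ballP[e /= e0 eU] : nbhs x U by exact: open_nbhs_nbhs.
  (* The factor 2 is there because the cube is centred at a rational point near [x]: every point of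
     it lies within two radii of [x]. *)
  have [k ke] : exists k : nat, 2 * k.+1%:R^-1 < e :> R.
    have e20 : 0 < e / 2 by rewrite divr_gt0.
    have [k hk] := ltr_add_invr e20.
    exists k; rewrite add0r ltr_pdivlMr// in hk; by rewrite mulrC.
  have /choice[q qx] : forall i : 'I_n, exists q : rat, `|ratr q - x 0 i| < k.+1%:R^-1 :> R.
    move=> i; have k0 : 0 < k.+1%:R^-1 :> R by rewrite invr_gt0.
    have lt : x 0 i - k.+1%:R^-1 < x 0 i + k.+1%:R^-1.
      by apply: (@lt_trans _ _ (x 0 i)); rewrite ?ltrDl// ltrBlDr ltrDl.
    have [q] := rat_in_itvoo lt.
    rewrite in_itv/= => /andP[h1 h2]; exists q; by rewrite ltr_distl h1 h2.
  exists (\row_i q i, k) => /=; last by move=> i; rewrite mxE.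
  move=> y By; apply: eU; split=> // j i; rewrite ord1 /ball/=.
  have /= := By i; rewrite mxE => h; have := qx i.
  rewrite (_ : x 0 i - y 0 i = (ratr (q i) - y 0 i) - (ratr (q i) - x 0 i)); last by ring.
  move=> h'; apply: (le_lt_trans (ler_normB _ _)).
  by apply: lt_trans ke; rewrite mulr_natl mulr2n ltrD.
rewrite bigcup_mkcond; apply: countable_bigcupT_measurable; first exact: countableP.
by move=> p; case: ifP.
Qed.

Lemma continuous_measurable_rV {R : realType} (n : nat) (f : 'rV[R]_n -> R) :
  continuous f -> measurable_fun setT f.
Proof.
move=> /continuousP cf.
apply: (measurability _ (RGenOpens.measurableE R)).
by move=> _ [_ [a [b ->] <-]]; rewrite setTI; apply: open_measurable_rV; apply: cf; exact: itv_open.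
Qed.

(** * Scalar inequalities and norms *)

Section ScalarInequalities.
Context {R : realType}.
Implicit Types x y c h u w : R.

Lemma le_is_derive (f f' : R -> R) (a b : R) : a <= b ->
  (forall x, a <= x <= b -> is_derive x 1 f (f' x)) ->
  (forall x, a <= x <= b -> 0 <= f' x) -> f a <= f b.
Proof.
move=> ab df f'0.
have [x||c cab E] := @MVT_segment R f f' a b ab.
- by rewrite in_itv/= => /andP[h1 h2]; apply: df; rewrite !ltW.
- apply: derivable_within_continuous => x; rewrite in_itv/= => h.
  by have [] := df x h.
- rewrite in_itv/= in cab.
  by rewrite -subr_ge0 E mulr_ge0 ?f'0// subr_ge0.
Qed.

(** By parity [x >= 0] suffices; there e^t + e^(-t) - 2 >= 0 is integrated twice from 0. *)
Lemma sqr_le_cosh x : x ^+ 2 <= expR x + expR (- x) - 2.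
Proof.
wlog x0 : x / 0 <= x.
  move=> H; have [/H//|x0] := leP 0 x.
  have := H (- x); rewrite sqrrN opprK oppr_ge0 ltW//.
  by rewrite (addrC (expR x)); apply.
pose g : R -> R := expR - (expR \o -%R) - 2 *: id.
have g0 y : 0 <= y -> 0 <= g y.
  move=> y0; have -> : 0 = g 0.
    by rewrite /g !fctE /= oppr0 subrr scaler0 subr0.
  apply: (@le_is_derive g (fun t => expR t + expR (- t) - 2)) => // t ht.
    apply: is_derive_eq; rewrite /= /GRing.scale/=; ring.
  have := expR_ge1Dx t; have := expR_ge1Dx (- t); lra.
pose k : R -> R := expR + (expR \o -%R) - id ^+ 2.
have : k 0 <= k x.
  apply: (@le_is_derive k g) => // t /andP[t0 _]; last exact: g0.
  apply: is_derive_eq; rewrite /= /g !fctE /= /GRing.scale/=; ring.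
rewrite /k !fctE /= oppr0 expR0; lra.
Qed.

(** The difference of the two sides has derivative x^3 / (1 + x), which has the sign of [x], so its
    minimum on x > -1 is its value 0 at the origin. *)
Lemma ln1D_ub u : -1 < u -> ln (1 + u) <= u - u ^+ 2 / 2 + u ^+ 3 / 3.
Proof.
pose f : R -> R := id - 2^-1 \*: id ^+ 2 + 3^-1 \*: id ^+ 3 - (@ln R \o (cst 1 + id)).
have df x : -1 < x -> is_derive x 1 f (x ^+ 3 / (1 + x)).
  move=> x1.
  have h : is_derive ((cst 1 + id) x) 1 (@ln R) (1 + x)^-1.
    by apply: is_derive1_ln; rewrite !fctE; lra.
  have d1 := is_deriveD (is_derive_cst (1 : R) x 1) (is_derive_id x (1 : R)).
  have d2 := is_derive1_comp h d1.
  have d3 := is_deriveZ (2^-1 : R) (is_deriveX 2 (is_derive_id x (1 : R))).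
  have d4 := is_deriveZ (3^-1 : R) (is_deriveX 3 (is_derive_id x (1 : R))).
  have d5 := is_deriveB (is_deriveD (is_deriveB (is_derive_id x 1) d3) d4) d2.
  rewrite -/f in d5; apply: (is_derive_eq d5); rewrite /GRing.scale /=; field; apply/eqP; lra.
have fE x : f x = x - x ^+ 2 / 2 + x ^+ 3 / 3 - ln (1 + x).
  by rewrite /f !fctE /= /GRing.scale /= (mulrC 2^-1) (mulrC 3^-1).
have f0 : f 0 = 0 by rewrite fE addr0 ln1; ring.
move=> u1; rewrite -subr_ge0 -fE -f0.
have [u0|u0] := leP 0 u.
  apply: (@le_is_derive f (fun x => x ^+ 3 / (1 + x)) _ _ u0) => x /andP[x0 _]; first by apply: df; lra.
  by rewrite divr_ge0// ?exprn_ge0//; lra.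
rewrite -lerN2; apply: (@le_is_derive (- f) (fun x => - (x ^+ 3 / (1 + x))) u 0).
- exact: ltW.
- move=> x /andP[ux _]; apply: (is_deriveN (df x _)); lra.
- move=> x /andP[ux x0]; rewrite -mulNr divr_ge0//; last by lra.
  rewrite (_ : - x ^+ 3 = (- x) ^+ 3); last by ring.
  by rewrite exprn_ge0// oppr_ge0.
Qed.
Lemma lnD_ratio c h : 0 < c -> 0 < h -> ln h = ln c + ln (1 + (h - c) / c).
Proof.
move=> c0 h0; have E : 1 + (h - c) / c = h / c by field; exact: lt0r_neq0.
by rewrite E -lnM ?posrE ?divr_gt0// mulrC divfK// gt_eqF.
Qed.

(** The expression is the Bregman divergence of [x ln x] between [h] and [c]. Its nonnegativity
    allows the logarithm of a mean to be replaced by the logarithm of any positive constant [c],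
    after which the entropy is a plain expectation. *)
Lemma entropy_tangent c h : 0 < c -> 0 < h -> 0 <= h * ln h - h * ln c - h + c.
Proof.
move=> c0 h0; rewrite (lnD_ratio h0 c0).
have := @le_ln1Dx R ((c - h) / h).
rewrite ltr_pdivlMr// => /(_ _)/wrap[]; first lra.
move=> /(ler_wpM2l (ltW h0)).
rewrite (_ : h * ((c - h) / h) = c - h); last by field; exact: lt0r_neq0.
by rewrite mulrDr; set t := h * ln (1 + _); set v := h * ln h; lra.
Qed.

Lemma entropy_quad c h : 0 < c -> 0 < h ->
  h * ln h - h * ln c - h + c <= (h - c) ^+ 2 / c.
Proof.
move=> c0 h0; rewrite (lnD_ratio c0 h0).
have := @le_ln1Dx R ((h - c) / c).
rewrite ltr_pdivlMr// => /(_ _)/wrap[]; first lra.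
move=> /(ler_wpM2l (ltW h0)).
rewrite (_ : (h - c) ^+ 2 / c = h * ((h - c) / c) - (h - c)); last by field; exact: lt0r_neq0.
by rewrite mulrDr; set t := h * ln (1 + _); set v := h * ln c; set w := h * (_ / _); lra.
Qed.

(** With h = c (1 + u) the bound on ln(1 + u) gives c (u^2/2 - u^3/6 + u^4/3), whence the constants
    1/6 and 1/3. The exact coefficient 1/2 of the quadratic term is what later yields the sharp
    logarithmic Sobolev constant. *)
Lemma entropy_taylor c h : 0 < c -> 0 < h ->
  h * ln h - h * ln c - h + c <= (h - c) ^+ 2 / (2 * c) +
    `|h - c| ^+ 3 * ((6^-1 + `|h - c| / (3 * c)) / c ^+ 2).
Proof.
move=> c0 h0; rewrite (lnD_ratio c0 h0).
set u := (h - c) / c.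
have hE : h = c * (1 + u) by rewrite /u; field; exact: lt0r_neq0.
have u1 : -1 < u by rewrite /u ltr_pdivlMr//; lra.
have := ln1D_ub u1; move=> /(ler_wpM2l (ltW h0)) H.
have nu : `|h - c| = c * `|u| by rewrite {1}hE mulrDr mulr1 addrC addKr normrM gtr0_norm.
rewrite nu.
have -> : (h - c) ^+ 2 / (2 * c) = c * (u ^+ 2 / 2).
  rewrite /u; field; exact: lt0r_neq0.
have -> : (c * `|u|) ^+ 3 * ((6^-1 + c * `|u| / (3 * c)) / c ^+ 2) = c * (`|u| ^+ 3 / 6 + `|u| ^+ 4 / 3).
  field; exact: lt0r_neq0.
have u3 : - u ^+ 3 <= `|u| ^+ 3 by rewrite -normrX (le_trans (ler_norm _))// normrN.
have u4 : u ^+ 4 = `|u| ^+ 4 by rewrite -normrX ger0_norm// exprn_even_ge0.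
rewrite mulrDr; set v := h * ln c in H *; set t := h * ln _ in H *.
rewrite -u4.
apply: (@le_trans _ _ (h * (u - u ^+ 2 / 2 + u ^+ 3 / 3) - h + c)); first lra.
rewrite hE -subr_ge0.
rewrite (_ : _ - _ = c * ((`|u| ^+ 3 + u ^+ 3) / 6)); last by field.
by apply: mulr_ge0; [exact: ltW|lra].
Qed.

End ScalarInequalities.

Section L1.
Context {R : realType} {n : nat}.
Implicit Types (x y v : 'rV[R]_n).

(** This norm is additive over coordinates, so its exponential moments factorize along [vcons]. *)
Definition l1 x : R := \sum_(i < n) `|x 0 i|.

Lemma l1_ge0 x : 0 <= l1 x.
Proof. by apply: sumr_ge0 => i _. Qed.

Lemma l1D x y : l1 (x + y) <= l1 x + l1 y.
Proof.
by rewrite -big_split/=; apply: ler_sum => i _; rewrite mxE ler_normD.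
Qed.

Lemma l1Z a x : l1 (a *: x) = `|a| * l1 x.
Proof. by rewrite mulr_sumr; apply: eq_bigr => i _; rewrite mxE normrM. Qed.

Lemma l1_coord x i : `|x 0 i| <= l1 x.
Proof. by rewrite /l1 (bigD1 i)//= lerDl sumr_ge0. Qed.

Lemma dotp_l1 v x L : (forall i, `|v 0 i| <= L) -> `|dotp v x| <= L * l1 x.
Proof.
move=> vL; apply: (le_trans (ler_norm_sum _ _ _)).
by rewrite mulr_sumr; apply: ler_sum => i _; rewrite normrM ler_wpM2r.
Qed.

Lemma measurable_l1 : measurable_fun setT l1.
Proof.
apply: measurable_sum => i.
by apply: measurableT_comp => //; exact: measurable_coord.
Qed.

Lemma dotpC x y : dotp x y = dotp y x.
Proof. by apply: eq_bigr => i _; rewrite mulrC. Qed.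

Lemma dotpDl x y v : dotp (x + y) v = dotp x v + dotp y v.
Proof. by rewrite -big_split; apply: eq_bigr => i _; rewrite mxE mulrDl. Qed.

Lemma dotpZl a x v : dotp (a *: x) v = a * dotp x v.
Proof. by rewrite mulr_sumr; apply: eq_bigr => i _; rewrite mxE mulrA. Qed.

Lemma dotpDr x y v : dotp v (x + y) = dotp v x + dotp v y.
Proof. by rewrite dotpC dotpDl !(dotpC v). Qed.

Lemma dotpZr a x v : dotp v (a *: x) = a * dotp v x.
Proof. by rewrite dotpC dotpZl dotpC. Qed.

Lemma dotp_ge0 x : 0 <= dotp x x.
Proof. by apply: sumr_ge0 => i _; rewrite -expr2 sqr_ge0. Qed.

End L1.

Lemma l1_vcons {R : realType} (n : nat) (t : R) (y : 'rV[R]_n) :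
  l1 (vcons t y) = `|t| + l1 y.
Proof. exact: sum_vcons. Qed.

Lemma integral_normal_expR {R : realType} (c : R) :
  (\int[@normal_prob R 0 1]_x (expR (- (c * x)))%:E = (expR (c ^+ 2 / 2))%:E)%E.
Proof.
have mexp : measurable_fun setT (fun x : R => (expR (- (c * x)))%:E).
  apply/measurable_EFinP; apply: measurableT_comp => //.
  by apply: measurableT_comp => //; exact: measurable_funM.
(* Translation by [c] applied to the constant 1 produces e^(-c x - c^2/2) under the integral; no
   Gaussian integral has to be computed. *)
have := @ge0_integral_normal_affine R c 1 (cst 1%E) ltr01 (measurable_cst _) (fun=> lee01).
rewrite integral_cst// [X in (_ * X)%E](probability_setT (normal_prob 0 1)) mule1 => E.
transitivity ((expR (c ^+ 2 / 2))%:E * \int[@normal_prob R 0 1]_x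
   ((1 * expR (- ((c + 1 * x) * (c + 1 * x) - x * x) / 2))%:E * cst 1 (c + 1 * x)%R))%E.
  rewrite -ge0_integralZl//.
  - by apply: eq_integral => x _; rewrite /= mule1 -EFinM mul1r -expRD; congr (expR _)%:E; field.
  - under eq_fun do rewrite mule1 mul1r.
    apply/measurable_EFinP; apply: measurableT_comp => //; apply: measurable_funM => //.
    apply: measurableT_comp => //; apply: measurable_funB; last exact: measurable_funM.
    by apply: measurable_funM; apply: measurable_funD => //; exact: measurable_funM.
  - by move=> x _; rewrite /= mule1 lee_fin mulr_ge0 ?expR_ge0.
by rewrite -E mule1.
Qed.

Lemma integral_expR_l1_lty {R : realType} (n : nat) (c : R) : 0 <= c ->
  (\int[gaussm n]_x (expR (c * l1 x))%:E < +oo :> \bar R)%E.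
Proof.
move=> c0; elim: n => [|n IH].
  rewrite integral_dirac//= ?diracT ?mul1e ?ltry//.
  apply/measurable_EFinP; apply: measurableT_comp => //.
  by apply: measurable_funM => //; exact: measurable_l1.
have ml k : measurable_fun setT (fun x : 'rV[R]_k => (expR (c * l1 x))%:E).
  apply/measurable_EFinP; apply: measurableT_comp => //.
  by apply: measurable_funM => //; exact: measurable_l1.
rewrite ge0_integral_gaussmS//.
have me (b : R) : measurable_fun setT (fun x : R => (expR (- (b * x)))%:E).
  apply/measurable_EFinP; apply: measurableT_comp => //.
  by apply: measurableT_comp => //; exact: measurable_funM.
have ma : measurable_fun setT (fun x : R => (expR (c * `|x|))%:E).
  apply/measurable_EFinP; apply: measurableT_comp => //.
  by apply: measurable_funM => //; exact: measurableT_comp.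
set K : \bar R := (\int[gaussm n]_x _)%E in IH.
have K0 : (0 <= K)%E by apply: integral_ge0 => y _; rewrite lee_fin expR_ge0.
rewrite [X in (X < _)%E](_ : _ =
    K * \int[@normal_prob R 0 1]_t (expR (c * `|t|))%:E)%E; last first.
  rewrite -ge0_integralZl//.
  apply: eq_integral => t _; rewrite muleC -ge0_integralZl//; last exact: ml.
  by apply: eq_integral => y _; rewrite l1_vcons mulrDr expRD EFinM.
apply: lte_mul_pinfty => //; first by rewrite ge0_fin_numE.
- apply: (@le_lt_trans _ _ (\int[@normal_prob R 0 1]_x
     ((expR (- (c * x)))%:E + (expR (- (- c * x)))%:E))%E).
    apply: ge0_le_integral => //.
    + by apply: emeasurable_funD; exact: me.
    + move=> t _; rewrite -EFinD lee_fin mulNr opprK.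
      have [t0|t0] := leP 0 t.
        by rewrite ger0_norm// ler_wpDl ?expR_ge0.
      by rewrite ltr0_norm// mulrN ler_wpDr ?expR_ge0.
  rewrite ge0_integralD//; try exact: me.
  by rewrite !integral_normal_expR -EFinD ltry.
Qed.

(** * Gaussian expectation *)

Section GaussExpectation.
Context {R : realType} {n : nat}.
Implicit Types (F G : 'rV[R]_n -> R) (x y v : 'rV[R]_n).

Definition gE F : R := \int[gaussm n]_x F x.
Definition gI F := (gaussm n).-integrable [set: 'rV[R]_n] (EFin \o F).
Definition bm F := measurable_fun [set: 'rV[R]_n] F /\ exists C, forall x, `|F x| <= C.

Lemma gI_meas F : gI F -> measurable_fun setT F.
Proof. by move=> /integrableP[/measurable_EFinP]. Qed.

Lemma gI_dom F G : measurable_fun setT F -> gI G -> (forall x, `|F x| <= G x) -> gI F.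
Proof.
move=> mF iG FG; apply: le_integrable iG => //; first exact/measurable_EFinP.
by move=> x _ /=; rewrite lee_fin (le_trans (FG x))// ler_norm.
Qed.

Lemma gI_expl1 c : 0 <= c -> gI (fun x => expR (c * l1 x)).
Proof.
move=> c0; have m : measurable_fun setT (fun x : 'rV[R]_n => expR (c * l1 x)).
  by apply: measurableT_comp => //; apply: measurable_funM => //; exact: measurable_l1.
apply/integrableP; split; first exact/measurable_EFinP.
under eq_integral do rewrite /= ger0_norm ?expR_ge0//.
exact: integral_expR_l1_lty.
Qed.

Lemma gIZ k F : gI F -> gI (fun x => k * F x).
Proof.
move=> iF; rewrite /gI (_ : _ \o _ = (fun x => k%:E * (EFin \o F) x)%E)//.
exact: integrableZl.
Qed.

Lemma gID F G : gI F -> gI G -> gI (fun x => F x + G x).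
Proof.
move=> iF iG; rewrite /gI (_ : _ \o _ = ((EFin \o F) \+ (EFin \o G))%E)//.
exact: integrableD.
Qed.

Lemma gIB F G : gI F -> gI G -> gI (fun x => F x - G x).
Proof.
move=> iF iG; rewrite /gI (_ : _ \o _ = ((EFin \o F) \- (EFin \o G))%E)//.
exact: integrableB.
Qed.

Lemma gI_exp F c C : 0 <= c -> measurable_fun setT F ->
  (forall x, `|F x| <= C * expR (c * l1 x)) -> gI F.
Proof. by move=> c0 mF FC; apply: gI_dom FC => //; apply: gIZ; exact: gI_expl1. Qed.

Lemma gI_bm F : bm F -> gI F.
Proof.
move=> [mF [C FC]]; apply: (@gI_exp F 0 C) => // x.
by rewrite mul0r expR0 mulr1.
Qed.

Lemma gI_cst k : gI (fun=> k).
Proof. by apply: gI_bm; split => //; exists `|k|. Qed.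

Lemma gE_cst k : gE (fun=> k) = k.
Proof.
rewrite /gE Rintegral_cst// [X in fine X](_ : _ = 1%E) ?mulr1//.
exact: probability_setT.
Qed.

Lemma gED F G : gI F -> gI G -> gE (fun x => F x + G x) = gE F + gE G.
Proof. by move=> iF iG; rewrite /gE RintegralD. Qed.

Lemma gEB F G : gI F -> gI G -> gE (fun x => F x - G x) = gE F - gE G.
Proof. by move=> iF iG; rewrite /gE RintegralB. Qed.

Lemma gEZ k F : gI F -> gE (fun x => k * F x) = k * gE F.
Proof. by move=> iF; rewrite /gE RintegralZl. Qed.

Lemma gE_le F G : gI F -> gI G -> (forall x, F x <= G x) -> gE F <= gE G.
Proof. by move=> iF iG FG; apply: le_Rintegral. Qed.

Lemma gE_norm_le F G : gI F -> gI G -> (forall x, `|F x| <= G x) -> `|gE F| <= gE G.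
Proof.
move=> iF iG FG; rewrite ler_norml -[- gE G]mulN1r -gEZ//; apply/andP; split.
  by apply: gE_le => //; [exact: gIZ|move=> x; rewrite mulN1r lerNl (le_trans _ (FG x))// -normrN ler_norm].
by apply: gE_le => // x; rewrite (le_trans _ (FG x))// ler_norm.
Qed.

Lemma gI_sum (I : Type) (s : seq I) (F : I -> 'rV[R]_n -> R) :
  (forall i, gI (F i)) -> gI (fun x => \sum_(i <- s) F i x).
Proof.
move=> iF; elim: s => [|i s IH].
  by under eq_fun do rewrite big_nil; exact: gI_cst.
under eq_fun do rewrite big_cons; exact: gID.
Qed.

Lemma gE_sum (I : Type) (s : seq I) (F : I -> 'rV[R]_n -> R) :
  (forall i, gI (F i)) -> gE (fun x => \sum_(i <- s) F i x) = \sum_(i <- s) gE (F i).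
Proof.
move=> iF; elim: s => [|i s IH].
  by under eq_fun do rewrite big_nil; rewrite big_nil gE_cst.
under eq_fun do rewrite big_cons.
by rewrite gED//; [rewrite big_cons IH|exact: gI_sum].
Qed.

Lemma EFin_gE F : gI F -> (gE F)%:E = (\int[gaussm n]_x (F x)%:E)%E.
Proof. by move=> iF; rewrite /gE /Rintegral fineK//; exact: integrable_fin_num. Qed.

Lemma expR_ge_pow k (u : R) : 0 <= u -> u ^+ k.+1 <= k.+1`!%:R * expR u.
Proof.
move=> u0; have := expR_ge1Dxn k u0.
have f0 : 0 < (k.+1)`!%:R :> R by rewrite ltr0n fact_gt0.
move=> /(ler_wpM2l (ltW f0)); apply: le_trans.
by rewrite mulrDr mulr1 mulrCA divff ?gt_eqF// mulr1 ler_wpDl// ltW.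
Qed.

Lemma gI_l1X k : gI (fun x => l1 x ^+ k).
Proof.
have m : measurable_fun setT (fun x : 'rV[R]_n => l1 x ^+ k).
  by apply: measurable_funX; exact: measurable_l1.
case: k m => [|k] m.
  by apply: (@gI_exp _ 0 1) => // x; rewrite expr0 mul0r expR0 normr1 mulr1.
apply: (@gI_exp _ 1 (k.+1)`!%:R) => // x; rewrite mul1r.
by rewrite ger0_norm ?exprn_ge0 ?l1_ge0// expR_ge_pow// l1_ge0.
Qed.

Lemma measurable_dotpl v : measurable_fun setT (dotp v).
Proof. by apply: measurable_dotp; [exact: measurable_cst|exact: measurable_id]. Qed.

Lemma gI_expdotp v : gI (fun x => expR (dotp v x)).
Proof.
have mv : measurable_fun setT (fun x => expR (dotp v x)).
  by apply: measurableT_comp => //; exact: measurable_dotpl.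
apply: (@gI_exp _ (l1 v) 1) => //; first exact: l1_ge0.
move=> x; rewrite mul1r ger0_norm ?expR_ge0// ler_expR.
apply: le_trans (ler_norm _) _; apply: dotp_l1; exact: l1_coord.
Qed.

Lemma gE_expdotp v : gE (fun x => expR (dotp v x)) = expR (dotp v v / 2).
Proof.
apply: EFin_inj; rewrite EFin_gE; last exact: gI_expdotp.
rewrite (ge0_integral_gauss_affine v ltr01).
- rewrite (eq_integral (fun=> (expR (dotp v v / 2))%:E)); last first.
    move=> x _; rewrite -EFinM /affine_dens expr1n mul1r -expRD; congr (expR _)%:E.
    by rewrite scale1r !dotpDl !dotpDr (dotpC x v); field.
  have := EFin_gE (gI_cst (expR (dotp v v / 2))); by rewrite gE_cst.
- by have /integrableP[] := gI_expdotp v.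
- by move=> x; rewrite lee_fin expR_ge0.
Qed.

Lemma gI_dotp2 v : gI (fun x => dotp v x ^+ 2).
Proof.
apply: (@gI_dom _ (fun x => l1 v ^+ 2 * l1 x ^+ 2)).
- by apply: measurable_funX; exact: measurable_dotpl.
- by apply: gIZ; exact: gI_l1X.
- move=> x; rewrite normrX -exprMn lerXn2r ?nnegrE ?mulr_ge0 ?l1_ge0//.
  by apply: dotp_l1; exact: l1_coord.
Qed.

Lemma expR_ub2 (w : R) : 0 <= w <= 2^-1 -> expR w <= 1 + w + 2 * w ^+ 2.
Proof.
move=> /andP[w0 w1]; have h := expR_ge1Dx (- w).
have e0 : 0 < expR w by exact: expR_gt0.
have := ler_wpM2l (ltW e0) h; rewrite mulrC -expRD subrr expR0; nra.
Qed.

(* Only the moment generating function is used: t^2 E(v.x)^2 <= E(e^(t v.x) + e^(-t v.x) - 2). *)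
Lemma gE_dotp2 v : gE (fun x => dotp v x ^+ 2) <= dotp v v.
Proof.
set d := dotp v v; have d0 : 0 <= d by exact: dotp_ge0.
have key (t : R) : 0 < t -> t ^+ 2 * d <= 1 -> gE (fun x => dotp v x ^+ 2) <= d + t ^+ 2 * d ^+ 2.
  move=> t0 td.
  have H : t ^+ 2 * gE (fun x => dotp v x ^+ 2) <= 2 * expR (t ^+ 2 * d / 2) - 2.
    rewrite -gEZ; last exact: gI_dotp2.
    apply: (@le_trans _ _ (gE (fun x => (expR (dotp (t *: v) x) + expR (dotp (- t *: v) x)) - 2))).
      apply: gE_le.
      - by apply: gIZ; exact: gI_dotp2.
      - by apply: gIB; [apply: gID; exact: gI_expdotp|exact: gI_cst].
      - by move=> x; rewrite -exprMn !dotpZl mulNr; exact: sqr_le_cosh.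
    rewrite gEB; last exact: gI_cst; last by apply: gID; exact: gI_expdotp.
    rewrite gED; [|exact: gI_expdotp..]; rewrite !gE_expdotp gE_cst.
    rewrite !dotpZl !dotpZr -/d (_ : - t * (- t * d) = t ^+ 2 * d); last by ring.
    rewrite mulrA -expr2; lra.
  have := @expR_ub2 (t ^+ 2 * d / 2).
  have td0 : 0 <= t ^+ 2 * d by rewrite mulr_ge0// sqr_ge0.
  move=> /(_ _)/wrap[]; first by apply/andP; split; lra.
  move=> H2; have t20 : 0 < t ^+ 2 by rewrite exprn_gt0.
  rewrite -(ler_pM2l t20); apply: (le_trans H); rewrite mulrDr.
  move: H2; set E := expR _; rewrite expr_div_n exprMn; set T := t ^+ 2; nra.
apply/ler_addgt0Pr => e e0.
(* Chosen so that t^2 (1 + d) <= 1 and t^2 (1 + d^2) <= e, which bring [key] into force with an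
   error of at most [e]. *)
pose t := Num.sqrt (Num.min (1 / (1 + d)) (e / (1 + d ^+ 2))).
have t0' : 0 < Num.min (1 / (1 + d)) (e / (1 + d ^+ 2)).
  by rewrite lt_min !divr_gt0// ?ltr_pwDl ?sqr_ge0.
have t2 : t ^+ 2 = Num.min (1 / (1 + d)) (e / (1 + d ^+ 2)) by rewrite sqr_sqrtr// ltW.
have d10 : 0 < 1 + d by rewrite ltr_pwDl.
have d20 : 0 < 1 + d ^+ 2 by rewrite ltr_pwDl ?sqr_ge0.
have h1 : t ^+ 2 * (1 + d) <= 1 by rewrite t2 -ler_pdivlMr// ge_min lexx.
have h2 : t ^+ 2 * (1 + d ^+ 2) <= e by rewrite t2 -ler_pdivlMr// ge_min lexx orbT.
have t20 : 0 <= t ^+ 2 by exact: sqr_ge0.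
apply: (le_trans (key t _ _)).
- by rewrite sqrtr_gt0.
- lra.
- lra.
Qed.

End GaussExpectation.

(** * Ornstein-Uhlenbeck operators *)

Section Mehler.
Context {R : realType} {n : nat}.
Implicit Types (F G : 'rV[R]_n -> R) (x y z v : 'rV[R]_n) (a s : R).

Lemma gE_fubini (H : 'rV[R]_n -> 'rV[R]_n -> R) C :
  measurable_fun setT (fun p : 'rV[R]_n * 'rV[R]_n => H p.1 p.2) ->
  (forall y z, `|H y z| <= C) ->
  bm (fun y => gE (H y)) /\
  gE (fun y => gE (H y)) = gE (fun z => gE (fun y => H y z)).
Proof.
move=> mH HC.
have iH : (gaussm n \x gaussm n)%E.-integrable setT
    (fun p : 'rV[R]_n * 'rV[R]_n => (H p.1 p.2)%:E).
  apply: measurable_bounded_integrable => //.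
  - have := @product_measure1E _ _ _ _ R (gaussm n) (gaussm n) setT setT measurableT measurableT.
    rewrite setXTT => E; apply: (@le_lt_trans _ _ 1%E); last exact: ltry.
    rewrite [leLHS]E.
    have G1 : gaussm n [set: 'rV[R]_n] = 1%E by exact: probability_setT.
    by rewrite [X in (X * _)%E]G1 [X in (_ * X)%E]G1 mule1.
  - exists C; split; first exact: num_real.
    by move=> M CM p _ /=; rewrite (le_trans (HC _ _))// ltW.
have mH1 y : bm (H y).
  split; last by exists C.
  exact: measurableT_comp mH (measurable_fun_pair (measurable_cst y) (@measurable_id _ _ setT)).
have mH2 z : bm (H^~ z).
  split; last by exists C => y.
  exact: measurableT_comp mH (measurable_fun_pair (@measurable_id _ _ setT) (measurable_cst z)).
have m1 : measurable_fun setT (fun y => gE (H y)).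
  apply/measurable_EFinP.
  have := measurable_fubini_F iH; apply: eq_measurable_fun => y _ /=.
  by rewrite EFin_gE//; exact: gI_bm.
have b1 : bm (fun y => gE (H y)).
  split => //; exists C => y; rewrite -[C](@gE_cst R n).
  by apply: gE_norm_le => //; [exact: gI_bm|exact: gI_cst].
split => //.
have := Fubini iH; rewrite /gE /Rintegral /= => E.
congr fine; transitivity (\int[gaussm n]_y \int[gaussm n]_z (H y z)%:E)%E.
  by apply: eq_integral => y _; rewrite -EFin_gE//; exact: gI_bm.
rewrite E; apply: eq_integral => z _; rewrite -EFin_gE//; exact: gI_bm.
Qed.

(* Meant for a^2 + s^2 = 1: the Ornstein-Uhlenbeck semigroup at the time t with a = e^(-t). *)
Definition ou a s F y : R := gE (fun z => F (a *: y + s *: z)).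

Lemma bm_comp_affine F a s y : bm F -> bm (fun z => F (a *: y + s *: z)).
Proof.
move=> [mF [C FC]]; split; last by exists C.
exact: measurableT_comp mF (measurable_affine _ _ (measurable_cst y) (@measurable_id _ _ setT)).
Qed.

Lemma measurable_comp_affine2 F a s : measurable_fun setT F ->
  measurable_fun setT (fun p : 'rV[R]_n * 'rV[R]_n => F (a *: p.1 + s *: p.2)).
Proof.
by move=> mF; exact: measurableT_comp mF (measurable_affine _ _ measurable_fst measurable_snd).
Qed.

Lemma bm_ou F a s : bm F -> bm (ou a s F).
Proof.
move=> [mF [C FC]].
by have [] := @gE_fubini (fun y z => F (a *: y + s *: z)) C (measurable_comp_affine2 _ _ mF) (fun y z => FC _).
Qed.

(* The density in x, with respect to the Gaussian, of the law of a y + s Z. *)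
Definition mehler a s y x : R :=
  s ^- n * expR (- (a ^+ 2 * dotp x x + a ^+ 2 * dotp y y - 2 * a * dotp y x) / (2 * s ^+ 2)).

Lemma mehler_gt0 a s y x : 0 < s -> 0 < mehler a s y x.
Proof. by move=> s0; rewrite /mehler mulr_gt0 ?expR_gt0// invr_gt0 exprn_gt0. Qed.

Lemma mehlerC a s y x : mehler a s y x = mehler a s x y.
Proof. by rewrite /mehler (dotpC y x) (addrC (_ * dotp x x)). Qed.

(** The weight of the substitution x = a y + s z cancels the kernel: the difference of the exponents
    carries the factor 1 - (a^2 + s^2). *)
Lemma mehler_affine a s y z : 0 < s -> a ^+ 2 + s ^+ 2 = 1 ->
  affine_dens (a *: y) s z * mehler a s y (a *: y + s *: z) = 1.
Proof.
move=> s0 as1; rewrite /affine_dens /mehler mulrACA divff ?mul1r; last first.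
  by rewrite expf_neq0// gt_eqF.
rewrite -expRD -[RHS]expR0; congr expR.
rewrite !dotpDl !dotpDr !dotpZl !dotpZr (dotpC z y).
set Y := dotp y y; set Z := dotp z z; set W := dotp y z.
have sn : s != 0 by rewrite gt_eqF.
transitivity ((1 - (a ^+ 2 + s ^+ 2)) * (a ^+ 2 * Y + 2 * a * s * W + s ^+ 2 * Z) / (2 * s ^+ 2)).
  by field.
by rewrite as1 subrr !mul0r.
Qed.

Lemma measurable_mehler a s :
  measurable_fun setT (fun p : 'rV[R]_n * 'rV[R]_n => mehler a s p.1 p.2).
Proof.
apply: measurable_funM => //; apply: measurableT_comp => //.
apply: measurable_funM => //; apply: measurableT_comp => //.
apply: measurable_funB; last by apply: measurable_funM => //; exact: measurable_dotp.
by apply: measurable_funD; apply: measurable_funM => //; exact: measurable_dotp.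
Qed.

Lemma measurable_mehlerr a s y : measurable_fun setT (mehler a s y).
Proof.
exact: measurableT_comp (measurable_mehler a s)
  (measurable_fun_pair (measurable_cst y) (@measurable_id _ _ setT)).
Qed.

Section Rotation.
Context (a s : R) (s0 : 0 < s) (as1 : a ^+ 2 + s ^+ 2 = 1).

Lemma ge0_integral_mehler y (F : 'rV[R]_n -> \bar R) :
  measurable_fun setT F -> (forall x, 0 <= F x)%E ->
  (\int[gaussm n]_z F (a *: y + s *: z)%R =
   \int[gaussm n]_x ((mehler a s y x)%:E * F x))%E.
Proof.
move=> mF F0; rewrite [RHS](ge0_integral_gauss_affine (a *: y) s0).
- by apply: eq_integral => z _; rewrite muleA -EFinM mehler_affine// mul1e.
- apply: emeasurable_funM => //; apply/measurable_EFinP; exact: measurable_mehlerr.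
- by move=> x; rewrite mule_ge0// lee_fin ltW// mehler_gt0.
Qed.

Lemma integral_mehler1 y : (\int[gaussm n]_x (mehler a s y x)%:E = 1)%E.
Proof.
transitivity (\int[gaussm n]_x ((mehler a s y x)%:E * cst 1 x))%E.
  by apply: eq_integral => x _; rewrite mule1.
rewrite -ge0_integral_mehler// integral_cst// mul1e; exact: probability_setT.
Qed.

Lemma gI_mehlerM y F : bm F -> gI (fun x => mehler a s y x * F x).
Proof.
move=> [mF [C FC]]; apply: (@gI_dom _ _ _ (fun x => C * mehler a s y x)).
- by apply: measurable_funM => //; exact: measurable_mehlerr.
- apply: gIZ; apply/integrableP; split.
    by apply/measurable_EFinP; exact: measurable_mehlerr.
  under eq_integral do rewrite /= (ger0_norm (ltW (mehler_gt0 _ _ _ s0))).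
  by rewrite integral_mehler1 ltry.
- move=> x; have m0 := ltW (mehler_gt0 a y x s0).
  by rewrite normrM ger0_norm// mulrC ler_wpM2r.
Qed.

Lemma gE_mehler1 y : gE (mehler a s y) = 1.
Proof. by rewrite /gE /Rintegral integral_mehler1. Qed.

Lemma bm_cst k : bm (fun _ : 'rV[R]_n => k).
Proof. by split => //; exists `|k|. Qed.

Lemma bmD F G : bm F -> bm G -> bm (fun x => F x + G x).
Proof.
move=> [mF [C FC]] [mG [D GD]]; split; first exact: measurable_funD.
by exists (C + D) => x; rewrite (le_trans (ler_normD _ _))// lerD.
Qed.

Lemma ou_mehler F y : bm F -> ou a s F y = gE (fun x => mehler a s y x * F x).
Proof.
(* Adding a bound [C] of [F] makes it nonnegative, and both sides change by [C] because the kernel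
   has mass 1. *)
wlog F0 : F / (forall x, 0 <= F x).
  move=> H bF; have [mF [C FC]] := bF.
  have bFC : bm (fun x => F x + C) by apply: bmD => //; exact: bm_cst.
  have := H (fun x => F x + C) _ bFC => /(_ _)/wrap[].
    by move=> x; have := FC x; rewrite ler_norml -lerBlDr sub0r => /andP[].
  rewrite /ou gED; last exact: gI_cst; last by apply: gI_bm; exact: bm_comp_affine.
  rewrite gE_cst; under [in RHS]eq_fun do rewrite mulrDr.
  rewrite gED; last exact/gI_mehlerM/bm_cst; last exact: gI_mehlerM.
  under [X in _ = _ + gE X]eq_fun do rewrite mulrC.
  have i1 : gI (mehler a s y).
    by have := gI_mehlerM y (bm_cst 1); under eq_fun do rewrite mulr1.
  by rewrite gEZ// gE_mehler1 mulr1 => /addIr.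
move=> bF; apply: EFin_inj; rewrite EFin_gE; last exact: gI_mehlerM.
rewrite EFin_gE; last by apply: gI_bm; exact: bm_comp_affine.
under [in RHS]eq_integral do rewrite EFinM.
rewrite -(@ge0_integral_mehler y (EFin \o F))//.
by apply/measurable_EFinP; case: bF.
Qed.

(** Invariance of the Gaussian measure: after Tonelli, the symmetry of the kernel lets its integral
    over the other variable be evaluated to 1. *)
Lemma gE_ou F : bm F -> gE (ou a s F) = gE F.
Proof.
wlog F0 : F / (forall x, 0 <= F x).
  move=> H bF; have [mF [C FC]] := bF.
  have bFC : bm (fun x => F x + C) by apply: bmD => //; exact: bm_cst.
  have := H (fun x => F x + C) _ bFC => /(_ _)/wrap[].
    by move=> x; have := FC x; rewrite ler_norml -lerBlDr sub0r => /andP[].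
  rewrite gED; last exact: gI_cst; last exact: gI_bm.
  rewrite (_ : ou a s _ = (fun x => ou a s F x + C)); last first.
    apply/funext => y; rewrite /ou gED ?gE_cst//; last exact: gI_cst.
    by apply: gI_bm; exact: bm_comp_affine.
  rewrite gED ?gE_cst; first by move=> /addIr.
    by apply: gI_bm; exact: bm_ou.
  exact: gI_cst.
move=> bF; have bP := bm_ou a s bF; have [mF _] := bF.
apply: EFin_inj; rewrite !EFin_gE; try exact: gI_bm.
transitivity (\int[gaussm n]_y \int[gaussm n]_x ((mehler a s y x)%:E * (F x)%:E))%E.
  apply: eq_integral => y _; rewrite ou_mehler// EFin_gE; last exact: gI_mehlerM.
  by apply: eq_integral => x _; rewrite EFinM.
rewrite (@fubini_tonelli _ _ _ _ _ (gaussm n) (gaussm n)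
  (fun p : 'rV[R]_n * 'rV[R]_n => (mehler a s p.1 p.2)%:E * (F p.2)%:E)%E)/=.
- apply: eq_integral => x _; rewrite ge0_integralZr ?lee_fin//.
  + under eq_integral do rewrite mehlerC.
    by rewrite integral_mehler1 mul1e.
  + apply/measurable_EFinP; under eq_fun do rewrite mehlerC; exact: measurable_mehlerr.
  + by move=> y _; rewrite lee_fin ltW// mehler_gt0.
- apply: emeasurable_funM; apply/measurable_EFinP; first exact: measurable_mehler.
  exact: measurableT_comp mF measurable_snd.
- by move=> p; rewrite mule_ge0// lee_fin// ltW// mehler_gt0.
Qed.

End Rotation.
End Mehler.

(** * Positive bounded functions with Lipschitz gradient *)

Section LipClass.
Context {R : realType} {n : nat}.
Implicit Types (F G h u : 'rV[R]_n -> R) (V : 'rV[R]_n -> 'rV[R]_n) (x y z w v : 'rV[R]_n) (a s e M L : R).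

Lemma lip_continuous F K : (forall x w, `|F (x + w) - F x| <= K * l1 w) -> continuous F.
Proof.
move=> FK x; apply/(cvgrPdist_lt (FF := nbhs_filter x)) => eps eps0.
pose d := eps / (`|K| * n%:R + 1).
have d1 : 0 < `|K| * n%:R + 1 by rewrite ltr_wpDl// mulr_ge0.
have d0 : 0 < d by rewrite divr_gt0.
apply/nbhs_ballP; exists d => //= y [_ xy].
have -> : y = x + (y - x) by rewrite addrC subrK.
rewrite distrC; apply: (le_lt_trans (FK _ _)).
have l : l1 (y - x) <= n%:R * d.
  rewrite /l1 (_ : n%:R * d = \sum_(i < n) d); last first.
    by rewrite sumr_const card_ord mulr_natl.
  apply: ler_sum => i _; rewrite !mxE distrC ltW//.
  exact: xy.
apply: (@le_lt_trans _ _ (`|K| * n%:R * d)).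
  rewrite -mulrA; apply: le_trans (ler_wpM2l (normr_ge0 K) l).
  by apply: ler_wpM2r; [exact: l1_ge0|exact: ler_norm].
by rewrite /d mulrCA gtr_pMr// ltr_pdivrMr// mul1r ltrDl.
Qed.

Lemma lip_measurable F K : (forall x w, `|F (x + w) - F x| <= K * l1 w) ->
  measurable_fun setT F.
Proof. by move=> /lip_continuous/continuous_measurable_rV. Qed.

(* V plays the role of the gradient of h: all that is used of differentiability is the
   first-order Taylor bound, which is stable under the Ornstein-Uhlenbeck operators. *)
Record pos_c11 e M L h V : Prop := PosC11 {
  pos_c11_lo : forall x, e <= h x;
  pos_c11_hi : forall x, h x <= M;
  pos_c11_V : forall x i, `|V x 0 i| <= L;
  pos_c11_lip : forall x w, `|h (x + w) - h x| <= L * l1 w;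
  pos_c11_Vlip : forall x w i, `|V (x + w) 0 i - V x 0 i| <= L * l1 w;
  pos_c11_taylor : forall x w, `|h (x + w) - h x - dotp (V x) w| <= L * l1 w ^+ 2 }.

Definition fq h V x : R := dotp (V x) (V x) / h x.
Definition Ent h : R := gE (fun x => h x * ln (h x)) - gE h * ln (gE h).
(* Gradient of [ou a s h] when V is the gradient of h. *)
Definition ou_grad a s V y : 'rV[R]_n := \row_i (a * ou a s (fun x => V x 0 i) y).

Lemma bm_mul F G : bm F -> bm G -> bm (fun x => F x * G x).
Proof.
move=> [mF [C FC]] [mG [D GD]]; split; first exact: measurable_funM.
by exists (C * D) => x; rewrite normrM ler_pM.
Qed.

Lemma bm_sum (I : Type) (r : seq I) (F : I -> 'rV[R]_n -> R) :
  (forall i, bm (F i)) -> bm (fun x => \sum_(i <- r) F i x).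
Proof.
move=> bF; elim: r => [|i r IH].
  by under eq_fun do rewrite big_nil; exact: bm_cst.
by under eq_fun do rewrite big_cons; apply: bmD.
Qed.

Lemma bm_ln h e M : 0 < e -> measurable_fun setT h -> (forall x, e <= h x <= M) ->
  bm (fun x => ln (h x)).
Proof.
move=> e0 mh hh; split; first exact: measurableT_comp.
exists (`|ln e| + `|ln M|) => x; have /andP[h1 h2] := hh x.
have h0 := lt_le_trans e0 h1.
have l1 : ln e <= ln (h x) by rewrite ler_ln ?posrE.
have l2 : ln (h x) <= ln M by rewrite ler_ln ?posrE// (lt_le_trans h0).
rewrite ler_norml; apply/andP; split.
  have := ler_norm (- ln e); have := normr_ge0 (ln M); rewrite normrN; lra.
have := ler_norm (ln M); have := normr_ge0 (ln e); lra.
Qed.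

Lemma bm_inv h e M : 0 < e -> measurable_fun setT h -> (forall x, e <= h x <= M) ->
  bm (fun x => (h x)^-1).
Proof.
move=> e0 mh hh; have bl := bm_ln e0 mh hh.
have h0 x : 0 < h x by have /andP[h1 _] := hh x; exact: lt_le_trans h1.
split; last first.
  exists e^-1 => x; have /andP[h1 _] := hh x.
  by rewrite ger0_norm; [rewrite lef_pV2 ?posrE|rewrite invr_ge0 ltW].
rewrite (_ : (fun x => _) = (fun x => expR (- ln (h x)))); last first.
  by apply/funext => x; rewrite expRN lnK ?posrE.
by apply: measurableT_comp => //; apply: measurableT_comp => //; exact: bl.1.
Qed.

Section ClsFacts.
Context e M L h V (e0 : 0 < e) (hV : pos_c11 e M L h V).

Lemma pos_c11_gt0 x : 0 < h x.
Proof. exact: lt_le_trans e0 (pos_c11_lo hV x). Qed.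

Lemma pos_c11_rng x : e <= h x <= M.
Proof. by rewrite (pos_c11_lo hV) (pos_c11_hi hV). Qed.

Lemma pos_c11_bm : bm h.
Proof.
split; first exact: lip_measurable (pos_c11_lip hV).
by exists M => x; rewrite (ger0_norm (ltW (pos_c11_gt0 x))) (pos_c11_hi hV).
Qed.

Lemma pos_c11_bmV i : bm (fun x => V x 0 i).
Proof.
split; last by exists L => x; exact: pos_c11_V hV _ _.
by apply: lip_measurable => x w; exact: pos_c11_Vlip hV _ _ _.
Qed.

Lemma pos_c11_bm_ln : bm (fun x => ln (h x)).
Proof. by apply: (bm_ln e0 _ pos_c11_rng); exact: pos_c11_bm.1. Qed.

Lemma pos_c11_bm_xln : bm (fun x => h x * ln (h x)).
Proof. by apply: bm_mul; [exact: pos_c11_bm|exact: pos_c11_bm_ln]. Qed.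

Lemma pos_c11_bm_inv : bm (fun x => (h x)^-1).
Proof. by apply: (bm_inv e0 _ pos_c11_rng); exact: pos_c11_bm.1. Qed.

Lemma pos_c11_bm_fq : bm (fq h V).
Proof.
apply: bm_mul; last exact: pos_c11_bm_inv.
by apply: bm_sum => i; apply: bm_mul; exact: pos_c11_bmV.
Qed.

End ClsFacts.

Lemma ou_between a s F lo hi y : bm F -> (forall x, lo <= F x <= hi) -> lo <= ou a s F y <= hi.
Proof.
move=> bF Fh; have i1 : gI (fun z => F (a *: y + s *: z)) by apply/gI_bm/bm_comp_affine.
apply/andP; split; [rewrite -[leLHS](@gE_cst R n)|rewrite -[leRHS](@gE_cst R n)].
  apply: gE_le => //; first exact: gI_cst.
  by move=> z; have /andP[] := Fh (a *: y + s *: z).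
apply: gE_le => //; first exact: gI_cst.
by move=> z; have /andP[] := Fh (a *: y + s *: z).
Qed.

Lemma ou_lip a s F K y w : 0 <= a -> bm F -> (forall x w, `|F (x + w) - F x| <= K * l1 w) ->
  `|ou a s F (y + w) - ou a s F y| <= a * (K * l1 w).
Proof.
move=> a0 bF FK; rewrite /ou -gEB; try by apply/gI_bm/bm_comp_affine.
rewrite -[leRHS](@gE_cst R n); apply: gE_norm_le.
- by apply: gIB; apply/gI_bm/bm_comp_affine.
- exact: gI_cst.
- move=> x; rewrite scalerDr addrAC; apply: (le_trans (FK _ _)).
  by rewrite l1Z ger0_norm// mulrCA.
Qed.

(** The gain from [L] to [a * L] drives the iteration: the errors of successive steps decrease
    geometrically. *)
Lemma pos_c11_ou a s e M L h V : 0 < e -> 0 <= a <= 1 -> pos_c11 e M L h V ->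
  pos_c11 e M (a * L) (ou a s h) (ou_grad a s V).
Proof.
move=> e0 /andP[a0 a1] hV; have bh := pos_c11_bm e0 hV; have bV := pos_c11_bmV hV.
have Ll1 x : 0 <= L * l1 x by exact: le_trans (normr_ge0 _) (pos_c11_lip hV 0 x).
split.
- by move=> y; have /andP[] := ou_between a s y bh (pos_c11_rng hV).
- by move=> y; have /andP[] := ou_between a s y bh (pos_c11_rng hV).
- move=> y i; rewrite mxE normrM ger0_norm// ler_wpM2l// ler_norml.
  apply: (ou_between _ _ _ (bV i)) => x; rewrite -ler_norml; exact: pos_c11_V hV _ _.
- by move=> y w; rewrite -mulrA; apply: ou_lip => //; exact: pos_c11_lip hV.
- move=> y w i; rewrite !mxE -mulrBr normrM ger0_norm// -mulrA ler_wpM2l//.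
  apply: le_trans (ou_lip s y w a0 (bV i) (fun x w => pos_c11_Vlip hV x w i)) _.
  by rewrite ler_piMl.
- move=> y w.
  have -> : dotp (ou_grad a s V y) w = gE (fun z => dotp (V (a *: y + s *: z)) (a *: w)).
    rewrite /dotp gE_sum; last first.
      move=> i; under eq_fun do rewrite mulrC.
      by apply/gIZ/gI_bm/(bm_comp_affine a s y (bV i)).
    apply: eq_bigr => i _; under eq_fun do rewrite mulrC.
    by rewrite gEZ; [rewrite !mxE /ou /=; ring|apply/gI_bm/(bm_comp_affine a s y (bV i))].
  have i1 : gI (fun z => dotp (V (a *: y + s *: z)) (a *: w)).
    apply: gI_sum => i; under eq_fun do rewrite mulrC.
    by apply/gIZ/gI_bm/(bm_comp_affine a s y (bV i)).
  have i2 x : gI (fun z => h (a *: x + s *: z)) by apply/gI_bm/bm_comp_affine.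
  rewrite /ou -gEB// -gEB//; last exact: gIB.
  rewrite -[leRHS](@gE_cst R n); apply: gE_norm_le.
  + by apply: gIB => //; exact: gIB.
  + exact: gI_cst.
  + move=> z; have -> : a *: (y + w) + s *: z = (a *: y + s *: z) + a *: w.
      by rewrite scalerDr addrAC.
    apply: (le_trans (pos_c11_taylor hV _ _)).
    rewrite l1Z ger0_norm// exprMn mulrA (mulrC L) expr2 -!mulrA ler_wpM2l//.
    rewrite mulrA -[leRHS]mul1r -mulrA ler_wpM2r//.
    by rewrite expr2 mulrA mulr_ge0// l1_ge0.
Qed.

(** With [y] frozen, the function of the noise stays in the class, so an inequality for the class
    also applies conditionally on [y]. *)
Lemma pos_c11_comp a s e M L h V y : 0 <= s <= 1 -> pos_c11 e M L h V ->
  pos_c11 e M L (fun z => h (a *: y + s *: z)) (fun z => s *: V (a *: y + s *: z)).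
Proof.
move=> /andP[s0 s1] hV.
have Ll1 x : 0 <= L * l1 x by exact: le_trans (normr_ge0 _) (pos_c11_lip hV 0 x).
split.
- by move=> z; exact: pos_c11_lo hV _.
- by move=> z; exact: pos_c11_hi hV _.
- move=> z i; rewrite mxE normrM ger0_norm//; apply: le_trans (pos_c11_V hV (a *: y + s *: z) i).
  by rewrite ler_piMl.
- move=> z w; rewrite scalerDr addrA; apply: (le_trans (pos_c11_lip hV _ _)).
  by rewrite l1Z ger0_norm// mulrCA ler_piMl.
- move=> z w i; rewrite !mxE -mulrBr normrM ger0_norm// scalerDr addrA.
  apply: le_trans (_ : s * (L * l1 (s *: w)) <= _).
    by rewrite ler_wpM2l// (pos_c11_Vlip hV).
  rewrite l1Z ger0_norm// (_ : s * (L * (s * l1 w)) = (s * s) * (L * l1 w)); last by ring.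
  by apply: ler_piMl => //; rewrite mulr_ile1.
- move=> z w; rewrite dotpZl -dotpZr scalerDr addrA; apply: (le_trans (pos_c11_taylor hV _ _)).
  rewrite l1Z ger0_norm// exprMn mulrCA; apply: ler_piMl.
    by rewrite expr2 mulrA mulr_ge0// l1_ge0.
  by rewrite exprn_ile1.
Qed.
End LipClass.

(** * The logarithmic Sobolev inequality with remainder *)

Section LogSobolev.
Context {R : realType} {n : nat}.
Implicit Types (F G h u : 'rV[R]_n -> R) (V : 'rV[R]_n -> 'rV[R]_n) (x y z w v : 'rV[R]_n) (a s e M L : R).

Definition fq_lip_const e L0 : R := 2 * n%:R / e + n%:R * L0 / e ^+ 2.

(** The factor L^2 is kept because [L] will shrink along the iteration, while the remaining
    occurrence of [L] is bounded by the fixed [L0], so that one constant serves all steps. *)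
Lemma fq_lip e M L L0 h V x w : 0 < e -> 0 <= L <= L0 -> pos_c11 e M L h V ->
  `|fq h V (x + w) - fq h V x| <= fq_lip_const e L0 * L ^+ 2 * l1 w.
Proof.
move=> e0 /andP[L0' LL0] hV.
have hx := pos_c11_gt0 e0 hV x; have hxw := pos_c11_gt0 e0 hV (x + w).
have lx := pos_c11_lo hV x; have lxw := pos_c11_lo hV (x + w).
have l0 := l1_ge0 w.
set A := dotp (V x) (V x); set B := dotp (V (x + w)) (V (x + w)).
have AB : `|B - A| <= n%:R * (L * l1 w * (2 * L)).
  rewrite /A /B /dotp -sumrB; apply: (le_trans (ler_norm_sum _ _ _)).
  rewrite (_ : n%:R * _ = \sum_(i < n) (L * l1 w * (2 * L))); last first.
    by rewrite sumr_const card_ord mulr_natl.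
  apply: ler_sum => i _.
  rewrite (_ : _ - _ = (V (x + w) 0 i - V x 0 i) * (V (x + w) 0 i + V x 0 i)); last by ring.
  rewrite normrM ler_pM//; first exact: pos_c11_Vlip hV _ _ _.
  rewrite (le_trans (ler_normD _ _))// mulr_natl mulr2n lerD//; exact: pos_c11_V hV _ _.
have A1 : 0 <= A <= n%:R * L ^+ 2.
  rewrite dotp_ge0/= /A /dotp (_ : n%:R * _ = \sum_(i < n) (L ^+ 2)); last first.
    by rewrite sumr_const card_ord mulr_natl.
  apply: ler_sum => i _; rewrite -expr2 -real_normK ?num_real//.
  by rewrite lerXn2r ?nnegrE//; exact: pos_c11_V hV _ _.
have hh := pos_c11_lip hV x w.
rewrite /fq -/A -/B.
rewrite (_ : _ - _ = (B - A) / h (x + w) + A * (h x - h (x + w)) / (h x * h (x + w))); last first.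
  by field; rewrite !gt_eqF.
have i1 : (h (x + w))^-1 <= e^-1 by rewrite lef_pV2 ?posrE.
have i2 : (h x)^-1 <= e^-1 by rewrite lef_pV2 ?posrE.
have p1 : 0 <= (h (x + w))^-1 by rewrite invr_ge0 ltW.
have p2 : 0 <= (h x)^-1 by rewrite invr_ge0 ltW.
apply: (le_trans (ler_normD _ _)).
rewrite (_ : fq_lip_const e L0 * L ^+ 2 * l1 w =
  n%:R * (L * l1 w * (2 * L)) * e^-1 + (n%:R * L ^+ 2) * (L0 * l1 w) * (e^-1 * e^-1)); last first.
  by rewrite /fq_lip_const; field; rewrite gt_eqF.
apply: lerD.
  by rewrite normrM ler_pM// ger0_norm.
have /andP[A0 A2] := A1.
rewrite invfM !normrM (ger0_norm A0) (ger0_norm p1) (ger0_norm p2).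
apply: ler_pM; rewrite ?mulr_ge0//; last by apply: ler_pM.
apply: ler_pM => //; rewrite distrC (le_trans hh)// ler_wpM2r//.
Qed.

Definition taylor_const e M : R := (6^-1 + M / (3 * e)) / e ^+ 2.

Definition local_const e M L0 : R := gE (fun z : 'rV[R]_n => l1 z ^+ 3) * (e^-1 + L0 * taylor_const e M).

(** The logarithm of the mean is replaced by the logarithm of [c], the value at zero noise, through
    [entropy_tangent]. The second-order expansion then leaves s^2 E[(V.z)^2] / (2c), at most s^2
    |V|^2 / (2c), and third-order terms in the noise. *)
Lemma local_entropy a s e M L L0 h V y : 0 < e -> 0 < s -> 0 <= L <= L0 -> pos_c11 e M L h V ->
  ou a s (fun x => h x * ln (h x)) y - ou a s h y * ln (ou a s h y) <=
  s ^+ 2 / 2 * fq h V (a *: y) + s ^+ 3 * L ^+ 2 * local_const e M L0.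
Proof.
move=> e0 s0 /andP[L0' LL0] hV.
set c := h (a *: y); have c0 : 0 < c := pos_c11_gt0 e0 hV _.
have ce : e <= c := pos_c11_lo hV _.
have cM : c <= M := pos_c11_hi hV _.
have bh := pos_c11_bm e0 hV; have bx := pos_c11_bm_xln e0 hV.
have iX : gI (fun z => h (a *: y + s *: z) * ln (h (a *: y + s *: z))).
  exact/gI_bm/(bm_comp_affine a s y bx).
have ih : gI (fun z => h (a *: y + s *: z)) by exact/gI_bm/(bm_comp_affine a s y bh).
have P0 : 0 < ou a s h y.
  by have /andP[+ _] := ou_between a s y bh (pos_c11_rng hV); exact: lt_le_trans.
apply: (@le_trans _ _ (ou a s (fun x => h x * ln (h x)) y - ou a s h y * ln c - ou a s h y + c)).
  have := entropy_tangent c0 P0; lra.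
have iL : gI (fun z => ln c * h (a *: y + s *: z)) by exact: gIZ.
rewrite /ou (mulrC _ (ln c)) -gEZ// -gEB// -gEB//; last exact: gIB.
rewrite -[X in _ + X <= _](@gE_cst R n) -gED; [|by apply: gIB => //; exact: gIB|exact: gI_cst].
pose G z := s ^+ 2 / (2 * c) * dotp (V (a *: y)) z ^+ 2
  + s ^+ 3 * L ^+ 2 * (e^-1 + L0 * taylor_const e M) * l1 z ^+ 3.
have t0 : 0 <= taylor_const e M.
  by rewrite /taylor_const divr_ge0 ?sqr_ge0// addr_ge0 ?divr_ge0 ?mulr_ge0 ?ltW// (lt_le_trans c0).
have iG1 : gI (fun z => s ^+ 2 / (2 * c) * dotp (V (a *: y)) z ^+ 2) by apply: gIZ; exact: gI_dotp2.
have iG2 : gI (fun z : 'rV[R]_n => s ^+ 3 * L ^+ 2 * (e^-1 + L0 * taylor_const e M) * l1 z ^+ 3).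
  by apply: gIZ; exact: gI_l1X.
apply: (@le_trans _ _ (gE G)); last first.
  rewrite /G gED// !gEZ; [|exact: gI_l1X|exact: gI_dotp2].
  apply: lerD; last by rewrite /local_const le_eqVlt; apply/orP; left; apply/eqP; ring.
  rewrite /fq -/c (_ : s ^+ 2 / 2 * _ = s ^+ 2 / (2 * c) * dotp (V (a *: y)) (V (a *: y))); last first.
    by field; rewrite gt_eqF.
  rewrite ler_wpM2l//; last exact: gE_dotp2.
  by apply: divr_ge0; [exact: sqr_ge0|rewrite mulr_ge0// ltW].
apply: gE_le; [|exact: gID|].
  by apply: gID; [apply: gIB => //; exact: gIB|exact: gI_cst].
move=> z; set H := h (a *: y + s *: z).
have H0 : 0 < H := pos_c11_gt0 e0 hV _.
have HM : H <= M := pos_c11_hi hV _.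
rewrite (mulrC (ln c)).
apply: (le_trans (entropy_taylor c0 H0)).
set D := H - c.
have l0 := l1_ge0 z.
set d := dotp (V (a *: y)) z.
have D1 : `|D| <= L * (s * l1 z).
  have := pos_c11_lip hV (a *: y) (s *: z); rewrite l1Z (gtr0_norm s0); exact.
have D2 : `|D - s * d| <= L * (s * l1 z) ^+ 2.
  have := pos_c11_taylor hV (a *: y) (s *: z).
  rewrite l1Z (gtr0_norm s0) dotpZr; exact.
have d1 : `|s * d| <= L * (s * l1 z).
  rewrite normrM (gtr0_norm s0) mulrCA ler_wpM2l//; first exact: ltW.
  by apply: dotp_l1; exact: pos_c11_V hV _.
have DM : `|D| <= M.
  rewrite ler_norml /D; apply/andP; split; lra.
have sl0 : 0 <= s * l1 z by rewrite mulr_ge0// ltW.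
have DD : D ^+ 2 <= (s * d) ^+ 2 + 2 * (L ^+ 2 * (s * l1 z) ^+ 3).
  rewrite -lerBlDl (_ : _ - _ = (D - s * d) * (D + s * d)); last by ring.
  apply: le_trans (ler_norm _) _; rewrite normrM.
  apply: (@le_trans _ _ ((L * (s * l1 z) ^+ 2) * (2 * (L * (s * l1 z))))); last first.
    by rewrite le_eqVlt; apply/orP; left; apply/eqP; ring.
  apply: ler_pM => //; apply: (le_trans (ler_normD _ _)); lra.
have D3 : `|D| ^+ 3 <= L0 * (L ^+ 2 * (s * l1 z) ^+ 3).
  apply: (@le_trans _ _ ((L * (s * l1 z)) ^+ 3)).
    by rewrite lerXn2r ?nnegrE// mulr_ge0.
  rewrite (_ : _ ^+ 3 = L * (L ^+ 2 * (s * l1 z) ^+ 3)); last by ring.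
  by rewrite ler_wpM2r// mulr_ge0 ?sqr_ge0 ?exprn_ge0.
have tc : (6^-1 + `|D| / (3 * c)) / c ^+ 2 <= taylor_const e M.
  rewrite /taylor_const; apply: ler_pM.
  - by rewrite addr_ge0// divr_ge0// mulr_ge0// ltW.
  - by rewrite invr_ge0 sqr_ge0.
  - rewrite lerD2l; apply: ler_pM => //.
      by rewrite invr_ge0 mulr_ge0// ltW.
    by rewrite lef_pV2 ?posrE ?mulr_gt0// ler_pM2l.
  - by rewrite lef_pV2 ?posrE ?exprn_gt0//; apply: lerXn2r; rewrite ?nnegrE// ltW.
have ic : c^-1 <= e^-1 by rewrite lef_pV2 ?posrE.
have Q0 : 0 <= L ^+ 2 * (s * l1 z) ^+ 3 by rewrite mulr_ge0 ?sqr_ge0 ?exprn_ge0.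
apply: (@le_trans _ _ (((s * d) ^+ 2 + 2 * (L ^+ 2 * (s * l1 z) ^+ 3)) / (2 * c) +
   (L0 * (L ^+ 2 * (s * l1 z) ^+ 3)) * taylor_const e M)).
  apply: lerD.
    by rewrite ler_wpM2r// invr_ge0 mulr_ge0// ltW.
  apply: ler_pM => //.
  by rewrite divr_ge0 ?sqr_ge0// addr_ge0// divr_ge0// mulr_ge0// ltW.
rewrite /G -/d (_ : _ / (2 * c) = s ^+ 2 / (2 * c) * d ^+ 2 + (L ^+ 2 * (s * l1 z) ^+ 3) * c^-1); last first.
  by field; rewrite gt_eqF.
rewrite -addrA lerD2l.
rewrite (_ : s ^+ 3 * L ^+ 2 * _ * _ = (L ^+ 2 * (s * l1 z) ^+ 3) * e^-1 +
  (L0 * (L ^+ 2 * (s * l1 z) ^+ 3)) * taylor_const e M); last by ring.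
by rewrite lerD2r ler_wpM2l.
Qed.
End LogSobolev.

Section LogSobolevIteration.
Context {R : realType} {n : nat}.
Implicit Types (F G h u : 'rV[R]_n -> R) (V : 'rV[R]_n -> 'rV[R]_n) (x y z w v : 'rV[R]_n) (a s e M L : R).

(** Chain rule for entropy: the drop from [h] to [ou a s h] is the mean of the entropies conditional
    on [y], because averaging over [y] after the operator restores the Gaussian mean. *)
Lemma Ent_chain a s e M L h V : 0 < e -> 0 < s -> a ^+ 2 + s ^+ 2 = 1 -> pos_c11 e M L h V ->
  bm (fun y => ou a s (fun x => h x * ln (h x)) y - ou a s h y * ln (ou a s h y)) /\
  Ent h - Ent (ou a s h) =
  gE (fun y => ou a s (fun x => h x * ln (h x)) y - ou a s h y * ln (ou a s h y)).
Proof.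
move=> e0 s0 as1 hV.
have bh := pos_c11_bm e0 hV; have bx := pos_c11_bm_xln e0 hV.
have bP := bm_ou a s bh; have bPx := bm_ou a s bx.
have bPl : bm (fun y => ou a s h y * ln (ou a s h y)).
  apply: bm_mul => //; apply: (bm_ln e0 bP.1) => y.
  exact: ou_between (pos_c11_rng hV).
split.
  rewrite (_ : (fun y => _) = (fun y => ou a s (fun x => h x * ln (h x)) y +
    -1 * (ou a s h y * ln (ou a s h y)))); last by apply/funext => y; rewrite mulN1r.
  by apply: bmD => //; apply: bm_mul => //; exact: bm_cst.
rewrite gEB; [|exact: gI_bm..].
by rewrite gE_ou// /Ent gE_ou//; ring.
Qed.

Definition step_const e M L0 : R := local_const (n := n) e M L0 + fq_lip_const (n := n) e L0 * gE (@l1 R n) / 2.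

Lemma gI_l1 : gI (@l1 R n).
Proof. by have := @gI_l1X R n 1; under eq_fun do rewrite expr1. Qed.

(** The local bound involves [fq] at the point [a *: y]. Its Lipschitz bound replaces this value by
    the average over the noise, at the cost of one more factor [s], and invariance turns the average
    over [y] into the mean of [fq]. *)
Lemma Ent_step a s e M L L0 h V : 0 < e -> 0 < s -> a ^+ 2 + s ^+ 2 = 1 ->
  0 <= L <= L0 -> pos_c11 e M L h V ->
  Ent h <= s ^+ 2 / 2 * gE (fq h V) + s ^+ 3 * L ^+ 2 * step_const e M L0 + Ent (ou a s h).
Proof.
move=> e0 s0 as1 LL0 hV; rewrite -lerBlDr.
have [bE ->] := Ent_chain e0 s0 as1 hV.
have bq := pos_c11_bm_fq e0 hV.
have bPq := bm_ou a s bq.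
pose k := s ^+ 2 / 2 * (fq_lip_const (n := n) e L0 * L ^+ 2 * (s * gE (@l1 R n))) + s ^+ 3 * L ^+ 2 * local_const (n := n) e M L0.
apply: (@le_trans _ _ (gE (fun y => s ^+ 2 / 2 * ou a s (fq h V) y + k))).
  apply: gE_le; first exact: gI_bm.
    by apply: gID; [apply: gIZ; exact: gI_bm|exact: gI_cst].
  move=> y; apply: (le_trans (local_entropy a y e0 s0 LL0 hV)).
  rewrite /k addrA lerD2r -mulrDr ler_wpM2l//.
    by apply: divr_ge0 => //; exact: sqr_ge0.
  have i1 : gI (fun z => fq h V (a *: y + s *: z)) by apply/gI_bm/bm_comp_affine.
  have i2 : gI (fun z : 'rV[R]_n => fq_lip_const (n := n) e L0 * L ^+ 2 * (s * l1 z)).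
    by apply/gIZ/gIZ/gI_l1.
  rewrite -(gEZ s gI_l1) -gEZ; last exact/gIZ/gI_l1.
  rewrite -gED// -[leLHS](@gE_cst R n); apply: gE_le; [exact: gI_cst|exact: gID|].
  move=> z; have := fq_lip (a *: y) (s *: z) e0 LL0 hV.
  rewrite l1Z (gtr0_norm s0) ler_norml => /andP[+ _]; lra.
rewrite gED; [|by apply: gIZ; exact: gI_bm|exact: gI_cst].
rewrite gEZ; last exact: gI_bm.
rewrite gE_ou// gE_cst lerD2l /k /step_const le_eqVlt; apply/orP; left; apply/eqP; by field.
Qed.

(** A crude bound that ends the iteration: it is quadratic in [L], which is of order [a^N] after [N]
    steps. *)
Lemma Ent_lip e M L h V : 0 < e -> pos_c11 e M L h V ->
  Ent h <= L ^+ 2 * (gE (fun x : 'rV[R]_n => l1 x ^+ 2) / e).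
Proof.
move=> e0 hV; set c := h 0; have c0 : 0 < c := pos_c11_gt0 e0 hV _.
have ce : e <= c := pos_c11_lo hV _.
have bh := pos_c11_bm e0 hV; have bx := pos_c11_bm_xln e0 hV.
have ih := gI_bm bh; have ix := gI_bm bx.
have E0 : 0 < gE h.
  apply: (lt_le_trans e0); rewrite -[leLHS](@gE_cst R n).
  by apply: gE_le => //; [exact: gI_cst|exact: pos_c11_lo hV].
apply: (@le_trans _ _ (gE (fun x => h x * ln (h x)) - gE h * ln c - gE h + c)).
  by have := entropy_tangent c0 E0; rewrite /Ent; lra.
have iL : gI (fun z => ln c * h z) by exact: gIZ.
rewrite (mulrC _ (ln c)) -gEZ// -gEB// -gEB//; last exact: gIB.
rewrite -[X in _ + X <= _](@gE_cst R n) -gED; [|by apply: gIB => //; exact: gIB|exact: gI_cst].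
rewrite mulrA mulrAC -gEZ; last exact: gI_l1X.
apply: gE_le; [|by apply: gIZ; exact: gI_l1X|].
  by apply: gID; [apply: gIB => //; exact: gIB|exact: gI_cst].
move=> x; rewrite (mulrC (ln c)).
apply: (le_trans (entropy_quad c0 (pos_c11_gt0 e0 hV x))).
have := pos_c11_lip hV 0 x; rewrite add0r -/c => hx.
rewrite [leRHS]mulrAC; apply: ler_pM.
- exact: sqr_ge0.
- by rewrite invr_ge0 ltW.
- rewrite -exprMn -real_normK ?num_real//; apply: lerXn2r => //; rewrite nnegrE//.
  exact: le_trans hx.
- by rewrite lef_pV2 ?posrE.
Qed.

(** Cauchy-Schwarz in tangent form: F^2 / G >= 2 l F - l^2 G for every [l], and [l] is the ratio of
    the means. *)
Lemma gE_cs F G e M : 0 < e -> bm F -> bm G -> (forall x, e <= G x <= M) ->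
  gE F ^+ 2 / gE G <= gE (fun x => F x ^+ 2 / G x).
Proof.
move=> e0 bF bG hG.
have G0 x : 0 < G x by have /andP[+ _] := hG x; exact: lt_le_trans.
have EG : 0 < gE G.
  apply: (lt_le_trans e0); rewrite -[leLHS](@gE_cst R n).
  by apply: gE_le => [||x]; [exact: gI_cst|exact: gI_bm|have /andP[] := hG x].
set l := gE F / gE G.
have iF := gI_bm bF; have iG := gI_bm bG.
rewrite (_ : _ / _ = 2 * l * gE F - l ^+ 2 * gE G); last by rewrite /l; field; rewrite gt_eqF.
rewrite -(gEZ _ iF) -(gEZ _ iG) -gEB; [|exact: gIZ..].
apply: gE_le.
- by apply: gIB; exact: gIZ.
- apply: gI_bm; apply: bm_mul; last exact: bm_inv e0 bG.1 hG.
  by under eq_fun do rewrite expr2; exact: bm_mul.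
- move=> x; rewrite -subr_ge0 (_ : _ - _ = (F x - l * G x) ^+ 2 / G x).
    by rewrite divr_ge0 ?sqr_ge0// ltW.
  by field; rewrite gt_eqF.
Qed.

(** Joint convexity of (v, h) -> v^2 / h, applied to each coordinate; the factor a^2 comes from
    differentiating h(a y + s z) in [y]. *)
Lemma fq_ou a s e M L h V y : 0 < e -> pos_c11 e M L h V ->
  fq (ou a s h) (ou_grad a s V) y <= a ^+ 2 * ou a s (fq h V) y.
Proof.
move=> e0 hV; have bh := pos_c11_bm e0 hV; have bV := pos_c11_bmV hV.
have bi := bm_inv e0 bh.1 (pos_c11_rng hV).
have bVi i : bm (fun x => V x 0 i ^+ 2 / h x).
  by apply: bm_mul => //; under eq_fun do rewrite expr2; exact: bm_mul.
have -> : fq (ou a s h) (ou_grad a s V) y =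
   a ^+ 2 * \sum_(i < n) (ou a s (fun x => V x 0 i) y ^+ 2 / ou a s h y).
  rewrite /fq /dotp mulr_suml mulr_sumr; apply: eq_bigr => i _.
  by rewrite !mxE; ring.
have -> : ou a s (fq h V) y = \sum_(i < n) ou a s (fun x => V x 0 i ^+ 2 / h x) y.
  rewrite /ou -gE_sum; last by move=> i; apply: gI_bm; exact: (bm_comp_affine a s y (bVi i)).
  by congr gE; apply/funext => z; rewrite /fq /dotp mulr_suml.
rewrite ler_wpM2l ?sqr_ge0//; apply: ler_sum => i _.
apply: (gE_cs e0 (bm_comp_affine a s y (bV i)) (bm_comp_affine a s y bh)) => z.
exact: pos_c11_rng hV _.
Qed.

Lemma gE_fq_ou a s e M L h V : 0 < e -> 0 < s -> 0 <= a <= 1 -> a ^+ 2 + s ^+ 2 = 1 -> pos_c11 e M L h V ->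
  gE (fq (ou a s h) (ou_grad a s V)) <= a ^+ 2 * gE (fq h V).
Proof.
move=> e0 s0 a01 as1 hV; have bq := pos_c11_bm_fq e0 hV.
rewrite -(gE_ou s0 as1 bq) -gEZ; last by apply: gI_bm; exact: bm_ou.
apply: gE_le.
- by apply: gI_bm; exact: pos_c11_bm_fq e0 (pos_c11_ou s e0 a01 hV).
- by apply: gIZ; apply: gI_bm; exact: bm_ou.
- by move=> y; exact: fq_ou e0 hV.
Qed.

(** Fisher terms contract by a^2 per step, and s^2 (1 + a^2 + ... + a^(2(N-1))) = 1 - a^(2N). The
    errors s^3 L^2 a^(2k) therefore sum to s L^2 (1 - a^(2N)), one power of [s] being left over. *)
Lemma Ent_iter a s e M L0 N : 0 < e -> 0 < s -> 0 <= a <= 1 -> a ^+ 2 + s ^+ 2 = 1 ->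
  forall h V L, 0 <= L <= L0 -> pos_c11 e M L h V ->
  Ent h <= (1 - a ^+ 2 ^+ N) * (gE (fq h V) / 2 + s * L ^+ 2 * step_const e M L0) +
    a ^+ 2 ^+ N * (L ^+ 2 * (gE (fun x : 'rV[R]_n => l1 x ^+ 2) / e)).
Proof.
move=> e0 s0 a01 as1; elim: N => [|N IH] h V L LL0 hV.
  by rewrite expr0 subrr mul0r add0r mul1r; exact: Ent_lip hV.
apply: (le_trans (Ent_step e0 s0 as1 LL0 hV)).
have hP := pos_c11_ou s e0 a01 hV.
have /andP[a0 a1] := a01; have /andP[L00 L1] := LL0.
have aL : 0 <= a * L <= L0 by rewrite mulr_ge0//= (le_trans _ L1)// ler_piMl.
have := IH _ _ _ aL hP; have := gE_fq_ou e0 s0 a01 as1 hV.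
set I' := gE (fq (ou a s h) _); set I := gE (fq h V); set K := step_const _ _ _; set m := gE _ / e.
set E := Ent (ou a s h) => HI HE.
have a20 : 0 <= a ^+ 2 <= 1 by rewrite sqr_ge0 exprn_ile1.
have q01 : 0 <= 1 - a ^+ 2 ^+ N.
  by have /andP[h1 h2] := a20; rewrite subr_ge0 exprn_ile1.
have H3 : (1 - a ^+ 2 ^+ N) * (I' / 2) <= (1 - a ^+ 2 ^+ N) * (a ^+ 2 * I / 2).
  by rewrite ler_wpM2l// ler_wpM2r.
have s2 : s ^+ 2 = 1 - a ^+ 2 by lra.
rewrite mulrDr in HE.
apply: le_trans (_ : s ^+ 2 / 2 * I + s ^+ 3 * L ^+ 2 * K + ((1 - a ^+ 2 ^+ N) * (a ^+ 2 * I / 2)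
   + (1 - a ^+ 2 ^+ N) * (s * (a * L) ^+ 2 * K) + a ^+ 2 ^+ N * ((a * L) ^+ 2 * m)) <= _).
  by rewrite lerD2l (le_trans HE)// lerD2r lerD2r.
rewrite le_eqVlt; apply/orP; left; apply/eqP.
rewrite (exprS _ N) (exprS s 2) s2; by field.
Qed.

(** For fixed [s], letting [N] tend to infinity removes the final crude term; then [s] tends to
    0. *)
Lemma log_sobolev e M L h V : 0 < e -> 0 <= L -> pos_c11 e M L h V -> Ent h <= gE (fq h V) / 2.
Proof.
move=> e0 L0 hV.
have key s : 0 < s < 1 -> Ent h <= gE (fq h V) / 2 + s * L ^+ 2 * step_const e M L.
  move=> /andP[s0 s1].
  have s21 : 0 < 1 - s ^+ 2 < 1.
    have p1 : 0 < s ^+ 2 by rewrite exprn_gt0.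
    have p2 : s ^+ 2 < 1 by rewrite exprn_ilt1// ltW.
    by apply/andP; split; lra.
  pose a := Num.sqrt (1 - s ^+ 2).
  have a2 : a ^+ 2 = 1 - s ^+ 2 by rewrite sqr_sqrtr// ltW//; case/andP: s21.
  have as1 : a ^+ 2 + s ^+ 2 = 1 by rewrite a2 subrK.
  have a01 : 0 <= a <= 1.
    rewrite sqrtr_ge0/= -(@ler_pXn2r _ 2) ?nnegrE ?sqrtr_ge0// a2 expr1n ltW//; by case/andP: s21.
  have LL : 0 <= L <= L by rewrite L0 lexx.
  have H N := @Ent_iter a s e M L N e0 s0 a01 as1 h V L LL hV.
  set X := gE (fq h V) / 2 + _ in H *; set Y := L ^+ 2 * _ in H.
  have cv : (fun N => (1 - a ^+ 2 ^+ N) * X + a ^+ 2 ^+ N * Y) @ \oo --> (1 - 0) * X + 0 * Y.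
    have ca : (fun N => a ^+ 2 ^+ N) @ \oo --> (0 : R).
      apply: cvg_expr; rewrite ger0_norm ?sqr_ge0// a2; by case/andP: s21.
    apply: cvgD; apply: cvgMl => //; apply: cvgB => //; exact: cvg_cst.
  rewrite subr0 mul1r mul0r addr0 in cv.
  rewrite -(cvg_lim (@Rhausdorff R) cv); apply: limr_ge; first by apply/cvg_ex; exists X.
  by near=> N; exact: H.
apply/ler_addgt0Pr => eps eps0.
pose K := L ^+ 2 * `|step_const e M L|.
have K0 : 0 <= K by rewrite mulr_ge0// sqr_ge0.
have K1 : 0 < 1 + K by rewrite ltr_pwDl.
pose s := Num.min (2^-1) (eps / (1 + K)).
have s0 : 0 < s by rewrite lt_min invr_gt0 ltr0n/= divr_gt0.
have s1 : s < 1 by rewrite gt_min invf_lt1// ltr1n.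
have sK : s * (1 + K) <= eps by rewrite -ler_pdivlMr// ge_min lexx orbT.
have := key s; rewrite s0 s1 => /(_ isT) h1.
apply: (le_trans h1); rewrite lerD2l; apply: le_trans sK.
rewrite -mulrA ler_wpM2l//; first exact: ltW.
apply: (@le_trans _ _ K); last by rewrite lerDr.
by rewrite ler_wpM2l ?sqr_ge0// ler_norm.
Unshelve. all: by end_near.
Qed.

(* The large step to [ou a s h] loses the variance; the rest is the inequality for [ou a s h]. *)
Lemma log_sobolev_deficit a s e M L h V : 0 < e -> 0 <= L -> 0 < s <= 1 -> 0 <= a <= 1 ->
  a ^+ 2 + s ^+ 2 = 1 -> pos_c11 e M L h V ->
  Ent h + a ^+ 2 / 2 * gE (fun y => ou a s (fq h V) y - \sum_(i < n) (ou a s (fun x => V x 0 i) y ^+ 2 / ou a s h y))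
  <= gE (fq h V) / 2.
Proof.
move=> e0 L0 /andP[s0 s1] a01 as1 hV.
have hP := pos_c11_ou s e0 a01 hV.
have bq := pos_c11_bm_fq e0 hV; have bPq := bm_ou a s bq.
have s01 : 0 <= s <= 1 by rewrite s1 ltW.
have /andP[a0 _] := a01.
have aL : 0 <= a * L by rewrite mulr_ge0.
have HP := log_sobolev e0 aL hP.
have [bE E] := Ent_chain e0 s0 as1 hV.
have H1 : Ent h - Ent (ou a s h) <= s ^+ 2 / 2 * gE (fq h V).
  rewrite E -(gE_ou s0 as1 bq) -gEZ; last exact: gI_bm.
  apply: gE_le; [exact: gI_bm|by apply: gIZ; exact: gI_bm|].
  (* The conditional entropy given [y] obeys the logarithmic Sobolev inequality in the noise
     variable, whose gradient carries the factor [s]. *)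
  move=> y; have hc := pos_c11_comp a y s01 hV.
  apply: (le_trans (log_sobolev e0 L0 hc)).
  rewrite (_ : fq _ _ = (fun z => s ^+ 2 * fq h V (a *: y + s *: z))); last first.
    by apply/funext => z; rewrite /fq dotpZl dotpZr; ring.
  rewrite gEZ; last by apply: gI_bm; exact: bm_comp_affine.
  by rewrite /ou mulrAC.
have fE y : fq (ou a s h) (ou_grad a s V) y = a ^+ 2 * \sum_(i < n) (ou a s (fun x => V x 0 i) y ^+ 2 / ou a s h y).
  rewrite /fq /dotp mulr_suml mulr_sumr; apply: eq_bigr => i _.
  by rewrite !mxE; ring.
have bf := pos_c11_bm_fq e0 hP.
rewrite -mulrA mulrC -mulrA.
have H2 : a ^+ 2 * gE (fun y => ou a s (fq h V) y - \sum_(i < n) (ou a s (fun x => V x 0 i) y ^+ 2 / ou a s h y))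
   <= a ^+ 2 * gE (fq h V) - gE (fq (ou a s h) (ou_grad a s V)).
  rewrite le_eqVlt; apply/orP; left; apply/eqP.
  have bS : bm (fun y => \sum_(i < n) (ou a s (fun x => V x 0 i) y ^+ 2 / ou a s h y)).
    apply: bm_sum => i; apply: bm_mul; last exact: bm_inv e0 (bm_ou a s (pos_c11_bm e0 hV)).1 (pos_c11_rng hP).
    under eq_fun do rewrite expr2.
    by apply: bm_mul; exact: (bm_ou a s (pos_c11_bmV hV i)).
  rewrite gEB; [|exact: gI_bm..].
  rewrite gE_ou// mulrBr -(gEZ _ (gI_bm bS)); congr (_ - gE _).
  by apply/funext => y; rewrite fE.
have s2 : s ^+ 2 = 1 - a ^+ 2 by lra.
rewrite s2 in H1.
set D := gE (fun y => _ - _) in H2 *; set I := gE (fq h V) in H1 H2 *.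
set J := gE (fq (ou a s h) _) in H2 HP.
lra.
Qed.

End LogSobolevIteration.

(** * Lower bound for the Mehler variance *)

Section VarianceBound.
Context {R : realType} {n : nat}.
Implicit Types (F G h u eta : 'rV[R]_n -> R) (V : 'rV[R]_n -> 'rV[R]_n) (x y z w v : 'rV[R]_n) (a s e M L : R).

(** Its square is, up to e^4, a lower bound for the Mehler kernel on the support of the test
    function; it enters unsquared through Cauchy-Schwarz. *)
Definition wgt y : R := expR (- dotp y y).

Lemma bm_wgt : bm wgt.
Proof.
split.
  apply: measurableT_comp => //; apply: measurableT_comp => //.
  by apply: measurable_dotp; exact: measurable_id.
exists 1 => x; rewrite ger0_norm ?expR_ge0// -expR0 ler_expR oppr_le0.
exact: dotp_ge0.
Qed.

Lemma gI_sqnorm : gI (fun x => dotp x x).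
Proof.
apply: (@gI_dom _ _ _ (fun x => l1 x ^+ 2)).
- by apply: measurable_dotp; exact: measurable_id.
- exact: gI_l1X.
- move=> x; rewrite expr2; apply: dotp_l1; exact: l1_coord.
Qed.

(** Jensen's inequality through the tangent of the exponential at -m: the mean is at least
    e^(-m). *)
Lemma gE_wgt_gt0 : 0 < gE wgt.
Proof.
set m := gE (fun x : 'rV[R]_n => dotp x x).
apply: (@lt_le_trans _ _ (expR (- m))); first exact: expR_gt0.
have i1 : gI (fun x => expR (- m) * (1 + m)) by exact: gI_cst.
have i2 : gI (fun x => expR (- m) * dotp x x) by apply: gIZ; exact: gI_sqnorm.
apply: (@le_trans _ _ (gE (fun x => expR (- m) * (1 + m) - expR (- m) * dotp x x))).
  rewrite gEB// gE_cst gEZ; last exact: gI_sqnorm.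
  by rewrite -/m le_eqVlt; apply/orP; left; apply/eqP; ring.
apply: gE_le; [exact: gIB|exact: gI_bm bm_wgt|].
move=> x; rewrite /wgt (_ : - dotp x x = - m + (m - dotp x x)); last by ring.
rewrite expRD -mulrBr ler_wpM2l ?expR_ge0//.
have := expR_ge1Dx (m - dotp x x); lra.
Qed.

(** From a <= 1/2 come s^2 >= 3/4 and s^(-n) >= 1. The negated exponent is at most (2 + 5/4 |y|^2) *
    2/3, which stays below 4 + 2 |y|^2. *)
Lemma mehler_lb a s y x : 0 <= a <= 2^-1 -> 0 < s -> a ^+ 2 + s ^+ 2 = 1 ->
  a ^+ 2 * dotp x x <= 1 -> wgt y ^+ 2 <= expR 4 * mehler a s y x.
Proof.
move=> /andP[a0 a1] s0 as1 ax.
have a2 : a ^+ 2 <= 4^-1.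
  rewrite (_ : 4^-1 = 2^-1 ^+ 2); last by field.
  by apply: lerXn2r; rewrite ?nnegrE.
have s2 : 3 / 4 <= s ^+ 2 by lra.
have s1 : s <= 1.
  rewrite -(@ler_pXn2r _ 2) ?nnegrE//; last exact: ltW.
  rewrite expr1n; have := sqr_ge0 a; lra.
rewrite /mehler /wgt mulrCA -!expRM_natl -expRD.
have sn : 1 <= s ^- n by rewrite invf_ge1 ?exprn_gt0// exprn_ile1// ltW.
apply: (@le_trans _ _ (1 * expR (4 + - (a ^+ 2 * dotp x x + a ^+ 2 * dotp y y - 2 * a * dotp y x) / (2 * s ^+ 2)))); last first.
  by rewrite ler_wpM2r ?expR_ge0.
rewrite mul1r ler_expR.
have y0 := dotp_ge0 y.
have h : - (2 * a * dotp y x) <= dotp y y + a ^+ 2 * dotp x x.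
  have := dotp_ge0 (y + a *: x).
  rewrite !dotpDl !dotpDr !dotpZl !dotpZr (dotpC x y) expr2; lra.
have h2 : a ^+ 2 * dotp y y <= 4^-1 * dotp y y by rewrite ler_wpM2r.
have x0 : 0 <= a ^+ 2 * dotp x x by rewrite mulr_ge0 ?sqr_ge0// dotp_ge0.
set Q := a ^+ 2 * dotp x x + a ^+ 2 * dotp y y - 2 * a * dotp y x.
have QE : Q <= 2 + 5 / 4 * dotp y y by rewrite /Q; lra.
have i1 : Q / (2 * s ^+ 2) <= (2 + 5 / 4 * dotp y y) * (2 / 3).
  have p1 : 0 <= (2 * s ^+ 2)^-1 by rewrite invr_ge0 mulr_ge0// sqr_ge0.
  apply: (@le_trans _ _ ((2 + 5 / 4 * dotp y y) / (2 * s ^+ 2))).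
    by rewrite ler_wpM2r.
  apply: ler_wpM2l; first lra.
  rewrite (_ : 2 / 3 = (3 / 2)^-1); last by field.
  rewrite lef_pV2 ?posrE; lra.
rewrite mulNr; lra.
Qed.

Lemma ouD a s F G y : bm F -> bm G ->
  ou a s (fun x => F x + G x) y = ou a s F y + ou a s G y.
Proof. by move=> bF bG; apply: gED; apply: gI_bm; exact: bm_comp_affine. Qed.

Lemma ouZ a s k F y : bm F -> ou a s (fun x => k * F x) y = k * ou a s F y.
Proof. by move=> bF; apply: gEZ; apply: gI_bm; exact: bm_comp_affine. Qed.

(* Variance of V_i / h under the law proportional to h(x) mehler(y, x), times the mass. *)
Definition varP a s h V (i : 'I_n) y : R :=
  ou a s (fun x => V x 0 i ^+ 2 / h x) y - ou a s (fun x => V x 0 i) y ^+ 2 / ou a s h y.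

(* Integrates 2 u v <= m u^2 + v^2 / m, m the Mehler kernel, u = V_i / h - q, v = t wgt eta;
   E[eta h] = 0 makes the constant q drop out. *)
Lemma varP_bound a s e M L h V eta i y t : 0 < e ->
  0 <= a <= 2^-1 -> 0 < s -> a ^+ 2 + s ^+ 2 = 1 -> pos_c11 e M L h V ->
  bm eta -> (forall x, `|eta x| <= 2) -> (forall x, 1 < a ^+ 2 * dotp x x -> eta x = 0) ->
  gE (fun x => eta x * h x) = 0 ->
  2 * t * gE (fun x => V x 0 i * eta x) * wgt y <=
  varP a s h V i y + t ^+ 2 * (4 * expR 4 * gE h).
Proof.
move=> e0 a01 s0 as1 hV beta eta2 eta0 etah.
have bh := pos_c11_bm e0 hV; have bV := pos_c11_bmV hV i; have bi := pos_c11_bm_inv e0 hV.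
have h0 := pos_c11_gt0 e0 hV.
have w0 : 0 <= wgt y by exact: expR_ge0.
set Pv := ou a s (fun x => V x 0 i) y; set Ph := ou a s h y.
have Ph0 : 0 < Ph.
  by have /andP[+ _] := ou_between a s y bh (pos_c11_rng hV); exact: lt_le_trans.
set q := Pv / Ph.
(* This is (V_i / h - q)^2 h expanded, so that linearity of [ou] identifies its image with the
   variance at the chosen [q]. *)
pose G x := V x 0 i ^+ 2 / h x + (- (2 * q)) * V x 0 i + q ^+ 2 * h x.
have b1 : bm (fun x => V x 0 i ^+ 2 / h x).
  by apply: bm_mul => //; under eq_fun do rewrite expr2; exact: bm_mul.
have b2 : bm (fun x => (- (2 * q)) * V x 0 i) by apply: bm_mul => //; exact: bm_cst.
have b3 : bm (fun x => q ^+ 2 * h x) by apply: bm_mul => //; exact: bm_cst.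
have bG : bm G by apply: bmD => //; exact: bmD.
have PG : ou a s G y = varP a s h V i y.
  rewrite /G (ouD _ _ _ (bmD b1 b2) b3) (ouD _ _ _ b1 b2) !ouZ//.
  by rewrite /varP -/Pv -/Ph /q; field; rewrite gt_eqF.
have iM := gI_mehlerM s0 as1 y bG.
rewrite -PG (ou_mehler s0 as1)//.
have iVe : gI (fun x => V x 0 i * eta x) by apply: gI_bm; exact: bm_mul.
have ieh : gI (fun x => eta x * h x) by apply: gI_bm; exact: bm_mul.
have ih := gI_bm bh.
have -> : 2 * t * gE (fun x => V x 0 i * eta x) * wgt y =
  gE (fun x => (2 * t * wgt y) * (V x 0 i * eta x) - (2 * t * wgt y * q) * (eta x * h x)).
  by rewrite gEB; [rewrite gEZ// gEZ// etah; ring|exact: gIZ..].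
rewrite mulrA -gEZ// -gED//; last exact: gIZ.
apply: gE_le; [by apply: gIB; exact: gIZ|by apply: gID => //; exact: gIZ|].
move=> x; set m := mehler a s y x.
have m0 : 0 < m by exact: mehler_gt0.
have hx := h0 x.
rewrite /G (_ : m * _ = (V x 0 i / h x - q) ^+ 2 * h x * m); last by field; rewrite gt_eqF.
rewrite (_ : _ - _ = 2 * (V x 0 i / h x - q) * (t * wgt y * eta x) * h x); last by field; rewrite gt_eqF.
set A := V x 0 i / h x - q.
apply: (@le_trans _ _ (A ^+ 2 * h x * m + (t * wgt y * eta x) ^+ 2 / m * h x)).
  rewrite -subr_ge0 (_ : _ - _ = (A * m - t * wgt y * eta x) ^+ 2 / m * h x).
    by rewrite mulr_ge0 ?divr_ge0 ?sqr_ge0// ltW.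
  by field; rewrite gt_eqF.
rewrite lerD2l ler_wpM2r//; first exact: ltW.
rewrite ler_pdivrMr// (_ : _ ^+ 2 = t ^+ 2 * (wgt y ^+ 2 * eta x ^+ 2)); last by ring.
rewrite (_ : _ * m = t ^+ 2 * (4 * (expR 4 * m))); last by ring.
apply: ler_wpM2l; first exact: sqr_ge0.
have [ax|ax] := leP (a ^+ 2 * dotp x x) 1; last first.
  by rewrite eta0// expr0n mulr0 mulr_ge0// mulr_ge0 ?expR_ge0// ltW.
have := mehler_lb y a01 s0 as1 ax; rewrite -/m => H.
have e4 : eta x ^+ 2 <= 4.
  rewrite -real_normK ?num_real// (_ : 4 = 2 ^+ 2); last by rewrite -natrX.
  by rewrite lerXn2r ?nnegrE.
rewrite mulrC; apply: ler_pM => //; exact: sqr_ge0.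
Qed.

Lemma varP_lb a s e M L h V eta i : 0 < e ->
  0 <= a <= 2^-1 -> 0 < s -> a ^+ 2 + s ^+ 2 = 1 -> pos_c11 e M L h V ->
  bm eta -> (forall x, `|eta x| <= 2) -> (forall x, 1 < a ^+ 2 * dotp x x -> eta x = 0) ->
  gE (fun x => eta x * h x) = 0 ->
  gE wgt ^+ 2 * gE (fun x => V x 0 i * eta x) ^+ 2 <=
  4 * expR 4 * gE h * gE (varP a s h V i).
Proof.
move=> e0 a01 s0 as1 hV beta eta2 eta0 etah.
set A := gE (fun x => V x 0 i * eta x); set K := gE wgt; set B := 4 * expR 4 * gE h.
have bh := pos_c11_bm e0 hV; have bV := pos_c11_bmV hV i; have bi := pos_c11_bm_inv e0 hV.
have Eh : 0 < gE h.
  apply: (lt_le_trans e0); rewrite -[leLHS](@gE_cst R n).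
  by apply: gE_le => [||x]; [exact: gI_cst|exact: gI_bm|exact: pos_c11_lo hV _].
have B0 : 0 < B by rewrite /B !mulr_gt0// expR_gt0.
have bvar : bm (varP a s h V i).
  rewrite (_ : varP a s h V i = (fun y => ou a s (fun x => V x 0 i ^+ 2 / h x) y +
    -1 * (ou a s (fun x => V x 0 i) y ^+ 2 / ou a s h y))); last first.
    by apply/funext => y; rewrite mulN1r.
  apply: bmD.
    by apply: bm_ou; apply: bm_mul => //; under eq_fun do rewrite expr2; exact: bm_mul.
  apply: bm_mul; first exact: bm_cst.
  have bPV := bm_ou a s bV.
  apply: bm_mul; first by under eq_fun do rewrite expr2; exact: bm_mul.
  apply: (bm_inv e0 (bm_ou a s bh).1) => y; exact: ou_between (pos_c11_rng hV).
have key t : 2 * t * A * K <= gE (varP a s h V i) + t ^+ 2 * B.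
  have ivar := gI_bm bvar; have iw := gI_bm bm_wgt.
  rewrite /K -gEZ// -[X in _ + X](@gE_cst R n) -gED//; last exact: gI_cst.
  apply: gE_le; [exact: gIZ|by apply: gID => //; exact: gI_cst|].
  by move=> y; exact: (varP_bound i y t e0 a01 s0 as1 hV).
(* The maximizer of 2 t A K - t^2 B. *)
have := key (A * K / B); set W := gE (varP _ _ _ _ _).
have -> : 2 * (A * K / B) * A * K = 2 * (A * K) ^+ 2 / B by field; rewrite gt_eqF.
have -> : (A * K / B) ^+ 2 * B = (A * K) ^+ 2 / B by field; rewrite gt_eqF.
move=> H; rewrite (_ : K ^+ 2 * A ^+ 2 = B * ((A * K) ^+ 2 / B)); last by field; rewrite gt_eqF.
by rewrite ler_wpM2l//; [exact: ltW|lra].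
Qed.

Lemma class_stability a s e M L h V eta : 0 < e -> 0 <= L ->
  0 <= a <= 2^-1 -> 0 < s -> a ^+ 2 + s ^+ 2 = 1 -> pos_c11 e M L h V ->
  bm eta -> (forall x, `|eta x| <= 2) -> (forall x, 1 < a ^+ 2 * dotp x x -> eta x = 0) ->
  gE (fun x => eta x * h x) = 0 ->
  Ent h + a ^+ 2 * (gE wgt ^+ 2 / (8 * expR 4 * gE h)) *
    \sum_(i < n) gE (fun x => V x 0 i * eta x) ^+ 2 <= gE (fq h V) / 2.
Proof.
move=> e0 L0 a01 s0 as1 hV beta eta2 eta0 etah.
have /andP[a0 a1] := a01.
have s1 : 0 < s <= 1.
  rewrite s0 -(@ler_pXn2r _ 2) ?nnegrE//; last exact: ltW.
  rewrite expr1n; have := sqr_ge0 a; lra.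
have a1' : 0 <= a <= 1 by rewrite a0; lra.
have bh := pos_c11_bm e0 hV; have bV := pos_c11_bmV hV; have bi := pos_c11_bm_inv e0 hV.
have Eh : 0 < gE h.
  apply: (lt_le_trans e0); rewrite -[leLHS](@gE_cst R n).
  by apply: gE_le => [||x]; [exact: gI_cst|exact: gI_bm|exact: pos_c11_lo hV _].
apply: le_trans (log_sobolev_deficit e0 L0 s1 a1' as1 hV).
rewrite lerD2l -mulrA (mulrAC (a ^+ 2)) -[leRHS]mulrA; apply: ler_wpM2l; first exact: sqr_ge0.
have b1 i : bm (fun x => V x 0 i ^+ 2 / h x).
  by apply: bm_mul => //; under eq_fun do rewrite expr2; exact: bm_mul.
have -> : (fun y => ou a s (fq h V) y - \sum_(i < n) (ou a s (fun x => V x 0 i) y ^+ 2 / ou a s h y))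
   = (fun y => \sum_(i < n) varP a s h V i y).
  apply/funext => y; rewrite sumrB; congr (_ - _).
  rewrite /ou -gE_sum; last by move=> i; apply: gI_bm; exact: (bm_comp_affine a s y (b1 i)).
  by congr gE; apply/funext => z; rewrite /fq /dotp mulr_suml.
have bvar i : bm (varP a s h V i).
  rewrite (_ : varP a s h V i = (fun y => ou a s (fun x => V x 0 i ^+ 2 / h x) y +
    -1 * (ou a s (fun x => V x 0 i) y ^+ 2 / ou a s h y))); last first.
    by apply/funext => y; rewrite mulN1r.
  apply: bmD; first exact: bm_ou.
  apply: bm_mul; first exact: bm_cst.
  have bPV := bm_ou a s (bV i).
  apply: bm_mul; first by under eq_fun do rewrite expr2; exact: bm_mul.
  apply: (bm_inv e0 (bm_ou a s bh).1) => y; exact: ou_between (pos_c11_rng hV).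
rewrite gE_sum; last by move=> i; exact: gI_bm.
rewrite mulr_sumr mulr_suml; apply: ler_sum => i _.
have := varP_lb i e0 a01 s0 as1 hV beta eta2 eta0 etah.
set A := gE _ ^+ 2; set K := gE wgt ^+ 2; set W := gE (varP _ _ _ _ _) => H.
rewrite mulrAC ler_pdivrMr; last by rewrite !mulr_gt0// expR_gt0.
apply: (le_trans H); rewrite le_eqVlt; apply/orP; left; apply/eqP; by field.
Qed.

End VarianceBound.

(** * Integration by parts *)

Section IntegrationByParts.
Context {R : realType} {n : nat}.
Implicit Types (F G h u eta : 'rV[R]_n -> R) (V : 'rV[R]_n -> 'rV[R]_n) (x y z w v c : 'rV[R]_n) (a s e M L K : R).

Lemma integral_gauss_affine c s F : 0 < s -> measurable_fun setT F ->
  (\int[gaussm n]_x (F x)%:E =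
   \int[gaussm n]_x (affine_dens c s x * F (c + s *: x)%R)%:E)%E.
Proof.
move=> s0 mF.
have d0 x : 0 <= affine_dens c s x by exact: affine_dens_ge0.
have mE : measurable_fun setT (EFin \o F) by exact/measurable_EFinP.
rewrite integralE [RHS]integralE; congr (_ - _)%E.
- rewrite (ge0_integral_gauss_affine c s0)//; last exact: measurable_funepos.
  apply: eq_integral => x _; rewrite !funeposE/= -!EFin_max -EFinM; congr EFin.
  by rewrite maxr_pMr// mulr0.
- rewrite (ge0_integral_gauss_affine c s0)//; last exact: measurable_funeneg.
  apply: eq_integral => x _; rewrite !funenegE/= -!EFin_max -EFinM; congr EFin.
  by rewrite maxr_pMr// mulr0 mulrN.
Qed.

Lemma gE_affine c s F : 0 < s -> measurable_fun setT F ->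
  gE F = gE (fun x => affine_dens c s x * F (c + s *: x)).
Proof. by move=> s0 mF; rewrite /gE /Rintegral (integral_gauss_affine c s0). Qed.

Lemma affine_dens1 c x : affine_dens c 1 x = expR (- (dotp c x + dotp c c / 2)).
Proof.
rewrite /affine_dens expr1n mul1r scale1r !dotpDl !dotpDr (dotpC x c); congr expR.
by field.
Qed.

(** The Cameron-Martin formula, read off from the affine substitution with scale 1. *)
Lemma gE_translate c u : bm u ->
  gE (fun x => u (c + x)) = gE (fun x => u x * expR (dotp c x - dotp c c / 2)).
Proof.
move=> [mu _]; rewrite [RHS](gE_affine c ltr01).
  congr gE; apply/funext => x; rewrite affine_dens1 scale1r mulrCA -expRD dotpDr.
  by rewrite [X in expR X](_ : _ = 0) ?expR0 ?mulr1//; field.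
apply: measurable_funM => //; apply: measurableT_comp => //.
apply: measurable_funB => //; exact: measurable_dotpl.
Qed.

Lemma expR_taylor1 (t : R) : `|expR t - 1 - t| <= t ^+ 2 * expR `|t|.
Proof.
have h0 := expR_ge1Dx t; have h1 := expR_ge1Dx (- t).
have e0 := expR_gt0 t.
rewrite ger0_norm; last by lra.
have h2 : expR t - 1 <= t * expR t.
  have := ler_wpM2l (ltW e0) h1; rewrite -expRD subrr expR0; lra.
have [t0|t0] := leP 0 t.
  rewrite ger0_norm//.
  apply: (@le_trans _ _ (t * (expR t - 1))); first lra.
  by rewrite expr2 -mulrA ler_wpM2l.
have et : 1 <= expR `|t| by rewrite -expR0 ler_expR.
apply: (@le_trans _ _ (t ^+ 2 * 1)); last by rewrite ler_wpM2l ?sqr_ge0.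
nra.
Qed.

(* Differentiates the Cameron-Martin formula at zero shift. *)
Lemma gE_ibp u (U : 'rV[R]_n -> R) (i : 'I_n) K : bm u -> bm U ->
  (forall x t, `|u (x + t *: ebasis i) - u x - t * U x| <= K * t ^+ 2) ->
  gE U = gE (fun x => x 0 i * u x).
Proof.
move=> bu bU hK; have [mu [C uC]] := bu.
have dotpe (x : 'rV[R]_n) : dotp (ebasis i) x = x 0 i.
  rewrite /dotp (bigD1 i)//= mxE eqxx mul1r big1 ?addr0// => j ji.
  by rewrite mxE (negbTE ji) mul0r.
have ee : dotp (ebasis i) (ebasis i : 'rV[R]_n) = 1 by rewrite dotpe mxE eqxx.
have ixu : gI (fun x => x 0 i * u x).
  apply: (@gI_dom _ _ _ (fun x => C * l1 x)).
  - by apply: measurable_funM => //; exact: measurable_coord.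
  - by apply: gIZ; exact: gI_l1.
  - by move=> x; rewrite normrM mulrC ler_pM// l1_coord.
have C0 : 0 <= C by exact: le_trans (normr_ge0 _) (uC 0).
have iu := gI_bm bu; have iU := gI_bm bU.
(* Dominates the exponential remainder: with q = 1 + |x|_1 and |v| <= t q <= q, v^2 e^|v| <= t^2 q^2
   e^q <= t^2 * 2 e^(2q). *)
pose W (x : 'rV[R]_n) := 2 * expR (2 * (1 + l1 x)).
have iW : gI W.
  rewrite /W; under eq_fun do rewrite mulrDr expRD mulrA; apply: gIZ.
  exact: gI_expl1.
have key t : 0 < t <= 1 ->
  `|gE U - gE (fun x => x 0 i * u x)| <= t * (K + C * (gE W + 1)).
  move=> /andP[t0 t1].
  rewrite -(ler_pM2l t0) -[X in X * `|_|](gtr0_norm t0) -normrM.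
  (* Both sides of the Cameron-Martin formula are expanded to first order in [t]. The zeroth-order
     terms cancel, leaving two remainders of order t^2. *)
  have -> : t * (gE U - gE (fun x => x 0 i * u x)) =
     gE (fun x => u x * (expR (t * x 0 i - t ^+ 2 / 2) - 1 - t * x 0 i))
     - gE (fun x => u (x + t *: ebasis i) - u x - t * U x).
    have bt : bm (fun x => u (x + t *: ebasis i)).
      have := bm_comp_affine t 1 (ebasis i) bu.
      by under eq_fun do rewrite scale1r addrC.
    have T := gE_translate (t *: ebasis i) bu.
    rewrite gEB; [|by apply: gIB => //; exact: gI_bm|exact: gIZ].
    rewrite gEB//; last exact: gI_bm.
    rewrite gEZ//.
    have i2 : gI (fun x => u x * expR (t * x 0 i - t ^+ 2 / 2)).
      apply: (@gI_exp _ _ _ t C); [exact: ltW| |].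
        apply: measurable_funM => //; apply: measurableT_comp => //.
        apply: measurable_funB => //; apply: measurable_funM => //; exact: measurable_coord.
      move=> x; rewrite normrM ler_pM// ger0_norm ?expR_ge0// ler_expR.
      apply: (@le_trans _ _ (t * x 0 i)); first by rewrite gerBl divr_ge0 ?sqr_ge0.
      rewrite ler_wpM2l//; first exact: ltW.
      by rewrite (le_trans (ler_norm _))// l1_coord.
    have -> : gE (fun x => u x * (expR (t * x 0 i - t ^+ 2 / 2) - 1 - t * x 0 i)) =
      gE (fun x => u x * expR (t * x 0 i - t ^+ 2 / 2)) - gE u - t * gE (fun x => x 0 i * u x).
      rewrite -(gEZ t ixu) -gEB// -gEB; [|exact: gIB|exact: gIZ].
      by congr gE; apply/funext => x; ring.
    have -> : gE (fun x => u x * expR (t * x 0 i - t ^+ 2 / 2)) = gE (fun x => u (x + t *: ebasis i)).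
      transitivity (gE (fun x => u (t *: ebasis i + x))).
        rewrite T; congr gE; apply/funext => x.
        by rewrite dotpZl dotpe dotpZl dotpZr ee mulr1 -expr2.
      by congr gE; apply/funext => x; rewrite addrC.
    by ring.
  apply: (le_trans (ler_normB _ _)).
  have i3 : gI (fun x => t ^+ 2 * (C * (W x + 1))).
    by apply: gIZ; apply: gIZ; apply: gID => //; exact: gI_cst.
  have mW : measurable_fun setT (fun x => u x * (expR (t * x 0 i - t ^+ 2 / 2) - 1 - t * x 0 i)).
    apply: measurable_funM => //; apply: measurable_funB; last by apply: measurable_funM => //; exact: measurable_coord.
    apply: measurable_funB => //; apply: measurableT_comp => //.
    apply: measurable_funB => //; apply: measurable_funM => //; exact: measurable_coord.
  have H1 x : `|u x * (expR (t * x 0 i - t ^+ 2 / 2) - 1 - t * x 0 i)| <= t ^+ 2 * (C * (W x + 1)).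
    rewrite normrM mulrCA; apply: ler_pM => //.
    set v := t * x 0 i - t ^+ 2 / 2.
    rewrite (_ : _ - _ = (expR v - 1 - v) - t ^+ 2 / 2); last by rewrite /v; ring.
    apply: (le_trans (ler_normB _ _)); rewrite mulrDr mulr1; apply: lerD; last first.
      rewrite ger0_norm; last by rewrite divr_ge0 ?sqr_ge0.
      have := sqr_ge0 t; lra.
    apply: (le_trans (expR_taylor1 v)).
    have vl : `|v| <= t * (1 + l1 x).
      apply: (le_trans (ler_normB _ _)); rewrite normrM (gtr0_norm t0) mulrDr addrC; apply: lerD.
        rewrite ger0_norm; last by rewrite divr_ge0 ?sqr_ge0.
        rewrite expr2 -mulrA ler_wpM2l ?ltW//; lra.
      by rewrite ler_wpM2l ?l1_coord// ltW.
    have l0 := l1_ge0 x.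
    have v1 : `|v| <= 1 + l1 x.
      apply: (le_trans vl); rewrite ler_piMl//; lra.
    have v2 : v ^+ 2 <= t ^+ 2 * (1 + l1 x) ^+ 2.
      rewrite -exprMn -real_normK ?num_real//; apply: lerXn2r => //; rewrite nnegrE//.
      exact: le_trans vl.
    apply: (@le_trans _ _ (t ^+ 2 * (1 + l1 x) ^+ 2 * expR (1 + l1 x))).
      by apply: ler_pM; [exact: sqr_ge0|exact: expR_ge0|exact: v2|rewrite ler_expR].
    rewrite -mulrA; apply: ler_wpM2l; first exact: sqr_ge0.
    have q0 : 0 <= 1 + l1 x by rewrite addr_ge0.
    rewrite /W; set q := 1 + l1 x in q0 *.
    rewrite (_ : 2 * q = q + q); last by ring.
    rewrite (expRD q q) [leRHS]mulrA; apply: ler_wpM2r; first exact: expR_ge0.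
    exact: (expR_ge_pow 1 q0).
  have i1 : gI (fun x => u x * (expR (t * x 0 i - t ^+ 2 / 2) - 1 - t * x 0 i)).
    by apply: gI_dom mW i3 H1.
  have H2 := gE_norm_le i1 i3 H1.
  have H3 : `|gE (fun x => u (x + t *: ebasis i) - u x - t * U x)| <= K * t ^+ 2.
    rewrite -[leRHS](@gE_cst R n); apply: gE_norm_le => //; last exact: gI_cst.
    apply: gIB; last exact: gIZ.
    apply: gIB => //; apply: gI_bm.
    have := bm_comp_affine t 1 (ebasis i) bu.
    by under eq_fun do rewrite scale1r addrC.
  apply: (le_trans (lerD H2 H3)).
  rewrite gEZ; last by apply: gIZ; apply: gID => //; exact: gI_cst.
  rewrite gEZ; last by apply: gID => //; exact: gI_cst.
  rewrite gED//; last exact: gI_cst.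
  by rewrite gE_cst le_eqVlt; apply/orP; left; apply/eqP; ring.
apply/eqP; rewrite -subr_eq0 -normr_le0; apply/ler_addgt0Pr => eps eps0; rewrite add0r.
set Q := K + _ in key.
have Q1 : 0 < 1 + `|Q| by rewrite ltr_pwDl.
pose t := Num.min 1 (eps / (1 + `|Q|)).
have t0 : 0 < t by rewrite lt_min ltr01 divr_gt0.
have t1 : t <= 1 by rewrite ge_min lexx.
have tQ : t * (1 + `|Q|) <= eps by rewrite -ler_pdivlMr// ge_min lexx orbT.
have := key t; rewrite t0 t1 => /(_ isT) h; apply: (le_trans h).
apply: le_trans tQ; rewrite ler_wpM2l//; first exact: ltW.
by rewrite (le_trans (ler_norm _))// lerDr.
Qed.

End IntegrationByParts.

(** * Local C^{1,1} bounds and their globalization *)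

Section Regularity.
Context {R : realType} {n : nat}.
Implicit Types (F G h k u : 'rV[R]_n -> R) (V W : 'rV[R]_n -> 'rV[R]_n) (x y z w v c : 'rV[R]_n) (a s e M L K : R) (D : set 'rV[R]_n).

(** A smooth density satisfies such bounds on balls only, hence the set [D]; positivity is left out
    so that products with cutoffs and test functions qualify. *)
Record c11on D K h V : Prop := C11on {
  c11_h : forall x, D x -> `|h x| <= K;
  c11_V : forall x i, D x -> `|V x 0 i| <= K;
  c11_lip : forall x w, D x -> D (x + w) -> `|h (x + w) - h x| <= K * l1 w;
  c11_Vlip : forall x w i, D x -> D (x + w) -> `|V (x + w) 0 i - V x 0 i| <= K * l1 w;
  c11_taylor : forall x w, D x -> D (x + w) ->
     `|h (x + w) - h x - dotp (V x) w| <= K * l1 w ^+ 2 }.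

Lemma c11_mul D K1 K2 h V k W : 0 <= K1 -> 0 <= K2 -> c11on D K1 h V -> c11on D K2 k W ->
  c11on D (4 * (K1 * K2)) (fun x => h x * k x) (fun x => k x *: V x + h x *: W x).
Proof.
move=> K10 K20 hV kW.
have KK : 0 <= K1 * K2 by rewrite mulr_ge0.
split.
- move=> x Dx; rewrite normrM.
  have := ler_pM (normr_ge0 _) (normr_ge0 _) (c11_h hV Dx) (c11_h kW Dx); lra.
- move=> x i Dx; rewrite !mxE; apply: (le_trans (ler_normD _ _)); rewrite !normrM.
  have := ler_pM (normr_ge0 _) (normr_ge0 _) (c11_h hV Dx) (c11_V kW i Dx).
  have := ler_pM (normr_ge0 _) (normr_ge0 _) (c11_V hV i Dx) (c11_h kW Dx).
  rewrite (mulrC `|V x 0 i|); lra.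
- move=> x w Dx Dxw; have l0 := l1_ge0 w.
  rewrite (_ : _ - _ = (h (x + w) - h x) * k (x + w) + h x * (k (x + w) - k x)); last by ring.
  apply: (le_trans (ler_normD _ _)); rewrite !normrM.
  have := ler_pM (normr_ge0 _) (normr_ge0 _) (c11_lip hV Dx Dxw) (c11_h kW Dxw).
  have := ler_pM (normr_ge0 _) (normr_ge0 _) (c11_h hV Dx) (c11_lip kW Dx Dxw).
  have : 0 <= K1 * K2 * l1 w by rewrite mulr_ge0.
  rewrite (_ : K1 * (K2 * l1 w) = K1 * K2 * l1 w) ?mulrA// (_ : K1 * l1 w * K2 = K1 * K2 * l1 w); last by ring.
  rewrite -mulrA; lra.
- move=> x w i Dx Dxw; have l0 := l1_ge0 w; rewrite !mxE.
  rewrite (_ : _ - _ = ((k (x + w) - k x) * V (x + w) 0 i + k x * (V (x + w) 0 i - V x 0 i))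
    + ((h (x + w) - h x) * W (x + w) 0 i + h x * (W (x + w) 0 i - W x 0 i))); last by ring.
  apply: (le_trans (ler_normD _ _)).
  apply: (le_trans (lerD (ler_normD _ _) (ler_normD _ _))); rewrite !normrM.
  have := ler_pM (normr_ge0 _) (normr_ge0 _) (c11_lip kW Dx Dxw) (c11_V hV i Dxw).
  have := ler_pM (normr_ge0 _) (normr_ge0 _) (c11_h kW Dx) (c11_Vlip hV i Dx Dxw).
  have := ler_pM (normr_ge0 _) (normr_ge0 _) (c11_lip hV Dx Dxw) (c11_V kW i Dxw).
  have := ler_pM (normr_ge0 _) (normr_ge0 _) (c11_h hV Dx) (c11_Vlip kW i Dx Dxw).
  rewrite (_ : K2 * l1 w * K1 = K1 * K2 * l1 w); last by ring.
  rewrite (_ : K1 * l1 w * K2 = K1 * K2 * l1 w); last by ring.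
  rewrite (_ : K2 * (K1 * l1 w) = K1 * K2 * l1 w); last by ring.
  rewrite (mulrA K1) -(mulrA 4); lra.
- move=> x w Dx Dxw; have l0 := l1_ge0 w.
  rewrite dotpDl !dotpZl.
  have dV : `|dotp (V x) w| <= K1 * l1 w by apply: dotp_l1 => i; exact (c11_V hV i Dx).
  rewrite (_ : _ - _ = (h (x + w) - h x - dotp (V x) w) * k (x + w) +
     h x * (k (x + w) - k x - dotp (W x) w) + dotp (V x) w * (k (x + w) - k x)); last by ring.
  apply: (le_trans (ler_normD _ _)).
  apply: (le_trans (lerD (ler_normD _ _) (lexx _))); rewrite !normrM.
  have := ler_pM (normr_ge0 _) (normr_ge0 _) (c11_taylor hV Dx Dxw) (c11_h kW Dxw).
  have := ler_pM (normr_ge0 _) (normr_ge0 _) (c11_h hV Dx) (c11_taylor kW Dx Dxw).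
  have := ler_pM (normr_ge0 _) (normr_ge0 _) dV (c11_lip kW Dx Dxw).
  have : 0 <= K1 * K2 * l1 w ^+ 2 by rewrite mulr_ge0// sqr_ge0.
  rewrite (_ : K1 * l1 w * (K2 * l1 w) = K1 * K2 * l1 w ^+ 2); last by ring.
  rewrite (_ : K1 * l1 w ^+ 2 * K2 = K1 * K2 * l1 w ^+ 2); last by ring.
  rewrite (mulrA K1) -(mulrA 4); lra.
Qed.

Lemma c11_addc D K h V (c : R) : 0 <= K -> c11on D K h V -> c11on D (K + `|c|) (fun x => h x + c) V.
Proof.
move=> K0 hV; have c0 := normr_ge0 c; split.
- move=> x Dx; apply: (le_trans (ler_normD _ _)); rewrite lerD2r; exact (c11_h hV Dx).
- move=> x i Dx; apply: (le_trans (c11_V hV i Dx)); lra.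
- move=> x w Dx Dxw; rewrite opprD addrACA subrr addr0.
  apply: (le_trans (c11_lip hV Dx Dxw)); rewrite ler_wpM2r ?l1_ge0//; lra.
- move=> x w i Dx Dxw; apply: (le_trans (c11_Vlip hV i Dx Dxw)).
  rewrite ler_wpM2r ?l1_ge0//; lra.
- move=> x w Dx Dxw; rewrite [X in X - dotp _ _](_ : _ = h (x + w) - h x); last by ring.
  apply: (le_trans (c11_taylor hV Dx Dxw)); rewrite ler_wpM2r ?sqr_ge0//; lra.
Qed.

Definition ball1 (r : R) : set 'rV[R]_n := [set x | l1 x <= r].

(** The margin 1 between the radii separates two cases. A pair of points not both in the larger ball
    either lies entirely outside the smaller one, where [h] and [V] vanish, or is at distance at
    least 1, where the sup bounds suffice at the price of the factor 2. *)
Lemma c11_globalize r K h V : 0 <= r -> 0 <= K -> c11on (ball1 (r + 1)) K h V ->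
  (forall x, r < l1 x -> h x = 0 /\ V x = 0) -> c11on setT (2 * K) h V.
Proof.
move=> r0 K0 hV out.
have in1 x : l1 x <= r -> ball1 (r + 1) x by rewrite /ball1/=; lra.
have hb x : `|h x| <= K.
  have [xr|xr] := leP (l1 x) r; first by apply: (c11_h hV); exact: in1.
  by have [-> _] := out x xr; rewrite normr0.
have Vb x i : `|V x 0 i| <= K.
  have [xr|xr] := leP (l1 x) r; first by apply: (c11_V hV); exact: in1.
  by have [_ ->] := out x xr; rewrite mxE normr0.
have far x w : ~ (ball1 (r + 1) x /\ ball1 (r + 1) (x + w)) ->
  [\/ r < l1 x /\ r < l1 (x + w), [/\ r < l1 x & 1 <= l1 w] | [/\ r < l1 (x + w) & 1 <= l1 w]].
  move=> nD.
  have t1 := l1D x w.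
  have t2 : l1 x <= l1 (x + w) + l1 w.
    have := l1D (x + w) (- w); rewrite addrK.
    by rewrite -[- w]scaleN1r l1Z normrN1 mul1r.
  have [xr|xr] := leP (l1 x) r; have [yr|yr] := leP (l1 (x + w)) r.
  - by exfalso; apply: nD; split; apply: in1.
  - apply: Or33; split => //; rewrite leNgt; apply/negP => w1; apply: nD.
    by split; rewrite /ball1/=; lra.
  - apply: Or32; split => //; rewrite leNgt; apply/negP => w1; apply: nD.
    by split; rewrite /ball1/=; lra.
  - by apply: Or31.
have l2 w : 1 <= l1 w -> 1 <= l1 w ^+ 2 /\ l1 w <= l1 w ^+ 2.
  by move=> w1; split; nra.
have K2w w : 1 <= l1 w -> 2 * K <= 2 * K * l1 w.
  by move=> w1; rewrite ler_peMr//; lra.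
split.
- by move=> x _; have := hb x; lra.
- by move=> x i _; have := Vb x i; lra.
- move=> x w _ _; have l0 := l1_ge0 w.
  have [[D1 D2]|/far[[/out[-> _] /out[-> _]]|[_ w1]|[_ w1]]] := pselect (ball1 (r + 1) x /\ ball1 (r + 1) (x + w)).
  + apply: (le_trans (c11_lip hV D1 D2)); rewrite ler_wpM2r//; lra.
  + by rewrite subrr normr0; rewrite !mulr_ge0.
  + apply: le_trans (K2w _ w1); apply: (le_trans (ler_normB _ _)).
    have := hb x; have := hb (x + w); lra.
  + apply: le_trans (K2w _ w1); apply: (le_trans (ler_normB _ _)).
    have := hb x; have := hb (x + w); lra.
- move=> x w i _ _; have l0 := l1_ge0 w.
  have [[D1 D2]|/far[[/out[_ ->] /out[_ ->]]|[_ w1]|[_ w1]]] := pselect (ball1 (r + 1) x /\ ball1 (r + 1) (x + w)).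
  + apply: (le_trans (c11_Vlip hV i D1 D2)); rewrite ler_wpM2r//; lra.
  + by rewrite subrr normr0; rewrite !mulr_ge0.
  + apply: le_trans (K2w _ w1); apply: (le_trans (ler_normB _ _)).
    have := Vb x i; have := Vb (x + w) i; lra.
  + apply: le_trans (K2w _ w1); apply: (le_trans (ler_normB _ _)).
    have := Vb x i; have := Vb (x + w) i; lra.
- move=> x w _ _; have l0 := l1_ge0 w.
  have dV : `|dotp (V x) w| <= K * l1 w by apply: dotp_l1 => i; exact: Vb.
  have [[D1 D2]|/far[[/out[-> ->] /out[-> _]]|[/out[-> ->] w1]|[/out[-> _] w1]]] := pselect (ball1 (r + 1) x /\ ball1 (r + 1) (x + w)).
  + apply: (le_trans (c11_taylor hV D1 D2)); rewrite ler_wpM2r ?sqr_ge0//; lra.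
  + rewrite /dotp big1 ?subr0 ?normr0; first by rewrite !mulr_ge0 ?sqr_ge0.
    by move=> i _; rewrite mxE mul0r.
  + rewrite /dotp big1; last by move=> i _; rewrite mxE mul0r.
    rewrite !subr0; apply: (le_trans (hb _)); have [w2 _] := l2 _ w1; nra.
  + rewrite add0r; apply: (le_trans (ler_normB _ _)); rewrite normrN.
    have := hb x; have [w2 w3] := l2 _ w1; nra.
Qed.

Lemma line_is_derive F x w (t : R) : (forall y, differentiable F y) ->
  is_derive t 1 (fun t => F (x + t *: w)) (dotp (grad F (x + t *: w)) w).
Proof.
move=> dF; set y := x + t *: w.
have E : (fun h : R => h^-1 *: (((fun t => F (x + t *: w)) \o shift t) (h *: (1 : R)) - F (x + t *: w))) =
         (fun r : R => r^-1 *: ((F \o shift y) (r *: w) - F y)).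
  apply/funext => h /=; congr (_ *: (F _ - _)).
  by rewrite /y [h *: 1]mulr1 scalerDl addrCA.
have dw : derivable F y w by exact: diff_derivable.
have -> : dotp (grad F y) w = derive F y w.
  rewrite deriveE//.
  have wE : w = \sum_(i < n) w 0 i *: (ebasis i : 'rV[R]_n).
    apply/rowP => j; rewrite summxE (bigD1 j)//= !mxE eqxx mulr1 big1 ?addr0// => i ij.
    by rewrite !mxE eq_sym (negbTE ij) mulr0.
  rewrite [in RHS]wE linear_sum; apply: eq_bigr => i _.
  by rewrite linearZ/= mxE /partial deriveE// mulrC.
apply: DeriveDef; first by rewrite /derivable E.
by rewrite /derive E.
Qed.

Lemma mvt_line F x w : (forall y, differentiable F y) ->
  exists2 t : R, 0 <= t <= 1 & F (x + w) - F x = dotp (grad F (x + t *: w)) w.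
Proof.
move=> dF.
have [t||t t01 E] := @MVT_segment R (fun t => F (x + t *: w)) (fun t => dotp (grad F (x + t *: w)) w) 0 1 ler01.
- by move=> _; exact: line_is_derive.
- apply: derivable_within_continuous => t _.
  by have [] := line_is_derive x w t dF.
- exists t; first by rewrite in_itv/= in t01.
  by move: E; rewrite scale1r scale0r addr0 subr0 mulr1.
Qed.

Lemma c11_C2 D K F : (forall y, differentiable F y) ->
  (forall i y, differentiable (partial i F) y) ->
  (forall x w t, D x -> D (x + w) -> 0 <= t <= 1 -> D (x + t *: w)) ->
  (forall x, D x -> `|F x| <= K) ->
  (forall i x, D x -> `|partial i F x| <= K) ->
  (forall i j x, D x -> `|partial j (partial i F) x| <= K) ->
  c11on D K F (grad F).
Proof.
move=> dF dP cD F0 F1 F2.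
have lip G x w : (forall y, differentiable G y) -> (forall i x, D x -> `|partial i G x| <= K) ->
    D x -> D (x + w) -> `|G (x + w) - G x| <= K * l1 w.
  move=> dG G1 Dx Dxw; have [t t01 ->] := mvt_line x w dG.
  by apply: dotp_l1 => i; rewrite mxE; apply: G1; exact: cD.
split => //.
- by move=> x i Dx; rewrite mxE; exact: F1.
- by move=> x w Dx Dxw; exact: lip.
- by move=> x w i Dx Dxw; rewrite !mxE; apply: lip => // j y Dy; exact: F2.
- move=> x w Dx Dxw; have [t /andP[t0 t1] ->] := mvt_line x w dF.
  have Dt : D (x + t *: w) by apply: cD => //; rewrite t0.
  rewrite (_ : _ - _ = dotp (grad F (x + t *: w) - grad F x) w); last first.
    by rewrite -[- grad F x]scaleN1r dotpDl dotpZl mulN1r.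
  rewrite expr2 mulrA; apply: dotp_l1 => i; rewrite !mxE.
  have K0 : 0 <= K * l1 w.
    by apply: le_trans (lip F x w dF F1 Dx Dxw).
  apply: (le_trans (lip _ x (t *: w) (dP i) (F2 i) Dx Dt)).
  by rewrite l1Z ger0_norm// mulrCA ler_piMl.
Qed.

Lemma ball1_convex r x w (t : R) : ball1 r x -> ball1 r (x + w) -> 0 <= t <= 1 -> ball1 r (x + t *: w).
Proof.
rewrite /ball1/= => h1 h2 /andP[t0 t1].
rewrite (_ : x + t *: w = (1 - t) *: x + t *: (x + w)); last first.
  by rewrite scalerBl scale1r scalerDr addrA subrK.
apply: (le_trans (l1D _ _)); rewrite !l1Z (ger0_norm t0) ger0_norm ?subr_ge0//.
have : (1 - t) * l1 x <= (1 - t) * r by rewrite ler_wpM2l// subr_ge0.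
have : t * l1 (x + w) <= t * r by rewrite ler_wpM2l.
lra.
Qed.

Lemma continuous_ball1_bounded F r : continuous F -> exists K, 0 <= K /\ forall x, ball1 r x -> `|F x| <= K.
Proof.
move=> cF.
have cK : compact [set x : 'rV[R]_n | forall i, `[- r, r]%classic (x 0 i)].
  by apply: (@rV_compact R n (fun=> `[- r, r]%classic)) => i; exact: segment_compact.
have /compact_bounded[N [_ HN]] := continuous_compact (continuous_subspaceT cF) cK.
exists (`|N| + 1); split; first by rewrite addr_ge0.
move=> x xr; apply: HN; first by rewrite (le_lt_trans (ler_norm _))// ltrDl.
exists x => // i; rewrite /= in_itv/= -ler_norml; exact: le_trans (l1_coord x i) xr.
Qed.

Lemma finite_bound (I : finType) (Q : I -> R -> Prop) :
  (forall i, exists K, 0 <= K /\ Q i K) -> (forall i K K', K <= K' -> Q i K -> Q i K') ->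
  exists K, 0 <= K /\ forall i, Q i K.
Proof.
move=> /choice[k hk] mono; exists (\sum_i k i); split.
  by apply: sumr_ge0 => i _; exact: (hk i).1.
move=> i; apply: (mono _ (k i)); last exact: (hk i).2.
by rewrite (bigD1 i)//= lerDl sumr_ge0// => j _; exact: (hk j).1.
Qed.

Lemma smooth_c11_ball F r : smooth F -> exists K, 0 <= K /\ c11on (ball1 r) K F (grad F).
Proof.
move=> sF; have [c0 [d0 P1]] := sF 2%N.
have d1 i y : differentiable (partial i F) y by have [_ [+ _]] := P1 i; exact.
have c1 i : continuous (partial i F) by have [+ _] := P1 i.
have c2 i j : continuous (partial j (partial i F)) by have [_ [_ /(_ j)[]]] := P1 i.
have [K0 [K00 H0]] := continuous_ball1_bounded r c0.
have [K1 [K10 H1]] : exists K, 0 <= K /\ forall i x, ball1 r x -> `|partial i F x| <= K.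
  apply: (@finite_bound _ (fun i K => forall x, ball1 r x -> `|partial i F x| <= K)).
    by move=> i; exact: continuous_ball1_bounded.
  by move=> i K K' KK h x /h; lra.
have [K2 [K20 H2]] : exists K, 0 <= K /\ forall p : 'I_n * 'I_n, forall x, ball1 r x -> `|partial p.2 (partial p.1 F) x| <= K.
  apply: (@finite_bound _ (fun p K => forall x, ball1 r x -> `|partial p.2 (partial p.1 F) x| <= K)).
    by move=> i; exact: continuous_ball1_bounded.
  by move=> i K K' KK h x /h; lra.
exists (K0 + K1 + K2); split; first by rewrite !addr_ge0.
apply: c11_C2 => //.
- by move=> x w t; exact: ball1_convex.
- by move=> x /H0; lra.
- by move=> i x /(H1 i); lra.
- by move=> i j x /(H2 (i, j)) /=; lra.
Qed.

End Regularity.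

(** * The cutoff function *)

Section Cutoff.
Context {R : realType} {n : nat}.
Implicit Types (F G h k u : 'rV[R]_n -> R) (V W : 'rV[R]_n -> 'rV[R]_n) (x y z w v c : 'rV[R]_n) (a s e M L K : R) (D : set 'rV[R]_n).

Definition tent a x : R := Num.max 0 (1 - a ^+ 2 * dotp x x).
(** Squaring the tent makes the gradient Lipschitz and gives |grad|^2 <= 16 a^2 [cutoff], so the
    squared gradient can be divided by the cutoff near the edge of the support. *)
Definition cutoff a x : R := tent a x ^+ 2.
Definition dcutoff a x : 'rV[R]_n := (- (4 * a ^+ 2 * tent a x)) *: x.

Lemma tent01 a x : 0 <= tent a x <= 1.
Proof.
rewrite /tent le_max lexx/= ge_max ler01/= gerBl mulr_ge0 ?sqr_ge0//.
exact: dotp_ge0.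
Qed.

Lemma cutoff01 a x : 0 <= cutoff a x <= 1.
Proof. by have /andP[h1 h2] := tent01 a x; rewrite /cutoff sqr_ge0 exprn_ile1. Qed.

Lemma tent_out a x : 1 <= a ^+ 2 * dotp x x -> tent a x = 0.
Proof. by move=> h; rewrite /tent; apply/max_idPl; rewrite subr_le0. Qed.

Lemma cutoff_out a x : 1 <= a ^+ 2 * dotp x x -> cutoff a x = 0 /\ dcutoff a x = 0.
Proof.
by move=> /tent_out h; rewrite /cutoff /dcutoff h expr0n mulr0 oppr0 scale0r.
Qed.

Lemma cutoff_lb a x : 1 - cutoff a x <= 2 * (a ^+ 2 * dotp x x).
Proof.
have q0 : 0 <= a ^+ 2 * dotp x x by rewrite mulr_ge0 ?sqr_ge0// dotp_ge0.
set q := a ^+ 2 * _ in q0 *.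
have : 1 - q <= tent a x by rewrite /tent le_max lexx orbT.
have /andP[] := tent01 a x; rewrite /cutoff; set p := tent a x => *; nra.
Qed.

Lemma coord_sqr_le x i : x 0 i ^+ 2 <= dotp x x.
Proof.
rewrite /dotp (bigD1 i)//= expr2 lerDl sumr_ge0// => j _.
by rewrite -expr2 sqr_ge0.
Qed.

Lemma dcutoff_le a x i : 0 < a -> `|dcutoff a x 0 i| <= 4 * a.
Proof.
move=> a0; have [h|h] := leP 1 (a ^+ 2 * dotp x x).
  by have [_ ->] := cutoff_out h; rewrite mxE normr0 mulr_ge0// ltW.
have ax : `|a * x 0 i| <= 1.
  rewrite -(@ler_pXn2r _ 2) ?nnegrE// real_normK ?num_real// expr1n exprMn.
  by apply: le_trans (ltW h); rewrite ler_wpM2l ?sqr_ge0// coord_sqr_le.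
have /andP[t0 t1] := tent01 a x.
rewrite mxE (_ : _ * _ = - (4 * a * tent a x) * (a * x 0 i)); last by ring.
have a40 : 0 <= 4 * a by rewrite mulr_ge0// ltW.
have at0 : 0 <= 4 * a * tent a x by rewrite mulr_ge0.
rewrite normrM normrN (ger0_norm at0) -[leRHS]mulr1; apply: ler_pM => //.
by rewrite -[leRHS]mulr1 ler_wpM2l.
Qed.

Lemma dcutoff_sqr a x : dotp (dcutoff a x) (dcutoff a x) <= 16 * a ^+ 2 * cutoff a x.
Proof.
rewrite /dcutoff dotpZl dotpZr /cutoff.
have [h|h] := leP 1 (a ^+ 2 * dotp x x).
  by rewrite (tent_out h) mulr0 oppr0 mul0r expr0n mulr0.
rewrite (_ : _ * _ = (16 * a ^+ 2 * tent a x ^+ 2) * (a ^+ 2 * dotp x x)); last by ring.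
apply: ler_piMr; last exact: ltW.
by apply: mulr_ge0; [apply: mulr_ge0 => //; exact: sqr_ge0|exact: sqr_ge0].
Qed.

Lemma l1_out a x : 0 < a -> n%:R / a < l1 x -> 1 <= a ^+ 2 * dotp x x.
Proof.
move=> a0 h; rewrite leNgt; apply/negP => h1; move: h; apply/negP; rewrite -leNgt.
rewrite /l1 (_ : n%:R / a = \sum_(i < n) a^-1); last first.
  by rewrite sumr_const card_ord mulr_natl.
apply: ler_sum => i _.
have ax : `|a * x 0 i| <= 1.
  rewrite -(@ler_pXn2r _ 2) ?nnegrE// real_normK ?num_real// expr1n exprMn.
  by apply: le_trans (ltW h1); rewrite ler_wpM2l ?sqr_ge0// coord_sqr_le.
by move: ax; rewrite normrM (gtr0_norm a0) -ler_pdivlMl// mulr1.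
Qed.

Lemma tent_lip a x y : `|tent a y - tent a x| <= `|a ^+ 2 * dotp y y - a ^+ 2 * dotp x x|.
Proof.
rewrite /tent; set p := a ^+ 2 * dotp y y; set q := a ^+ 2 * dotp x x.
have [h1|h1] := leP 0 (1 - p); have [h2|h2] := leP 0 (1 - q).
- by rewrite (_ : _ - _ = - (p - q)) ?normrN//; ring.
- rewrite subr0 ger0_norm// distrC ger0_norm; lra.
- rewrite sub0r normrN ger0_norm// ger0_norm; lra.
- by rewrite subrr normr0.
Qed.

Lemma cutoff_c11 a : 0 < a -> exists K, 0 <= K /\ c11on setT K (cutoff a) (dcutoff a).
Proof.
move=> a0; set r := n%:R / a.
have r0 : 0 <= r by rewrite divr_ge0// ltW.
pose rho := r + 1; have rho0 : 0 <= rho by rewrite addr_ge0.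
pose Ku := 2 * a ^+ 2 * rho.
have a20 : 0 <= a ^+ 2 by exact: sqr_ge0.
have a24 : 0 <= 4 * a ^+ 2 by exact: mulr_ge0.
have Ku0 : 0 <= Ku by apply: mulr_ge0 => //; exact: mulr_ge0.
have arho : 0 <= 4 * a ^+ 2 * rho by exact: mulr_ge0.
have aKr : 0 <= 4 * a ^+ 2 * (Ku * rho + 1) by apply: mulr_ge0 => //; apply: addr_ge0 => //; exact: mulr_ge0.
have Ku20 : 0 <= Ku ^+ 2 by exact: sqr_ge0.
pose K := 1 + 4 * a ^+ 2 * rho + 2 * Ku + 4 * a ^+ 2 * (Ku * rho + 1) + Ku ^+ 2 + 2 * a ^+ 2.
have K0 : 0 <= K by rewrite /K; lra.
exists (2 * K); split; first by rewrite mulr_ge0.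
apply: (@c11_globalize _ _ r) => //; last by move=> x h; apply: cutoff_out; exact: l1_out.
have ul x w : ball1 rho x -> ball1 rho (x + w) ->
    `|a ^+ 2 * dotp (x + w) (x + w) - a ^+ 2 * dotp x x| <= Ku * l1 w.
  rewrite /ball1/= => h1 h2.
  rewrite (_ : _ - _ = a ^+ 2 * (dotp x w + dotp (x + w) w)); last first.
    by rewrite !dotpDl !dotpDr (dotpC w x); ring.
  rewrite normrM ger0_norm// (_ : Ku * l1 w = a ^+ 2 * (rho * l1 w + rho * l1 w)); last by rewrite /Ku; ring.
  rewrite ler_wpM2l// (le_trans (ler_normD _ _))//; apply: lerD; apply: dotp_l1 => i.
    exact: le_trans (l1_coord x i) h1.
  exact: le_trans (l1_coord (x + w) i) h2.
have pl x w : ball1 rho x -> ball1 rho (x + w) -> `|tent a (x + w) - tent a x| <= Ku * l1 w.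
  by move=> h1 h2; apply: (le_trans (tent_lip _ _ _)); exact: ul.
split.
- move=> x _; have /andP[h1 h2] := cutoff01 a x; rewrite ger0_norm// (le_trans h2)//.
  by rewrite /K; lra.
- move=> x i xr; have /andP[t0 t1] := tent01 a x.
  have at0 : 0 <= 4 * a ^+ 2 * tent a x by exact: mulr_ge0.
  rewrite mxE mulNr normrN normrM (ger0_norm at0).
  apply: (@le_trans _ _ (4 * a ^+ 2 * rho)); last by rewrite /K; lra.
  apply: ler_pM => //.
    by rewrite ler_piMr.
  exact: le_trans (l1_coord x i) xr.
- move=> x w h1 h2; have l0 := l1_ge0 w.
  rewrite /cutoff (_ : _ - _ = (tent a (x + w) - tent a x) * (tent a (x + w) + tent a x)); last by ring.
  apply: (@le_trans _ _ (2 * Ku * l1 w)); last by rewrite ler_wpM2r// /K; lra.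
  rewrite normrM (_ : 2 * Ku * l1 w = Ku * l1 w * 2); last by ring.
  apply: ler_pM => //; first exact: pl.
  have /andP[t0 t1] := tent01 a x; have /andP[t2 t3] := tent01 a (x + w).
  rewrite ger0_norm; lra.
- move=> x w i h1 h2; have l0 := l1_ge0 w.
  have /andP[t0 t1] := tent01 a x; have /andP[t2 t3] := tent01 a (x + w).
  rewrite !mxE (_ : _ - _ = - (4 * a ^+ 2 * ((tent a (x + w) - tent a x) * (x + w) 0 i + tent a x * w 0 i))); last by rewrite !mxE; ring.
  apply: (@le_trans _ _ (4 * a ^+ 2 * (Ku * rho + 1) * l1 w)); last first.
    by rewrite ler_wpM2r// /K; lra.
  rewrite normrN normrM (ger0_norm a24) -[leRHS]mulrA; apply: ler_wpM2l => //.
  apply: (le_trans (ler_normD _ _)); rewrite !normrM mulrDl mul1r; apply: lerD.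
    rewrite mulrAC; apply: ler_pM => //; first exact: pl.
    exact: le_trans (l1_coord (x + w) i) h2.
  by rewrite -[leRHS]mul1r; apply: ler_pM => //; [rewrite ger0_norm|exact: l1_coord].
- move=> x w h1 h2; have l0 := l1_ge0 w.
  have /andP[t0 t1] := tent01 a x; have /andP[t2 t3] := tent01 a (x + w).
  set d := a ^+ 2 * dotp (x + w) (x + w) - a ^+ 2 * dotp x x.
  (* The linear term is expressed through the increment [d] of a^2 |x|^2; the last summand removes
     the quadratic part of that increment. *)
  have dE : dotp (dcutoff a x) w = - (2 * tent a x * d) + 2 * tent a x * a ^+ 2 * dotp w w.
    by rewrite /dcutoff dotpZl /d !dotpDl !dotpDr (dotpC w x); ring.
  have ww : 0 <= dotp w w <= l1 w ^+ 2.
    rewrite dotp_ge0/= expr2 (le_trans (ler_norm _))//.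
    by apply: dotp_l1; exact: l1_coord.
  have dl : d ^+ 2 <= Ku ^+ 2 * l1 w ^+ 2.
    rewrite -exprMn -real_normK ?num_real//; apply: lerXn2r; rewrite ?nnegrE//; first exact: mulr_ge0.
    by rewrite /d; exact: ul.
  (* One-dimensional Taylor bound for the convex function p -> max(0, 1 - p)^2, with its corner
     cases. *)
  have key : 0 <= tent a (x + w) ^+ 2 - tent a x ^+ 2 + 2 * tent a x * d <= d ^+ 2.
    rewrite /d /tent; set p := a ^+ 2 * dotp x x; set q := a ^+ 2 * dotp (x + w) (x + w).
    have [k1|k1] := leP 0 (1 - p); have [k2|k2] := leP 0 (1 - q).
    - by rewrite (_ : _ + _ = (q - p) ^+ 2) ?sqr_ge0 ?lexx//; ring.
    - rewrite expr0n /= sub0r; apply/andP; split.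
        rewrite (_ : - (1 - p) ^+ 2 + 2 * (1 - p) * (q - p) = (1 - p) * (2 * (q - p) - (1 - p))); last by ring.
        by apply: mulr_ge0 => //; lra.
      rewrite -subr_ge0 (_ : _ - _ = (q - p - (1 - p)) ^+ 2) ?sqr_ge0//; ring.
    - rewrite expr0n /= subr0 mulr0 mul0r addr0 sqr_ge0/= -[leRHS]sqrrN.
      by apply: lerXn2r; rewrite ?nnegrE; lra.
    - by rewrite expr0n /= subr0 mulr0 mul0r addr0 lexx sqr_ge0.
  have aw : 0 <= 2 * tent a x * a ^+ 2 * dotp w w <= 2 * a ^+ 2 * l1 w ^+ 2.
    have /andP[w1 w2] := ww; apply/andP; split.
      by apply: mulr_ge0 => //; apply: mulr_ge0 => //; exact: mulr_ge0.
    apply: ler_pM => //; first by apply: mulr_ge0 => //; exact: mulr_ge0.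
    by rewrite ler_wpM2r//; lra.
  apply: (@le_trans _ _ (Ku ^+ 2 * l1 w ^+ 2 + 2 * a ^+ 2 * l1 w ^+ 2)); last first.
    by rewrite -mulrDl ler_wpM2r ?sqr_ge0// /K; lra.
  rewrite dE /cutoff ler_norml; move: key aw; set A := 2 * tent a x * d; set B := 2 * tent a x * a ^+ 2 * dotp w w.
  move=> /andP[g1 g2] /andP[g3 g4]; apply/andP; split; lra.
Qed.

Lemma c11_pos_c11 K e u V : 0 < e -> 0 <= K -> (forall x, 0 <= u x) -> c11on setT K u V ->
  pos_c11 e (K + e) K (fun x => u x + e) V.
Proof.
move=> e0 K0 u0 uV; split.
- by move=> x; rewrite lerDr.
- by move=> x; rewrite lerD2r (le_trans (ler_norm _))// (c11_h uV).
- by move=> x i; exact: (c11_V uV i I).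
- move=> x w; rewrite (_ : _ - _ = u (x + w) - u x); last by ring.
  by apply: (c11_lip uV).
- by move=> x w i; apply: (c11_Vlip uV).
- move=> x w; rewrite (_ : u (x + w) + e - _ = u (x + w) - u x); last by ring.
  by apply: (c11_taylor uV).
Qed.

Lemma c11_bm K u V : c11on setT K u V -> bm u /\ forall i, bm (fun x => V x 0 i).
Proof.
move=> uV; split.
  split; last by exists K => x; apply: (c11_h uV).
  by apply: (@lip_measurable _ _ _ K) => x w; apply: (c11_lip uV).
move=> i; split; last by exists K => x; apply: (c11_V uV).
by apply: (@lip_measurable _ _ _ K) => x w; apply: (c11_Vlip uV).
Qed.

Lemma c11_ibp K u V i : c11on setT K u V -> gE (fun x => V x 0 i) = gE (fun x => x 0 i * u x).
Proof.
move=> uV; have [bu bV] := c11_bm uV.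
apply: (@gE_ibp _ _ _ _ i K) => // x t.
have := c11_taylor uV (x := x) (w := t *: ebasis i) I I.
rewrite dotpZr l1Z.
have -> : l1 (ebasis i : 'rV[R]_n) = 1.
  rewrite /l1 (bigD1 i)//= mxE eqxx normr1 big1 ?addr0// => j ji.
  by rewrite mxE (negbTE ji) normr0.
have -> : dotp (V x) (ebasis i) = V x 0 i.
  rewrite /dotp (bigD1 i)//= mxE eqxx mulr1 big1 ?addr0// => j ji.
  by rewrite mxE (negbTE ji) mulr0.
by rewrite mulr1 real_normK ?num_real.
Qed.

End Cutoff.

(** * Limits under the Gaussian expectation *)

Section LimitTheorems.
Context {R : realType} {n : nat}.
Implicit Types (F G h u : 'rV[R]_n -> R) (x y z w v : 'rV[R]_n).

Lemma cvg_to_EFin (u : nat -> R) (l : R) :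
  u k @[k --> \oo] --> l -> (u k)%:E @[k --> \oo] --> l%:E.
Proof. by move=> ul; apply/fine_cvgP; split => //; exact: nearW. Qed.

Lemma gE_dominated_cvg (F_ : nat -> 'rV[R]_n -> R) F G :
  (forall k, measurable_fun setT (F_ k)) -> measurable_fun setT F -> gI G ->
  (forall k x, `|F_ k x| <= G x) -> (forall x, F_ k x @[k --> \oo] --> F x) ->
  gE (F_ k) @[k --> \oo] --> gE F.
Proof.
move=> mF_ mF iG FG cF.
have [iF _ cv] : [/\ (gaussm n).-integrable setT (EFin \o F),
    (fun k => \int[gaussm n]_x `|(F_ k x)%:E - (F x)%:E|)%E @ \oo --> 0%E &
    (fun k => \int[gaussm n]_x (F_ k x)%:E)%E @ \oo --> (\int[gaussm n]_x (F x)%:E)%E].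
  apply: (@dominated_convergence _ _ R (gaussm n) setT measurableT
    (fun k x => (F_ k x)%:E) (fun x => (F x)%:E) (fun x => (G x)%:E)) => //.
  - by move=> k; exact/measurable_EFinP.
  - exact/measurable_EFinP.
  - by apply: aeW => x _; exact: cvg_to_EFin.
  - by apply: aeW => x k _ /=; rewrite lee_fin.
have iF_ k : gI (F_ k) by exact: gI_dom (mF_ k) iG (FG k).
rewrite -(EFin_gE iF) in cv.
by have /fine_cvgP[_] := cv.
Qed.

Lemma gE_fatou (F_ : nat -> 'rV[R]_n -> R) F (Y_ : nat -> R) Y :
  (forall k, gI (F_ k)) -> measurable_fun setT F ->
  (forall k x, 0 <= F_ k x) -> (forall x, 0 <= F x) ->
  (forall x, F_ k x @[k --> \oo] --> F x) ->
  (forall k, gE (F_ k) <= Y_ k) -> Y_ k @[k --> \oo] --> Y ->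
  gI F /\ gE F <= Y.
Proof.
move=> iF_ mF F_0 F0 cF FY cY.
have le : (\int[gaussm n]_x (F x)%:E <= Y%:E)%E.
  have := @fatou _ _ R (gaussm n) setT measurableT (fun k x => (F_ k x)%:E)
    (fun k => (measurable_EFinP _ _).2 (gI_meas (iF_ k))) (fun k x _ => F_0 k x).
  set lhs := (X in (X <= _)%E -> _); set rhs := (X in (_ <= X)%E -> _).
  have -> : lhs = (\int[gaussm n]_x (F x)%:E)%E.
    by apply: eq_integral => x _; apply: (cvg_limn_einf_sup (cvg_to_EFin (cF x))).1.
  move=> H; apply: (le_trans H).
  rewrite -(cvg_limn_einf_sup (cvg_to_EFin cY)).1.
  rewrite /rhs !limn_einf_lim; apply: lee_lim; [exact: is_cvg_einfs|exact: is_cvg_einfs|].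
  apply: nearW => m; apply: le_ereal_inf_tmp => _ [k /= mk <-].
  apply: (@le_trans _ _ (gE (F_ k))%:E); last by rewrite lee_fin.
  by rewrite EFin_gE//; apply: ereal_inf_lbound; exists k.
have iF : gI F.
  apply/integrableP; split; first exact/measurable_EFinP.
  under eq_integral do rewrite /= ger0_norm//.
  exact: le_lt_trans le (ltry _).
by split => //; rewrite -lee_fin EFin_gE.
Qed.

(** Only the limit 0 is delicate: with s = sqrt y and y < 1, |y ln y| = 2 s^2 ln(1/s) <= 2 s. *)
Lemma xlnx_cvg (y_ : nat -> R) (y : R) : (forall k, 0 < y_ k) -> 0 <= y ->
  y_ k @[k --> \oo] --> y -> y_ k * ln (y_ k) @[k --> \oo] --> y * ln y.
Proof.
move=> y_0; rewrite le_eqVlt => /predU1P[<-|y0] cy.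
  rewrite mul0r.
  have cs : Num.sqrt (y_ k) @[k --> \oo] --> (0 : R).
    rewrite -[X in _ --> X](@sqrtr0 R).
    by apply: (cvg_comp y_ Num.sqrt cy); exact: sqrt_continuous.
  apply/cvgr0Pnorm_lt => e e0.
  have near1 : \forall k \near \oo, y_ k < 1.
    by apply: (cvgr_lt 0 cy); exact: ltr01.
  have near2 : \forall k \near \oo, Num.sqrt (y_ k) < e / 2.
    by apply: (cvgr_lt 0 cs); rewrite divr_gt0.
  near=> k; have h1 : y_ k < 1 by near: k.
  have h2 : Num.sqrt (y_ k) < e / 2 by near: k.
  set s := Num.sqrt (y_ k) in h2.
  have yk := y_0 k.
  have s0 : 0 < s by rewrite sqrtr_gt0.
  have ss : y_ k = s ^+ 2 by rewrite sqr_sqrtr// ltW.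
  have lnE : ln (y_ k) = - (2 * ln s^-1).
    by rewrite ss lnXn// lnV ?posrE// mulrN opprK mulr_natl.
  have li : ln s^-1 < s^-1 by apply: ln_sublinear; rewrite invr_gt0.
  have l0 : 0 <= ln s^-1.
    apply: ln_ge0; rewrite invf_ge1//.
    have s0' : 0 <= s by exact: ltW.
    by rewrite -(@ler_pXn2r _ 2) ?nnegrE// -ss expr1n ltW.
  rewrite lnE mulrN normrN ger0_norm; last by rewrite mulr_ge0 ?mulr_ge0// ltW.
  apply: (@le_lt_trans _ _ (s ^+ 2 * (2 * s^-1))).
    by rewrite ss; apply: ler_wpM2l; [exact: sqr_ge0|rewrite ler_wpM2l// ltW].
  rewrite (_ : _ * _ = 2 * s); last by field; rewrite gt_eqF.
  lra.
apply: cvgM => //; apply: (cvg_comp y_ (@ln R) cy); exact: continuous_ln.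
Unshelve. all: by end_near.
Qed.
End LimitTheorems.

(** * Smooth densities *)

Section DensityApproximation.
Context {R : realType} {n : nat}.
Implicit Types (F G h u : 'rV[R]_n -> R) (V W : 'rV[R]_n -> 'rV[R]_n) (x y z w v c : 'rV[R]_n) (a s e M L K : R) (D : set 'rV[R]_n).

Context (f : 'rV[R]_n -> R) (sf : smooth f) (f0 : forall x, 0 <= f x).
Context (iF : gI f) (f1 : gE f = 1) (iI : gI (fq f (grad f))).

(* Compactly supported truncations bounded below by 1/(k+1), with gradient [Vk]; these lie in the
   class [pos_c11], which f itself need not. *)
Definition ak (k : nat) : R := k.+1%:R^-1.
Definition gk (k : nat) x : R := f x * cutoff (ak k) x + ak k.
Definition Vk (k : nat) x : 'rV[R]_n := cutoff (ak k) x *: grad f x + f x *: dcutoff (ak k) x.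

Lemma ak_gt0 k : 0 < ak k.
Proof. by rewrite invr_gt0. Qed.

Lemma ak_le1 k : ak k <= 1.
Proof. by rewrite invf_le1// ler1n. Qed.

Lemma ak_cvg : ak k @[k --> \oo] --> (0 : R).
Proof. exact: cvg_harmonic. Qed.

Lemma c11_sub D K V u : c11on setT K u V -> c11on D K u V.
Proof.
by move=> uV; split => *; [apply: (c11_h uV)|apply: (c11_V uV)|apply: (c11_lip uV)
  |apply: (c11_Vlip uV)|apply: (c11_taylor uV)].
Qed.

Lemma gk_c11 k : exists K, 0 <= K /\ c11on setT K (fun x => f x * cutoff (ak k) x) (Vk k).
Proof.
set r := n%:R / ak k.
have r0 : 0 <= r by rewrite divr_ge0// ltW// ak_gt0.
have [K1 [K10 H1]] := smooth_c11_ball (r + 1) sf.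
have [K2 [K20 H2]] := @cutoff_c11 R n _ (ak_gt0 k).
exists (2 * (4 * (K1 * K2))); split; first by rewrite !mulr_ge0.
apply: (@c11_globalize _ _ r) => //; first by rewrite !mulr_ge0.
  by apply: c11_mul => //; exact: c11_sub.
move=> x rx; have [b1 b2] := cutoff_out (l1_out (ak_gt0 k) rx).
by rewrite /Vk b1 b2 mulr0 scale0r scaler0 addr0.
Qed.

Lemma fb_ge0 k x : 0 <= f x * cutoff (ak k) x.
Proof. by rewrite mulr_ge0//; have /andP[] := cutoff01 (ak k) x. Qed.

Lemma gk_pos_c11 k : exists M L, 0 <= L /\ pos_c11 (ak k) M L (gk k) (Vk k).
Proof.
have [K [K0 H]] := gk_c11 k.
exists (K + ak k), K; split => //; apply: c11_pos_c11 => //; first exact: ak_gt0.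
exact: fb_ge0.
Qed.

(** A zero of the nonnegative [f] is a minimum. At such a point [fq] is 0, as a quotient by 0, so
    any bound of the truncated Fisher integrand by it requires the gradient to vanish there. *)
Lemma grad_zero x : f x = 0 -> grad f x = 0.
Proof.
move=> fx0; have [K [K0 H]] := smooth_c11_ball (l1 x + 1) sf.
apply/rowP => i; rewrite [RHS]mxE; set g := grad f x 0 i.
have key (t : R) : `|t| <= 1 -> - (K * t ^+ 2) <= t * g.
  move=> t1.
  have le1 : l1 (t *: ebasis i : 'rV[R]_n) = `|t|.
    rewrite l1Z /l1 (bigD1 i)//= mxE eqxx normr1 big1 ?addr0 ?mulr1// => j ji.
    by rewrite mxE (negbTE ji) normr0.
  have B1 : ball1 (l1 x + 1) x by rewrite /ball1/= lerDl.
  have B2 : ball1 (l1 x + 1) (x + t *: ebasis i).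
    by rewrite /ball1/= (le_trans (l1D _ _))// lerD2l le1.
  have := c11_taylor H B1 B2; rewrite fx0 le1 subr0 dotpZr.
  have -> : dotp (grad f x) (ebasis i) = g.
    rewrite /dotp (bigD1 i)//= mxE [X in _ * X]mxE eqxx mulr1 big1 ?addr0.
      by rewrite /g mxE.
    by move=> j ji; rewrite [X in _ * X]mxE (negbTE ji) mulr0.
  rewrite real_normK ?num_real// ler_norml => /andP[_].
  have := f0 (x + t *: ebasis i); lra.
have g_small (t : R) : 0 < t <= 1 -> `|g| <= K * t.
  move=> /andP[t0 t1].
  have h1 := key t; have h2 := key (- t).
  rewrite normrN gtr0_norm// in h2; rewrite gtr0_norm// in h1.
  have {}h1 := h1 t1; have {}h2 := h2 t1.
  rewrite sqrrN in h2.
  rewrite ler_norml -(ler_pM2l t0) -[X in _ && X](ler_pM2l t0); apply/andP; split; lra.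
apply/eqP; rewrite -normr_le0; apply/ler_addgt0Pr => e e0; rewrite add0r.
have K1 : 0 < 1 + K by rewrite ltr_pwDl.
pose t := Num.min 1 (e / (1 + K)).
have t0 : 0 < t by rewrite lt_min ltr01 divr_gt0.
have t1 : t <= 1 by rewrite ge_min lexx.
have tK : t * (1 + K) <= e by rewrite -ler_pdivlMr// ge_min lexx orbT.
have := g_small t; rewrite t0 t1 => /(_ isT) h; apply: (le_trans h); lra.
Qed.

Lemma dotp_young a (b r : R) v w : 0 < a ->
  dotp (b *: v + r *: w) (b *: v + r *: w) <=
  (1 + a) * (b ^+ 2 * dotp v v) + (1 + a^-1) * (r ^+ 2 * dotp w w).
Proof.
move=> a0; have := dotp_ge0 ((a * b) *: v + (- r) *: w).
rewrite !dotpDl !dotpDr !dotpZl !dotpZr (dotpC w v) => h.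
rewrite -subr_ge0 (_ : _ - _ = (a * b * (a * b * dotp v v) + a * b * (- r * dotp v w)
  + (- r * (a * b * dotp v w) + - r * (- r * dotp w w))) / a).
  by rewrite divr_ge0// ltW.
by field; rewrite gt_eqF.
Qed.

(** Young's inequality with weight [ak k] separates the gradients of [f] and of the cutoff. Its
    factor 1 + 1/a meets the 16 a^2 of [dcutoff_sqr], leaving 16 a^2 + 16 a <= 32 a, while
    [gk >= f * cutoff] absorbs the denominators. *)
Lemma fq_approx k x : fq (gk k) (Vk k) x <= (1 + ak k) * fq f (grad f) x + 32 * ak k * f x.
Proof.
have a0 := ak_gt0 k; have a1 := ak_le1 k; set a := ak k in a0 a1 *.
have fx := f0 x; have bx0 := fb_ge0 k x; rewrite -/a in bx0.
have /andP[b0 b1] := cutoff01 a x; set b := cutoff a x in b0 b1 bx0.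
rewrite /fq; set G := dotp (grad f x) (grad f x).
have G0 : 0 <= G by exact: dotp_ge0.
set dD := dotp (dcutoff a x) (dcutoff a x).
have D0 : 0 <= dD by exact: dotp_ge0.
have D1 : dD <= 16 * a ^+ 2 * b by exact: dcutoff_sqr.
have V1 : dotp (Vk k x) (Vk k x) <= (1 + a) * (b ^+ 2 * G) + (1 + a^-1) * (f x ^+ 2 * dD).
  exact: dotp_young.
have RH0 : 0 <= (1 + a) * (G / f x) + 32 * a * f x.
  by rewrite addr_ge0// mulr_ge0 ?divr_ge0// ?mulr_ge0// ?addr_ge0// ltW.
have gk0 : 0 < gk k x by rewrite /gk -/a ltr_wpDl.
have [fx0|fx0] := eqVneq (f x) 0.
  have -> : dotp (Vk k x) (Vk k x) = 0.
    rewrite /Vk (grad_zero fx0) fx0 scaler0 scale0r addr0 /dotp big1// => i _.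
    by rewrite mxE mul0r.
  by rewrite mul0r.
have fxp : 0 < f x by rewrite lt_def fx0.
have [bz|bz] := eqVneq b 0.
  have -> : dotp (Vk k x) (Vk k x) = 0.
    apply/eqP; rewrite eq_le dotp_ge0 andbT (le_trans V1)//.
    have -> : dD = 0 by apply/eqP; rewrite eq_le D0 andbT (le_trans D1)// bz mulr0.
    by rewrite bz expr0n !mulr0 mul0r !mulr0 addr0.
  by rewrite mul0r.
have bp : 0 < b by rewrite lt_def bz.
apply: (@le_trans _ _ (((1 + a) * (b ^+ 2 * G) + (1 + a^-1) * (f x ^+ 2 * (16 * a ^+ 2 * b))) / (f x * b))).
  apply: ler_pM => //.
  - exact: dotp_ge0.
  - by rewrite invr_ge0 ltW.
  - apply: (le_trans V1); rewrite lerD2l ler_wpM2l ?addr_ge0 ?invr_ge0 ?(ltW a0)//.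
    by rewrite ler_wpM2l ?sqr_ge0.
  - have fb0 : 0 < f x * b by exact: mulr_gt0.
    rewrite lef_pV2 ?posrE//.
    by rewrite /gk -/a -/b lerDl ltW.
rewrite (_ : _ / (f x * b) = (1 + a) * (b * (G / f x)) + (16 * a ^+ 2 + 16 * a) * f x); last first.
  by field; rewrite !gt_eqF.
apply: lerD.
  rewrite ler_wpM2l ?addr_ge0 ?(ltW a0)//.
  by rewrite ler_piMl// divr_ge0.
rewrite ler_wpM2r//; nra.
Qed.

Lemma cutoff_ak_cvg x : cutoff (ak k) x @[k --> \oo] --> (1 : R).
Proof.
have c0 : (1 - 2 * (ak k ^+ 2 * dotp x x)) @[k --> \oo] --> (1 - 2 * (0 ^+ 2 * dotp x x) : R).
  apply: cvgB; first exact: cvg_cst.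
  apply: cvgM; first exact: cvg_cst.
  apply: cvgM; last exact: cvg_cst.
  by under eq_fun do rewrite expr2; rewrite expr2; apply: cvgM; exact: ak_cvg.
rewrite expr0n mul0r mulr0 subr0 in c0.
apply: (squeeze_cvgr (f := fun k => 1 - 2 * (ak k ^+ 2 * dotp x x)) (h := fun=> 1)) c0 _.
  apply: nearW => k; have /andP[h1 h2] := cutoff01 (ak k) x; rewrite h2 andbT.
  have := cutoff_lb (ak k) x; lra.
exact: cvg_cst.
Qed.

Lemma gk_cvg x : gk k x @[k --> \oo] --> f x.
Proof.
rewrite -[X in _ --> X]addr0 -[X in _ --> X + _]mulr1.
apply: cvgD; last exact: ak_cvg.
by apply: cvgM; [exact: cvg_cst|exact: cutoff_ak_cvg].
Qed.

Lemma gk_bm k : bm (gk k).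
Proof. by have [M [L [_ H]]] := gk_pos_c11 k; exact: pos_c11_bm (ak_gt0 k) H. Qed.

Lemma gk_le k x : 0 <= gk k x <= f x + 1.
Proof.
rewrite /gk addr_ge0 ?fb_ge0 ?(ltW (ak_gt0 k))//= lerD ?ak_le1//.
by rewrite ler_piMr//; have /andP[] := cutoff01 (ak k) x.
Qed.

Lemma gE_gk_cvg u : bm u -> gE (fun x => u x * gk k x) @[k --> \oo] --> gE (fun x => u x * f x).
Proof.
move=> [mu [C uC]].
apply: (@gE_dominated_cvg _ _ _ _ (fun x => C * (f x + 1))).
- by move=> k; apply: measurable_funM => //; exact: (gk_bm k).1.
- by apply: measurable_funM => //; exact: gI_meas iF.
- by apply: gIZ; apply: gID => //; exact: gI_cst.
- move=> k x; have /andP[h1 h2] := gk_le k x.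
  by rewrite normrM; apply: ler_pM => //; rewrite ger0_norm.
- by move=> x; apply: cvgM; [exact: cvg_cst|exact: gk_cvg].
Qed.

Lemma gE_gk_cvg1 : gE (gk k) @[k --> \oo] --> (1 : R).
Proof.
have := gE_gk_cvg (bm_cst 1); under eq_fun do under eq_fun do rewrite mul1r.
by under [X in _ --> gE X]eq_fun do rewrite mul1r; rewrite f1.
Qed.

End DensityApproximation.

(** * The stability inequality for smooth densities *)

Section DensityStability.
Context {R : realType} {n : nat}.
Implicit Types (h u : 'rV[R]_n -> R) (V W : 'rV[R]_n -> 'rV[R]_n) (x y z w v : 'rV[R]_n) (e M L K : R).

Lemma cvg_sum_ord (m : nat) (F_ : 'I_m -> nat -> R) (l : 'I_m -> R) :
  (forall i, F_ i k @[k --> \oo] --> l i) ->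
  \sum_(i < m) F_ i k @[k --> \oo] --> \sum_(i < m) l i.
Proof.
move=> H; elim: m F_ l H => [|m IH] F_ l H.
  by under eq_fun do rewrite big_ord0; rewrite big_ord0; exact: cvg_cst.
under eq_fun do rewrite big_ord_recl; rewrite big_ord_recl.
by apply: cvgD; [exact: H|apply: IH => i; exact: H].
Qed.

Lemma coord_cutoff_bm (a : R) i : 0 < a -> bm (fun x => x 0 i * cutoff a x).
Proof.
move=> a0; have [K [K0 H]] := @cutoff_c11 R n a a0; have [[mb _] _] := c11_bm H.
split; first by apply: measurable_funM => //; exact: measurable_coord.
exists a^-1 => x.
have [h|h] := leP 1 (a ^+ 2 * dotp x x).
  by have [-> _] := cutoff_out h; rewrite mulr0 normr0 invr_ge0 ltW.
have ax : `|a * x 0 i| <= 1.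
  rewrite -(@ler_pXn2r _ 2) ?nnegrE// real_normK ?num_real// expr1n exprMn.
  by apply: le_trans (ltW h); rewrite ler_wpM2l ?sqr_ge0// coord_sqr_le.
have /andP[b0 b1] := cutoff01 a x.
rewrite normrM (ger0_norm b0) -[leRHS]mulr1; apply: ler_pM => //.
by move: ax; rewrite normrM (gtr0_norm a0) -ler_pdivlMl// mulr1.
Qed.

Context (f : 'rV[R]_n -> R) (sf : smooth f) (f0 : forall x, 0 <= f x).
Context (iF : gI f) (f1 : gE f = 1) (iI : gI (fq f (grad f))).
Context (phi : 'rV[R]_n -> R) (Kp : R) (Kp0 : 0 <= Kp) (Gphi : 'rV[R]_n -> 'rV[R]_n) (cphi : c11on setT Kp phi Gphi).
Context (phi1 : forall x, `|phi x| <= 1).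
Context (a : R) (a0 : 0 < a) (a1 : a <= 2^-1) (Z0 : 0 < gE (fun x => cutoff a x * f x)).

Let chi := @cutoff R n a.
Let mean h := gE (fun x => phi x * chi x * h x) / gE (fun x => chi x * h x).
(** [psi1] and [psi2] are x_i eta - d_i eta for eta = chi * phi and eta = chi. They are bounded and
    do not involve the density, so in the limit of the truncations only means against fixed
    functions occur. *)
Definition psi1 i x : R := x 0 i * chi x * phi x - phi x * dcutoff a x 0 i - chi x * Gphi x 0 i.
Definition psi2 i x : R := x 0 i * chi x - dcutoff a x 0 i.
(* E[(x_i eta - d_i eta) h] for eta = chi * (phi - c), c = mean h. *)
Definition truncated_stein h i : R := gE (fun x => psi1 i x * h x) - mean h * gE (fun x => psi2 i x * h x).

Let bchi : bm chi.
Proof. by have [K [_ H]] := @cutoff_c11 R n a a0; have [] := c11_bm H. Qed.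
Let bdchi i : bm (fun x => dcutoff a x 0 i).
Proof. by have [K [_ H]] := @cutoff_c11 R n a a0; have [] := c11_bm H. Qed.
Let bphi : bm phi. Proof. by have [] := c11_bm cphi. Qed.
Let bgphi i : bm (fun x => Gphi x 0 i). Proof. by have [] := c11_bm cphi. Qed.

Lemma bmB F G : bm F -> bm G -> bm (fun x : 'rV[R]_n => F x - G x).
Proof.
move=> bF bG; under eq_fun do rewrite -mulN1r.
by apply: bmD => //; apply: bm_mul => //; exact: bm_cst.
Qed.

Lemma bm_psi1 i : bm (psi1 i).
Proof.
apply: bmB; last exact: bm_mul.
by apply: bmB; apply: bm_mul => //; exact: coord_cutoff_bm.
Qed.

Lemma bm_psi2 i : bm (psi2 i).
Proof. by apply: bmB => //; exact: coord_cutoff_bm. Qed.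

Lemma mean_cvg : mean (gk f k) @[k --> \oo] --> mean f.
Proof.
apply: cvgM.
  by apply: gE_gk_cvg => //; exact: bm_mul.
apply: cvgV; first by rewrite gt_eqF.
exact: gE_gk_cvg.
Qed.

Lemma truncated_stein_cvg i : truncated_stein (gk f k) i @[k --> \oo] --> truncated_stein f i.
Proof.
apply: cvgB; first by apply: gE_gk_cvg => //; exact: bm_psi1.
by apply: cvgM; [exact: mean_cvg|apply: gE_gk_cvg => //; exact: bm_psi2].
Qed.

(** Arranged for Fatou's lemma: x ln x + 1 >= 0 makes the left integrand nonnegative, and every term
    on the right converges. *)
Lemma approx_stability k :
  gE (fun x => gk f k x * ln (gk f k x) + 1) <=
  ((1 + ak k) * gE (fq f (grad f)) + 32 * ak k) / 2
  - a ^+ 2 * (gE (@wgt R n) ^+ 2 / (8 * expR 4 * gE (gk f k))) * \sum_(i < n) truncated_stein (gk f k) i ^+ 2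
  + gE (gk f k) * ln (gE (gk f k)) + 1.
Proof.
set g := gk f k.
have [M [L [L0 gV]]] := gk_pos_c11 sf f0 k; rewrite -/g in gV.
have e0 := ak_gt0 (R := R) k.
have bg : bm g := pos_c11_bm e0 gV.
have g0 x : 0 < g x := pos_c11_gt0 e0 gV x.
have chi01 x : 0 <= chi x <= 1 := cutoff01 a x.
set c := mean g.
have ichi : gI (fun x => chi x * g x) by apply: gI_bm; exact: bm_mul.
have iphichi : gI (fun x => phi x * chi x * g x).
  by apply: gI_bm; apply: bm_mul => //; exact: bm_mul.
have nle : `|gE (fun x => phi x * chi x * g x)| <= gE (fun x => chi x * g x).
  apply: gE_norm_le => // x; have /andP[h1 h2] := chi01 x.
  rewrite (normrM (phi x * chi x)) (normrM (phi x)) (ger0_norm h1) (gtr0_norm (g0 x)) ler_wpM2r ?(ltW (g0 x))//.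
  by rewrite ler_piMl.
have Z0' : 0 <= gE (fun x => chi x * g x) by exact: le_trans (normr_ge0 _) nle.
have c1 : `|c| <= 1.
  rewrite /c /mean normrM normfV (ger0_norm Z0').
  have [->|nz] := eqVneq (gE (fun x => chi x * g x)) 0; first by rewrite invr0 mulr0.
  by rewrite ler_pdivrMr ?mul1r// lt_def nz.
pose eta x := chi x * (phi x + - c).
have [Kc [Kc0 Hc]] := @cutoff_c11 R n a a0.
have ceta := c11_mul Kc0 (addr_ge0 Kp0 (normr_ge0 (- c))) Hc (c11_addc (- c) Kp0 cphi).
set We := (fun x : 'rV[R]_n => _ *: _ + _) in ceta.
have beta : bm eta by have [] := c11_bm ceta.
have eta2 x : `|eta x| <= 2.
  have /andP[h1 h2] := chi01 x.
  rewrite (normrM (chi x)) (ger0_norm h1).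
  apply: (@le_trans _ _ (1 * 2)); last by rewrite mul1r.
  apply: ler_pM => //; apply: (le_trans (ler_normD _ _)); rewrite normrN.
  have := phi1 x; lra.
have eta0 x : 1 < a ^+ 2 * dotp x x -> eta x = 0.
  by move=> /ltW/cutoff_out[h _]; rewrite /eta /chi h mul0r.
have etag : gE (fun x => eta x * g x) = 0.
  have -> : (fun x => eta x * g x) = (fun x => phi x * chi x * g x - c * (chi x * g x)).
    by apply/funext => x; rewrite /eta; ring.
  rewrite gEB//; last exact: gIZ.
  rewrite gEZ// /c /mean.
  (* With a zero denominator [c] is 0 by the convention for division, and [nle] makes the numerator
     vanish as well. *)
  have [z|nz] := eqVneq (gE (fun x => chi x * g x)) 0.
    rewrite z invr0 !mulr0 subr0; apply/eqP; rewrite -normr_le0.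
    by move: nle; rewrite z.
  by rewrite divfK// subrr.
pose s := Num.sqrt (1 - a ^+ 2).
have a2 : a ^+ 2 < 1.
  have h0 := a0; have h1 := a1; have : a * a <= a * 2^-1 by rewrite ler_wpM2l// ltW.
  rewrite expr2; lra.
have s0 : 0 < s by rewrite sqrtr_gt0 subr_gt0.
have as1 : a ^+ 2 + s ^+ 2 = 1 by rewrite sqr_sqrtr ?subr_ge0 1?ltW// addrC subrK.
have a01 : 0 <= a <= 2^-1 by rewrite (ltW a0) a1.
have main := class_stability e0 L0 a01 s0 as1 gV beta eta2 eta0 etag.
(* Integration by parts is applied to the product [gk * eta]; moving the term with the gradient of
   [eta] to the other side gives the truncated Stein coordinate. *)
have ibp i : gE (fun x => Vk f k x 0 i * eta x) = truncated_stein g i.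
  have [Kg [Kg0 Hg]] := gk_c11 sf k.
  have cu := c11_mul (addr_ge0 Kg0 (normr_ge0 (ak k))) (mulr_ge0 (ler0n R 4) (mulr_ge0 Kc0 (addr_ge0 Kp0 (normr_ge0 (- c))))) (c11_addc (ak k) Kg0 Hg) ceta.
  have := c11_ibp i cu.
  have -> : (fun x => (eta x *: Vk f k x + (f x * cutoff (ak k) x + ak k) *: We x) 0 i) =
    (fun x => Vk f k x 0 i * eta x + g x * We x 0 i).
    by apply/funext => x; rewrite !mxE /g /gk; ring.
  have bV := pos_c11_bmV gV i.
  have bW : bm (fun x => We x 0 i) by have [_] := c11_bm ceta.
  rewrite gED; [|by apply: gI_bm; exact: bm_mul|by apply: gI_bm; exact: bm_mul].
  move=> E.
  have -> : gE (fun x => Vk f k x 0 i * eta x) =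
     gE (fun x => x 0 i * ((f x * cutoff (ak k) x + ak k) * eta x)) - gE (fun x => g x * We x 0 i).
    by rewrite -E addrK.
  have b3 : bm (fun x => x 0 i * ((f x * cutoff (ak k) x + ak k) * eta x)).
    have -> : (fun x => x 0 i * ((f x * cutoff (ak k) x + ak k) * eta x)) =
      (fun x => (x 0 i * chi x) * ((phi x + - c) * g x)).
      by apply/funext => x; rewrite /eta /g /gk; ring.
    apply: bm_mul; first exact: coord_cutoff_bm.
    by apply: bm_mul => //; apply: bmD => //; exact: bm_cst.
  rewrite -gEB; [|exact: gI_bm|by apply: gI_bm; exact: bm_mul].
  rewrite /truncated_stein -/c -gEZ; last by apply: gI_bm; apply: bm_mul => //; exact: bm_psi2.
  rewrite -gEB; last first.
    by apply: gIZ; apply: gI_bm; apply: bm_mul => //; exact: bm_psi2.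
  - by apply: gI_bm; apply: bm_mul => //; exact: bm_psi1.
  congr gE; apply/funext => x.
  by rewrite /eta /psi1 /psi2 /We !mxE /g /gk /chi; ring.
have fqle : gE (fq g (Vk f k)) <= (1 + ak k) * gE (fq f (grad f)) + 32 * ak k.
  have -> : (1 + ak k) * gE (fq f (grad f)) + 32 * ak k =
    gE (fun x => (1 + ak k) * fq f (grad f) x + 32 * ak k * f x).
    by rewrite gED ?gEZ ?f1 ?mulr1//; exact: gIZ.
  apply: gE_le; [by apply: gI_bm; exact: pos_c11_bm_fq e0 gV|by apply: gID; exact: gIZ|].
  exact: fq_approx sf f0 k.
have bx := pos_c11_bm_xln e0 gV.
rewrite gED; [|exact: gI_bm|exact: gI_cst]; rewrite gE_cst lerD2r -lerBlDr -/(Ent g).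
move: main; under eq_bigr do rewrite ibp.
set S := a ^+ 2 * _ * _ => main; lra.
Qed.

(** Limit of the truncated inequalities: the means of [gk] tend to 1, so the logarithm of the mass
    disappears. Integrability of [f ln f] is not assumed but comes out of Fatou's lemma. *)
Lemma density_stability :
  gI (fun x => f x * ln (f x)) /\
  gE (fun x => f x * ln (f x)) +
    a ^+ 2 * (gE (@wgt R n) ^+ 2 / (8 * expR 4)) * \sum_(i < n) truncated_stein f i ^+ 2 <=
  gE (fq f (grad f)) / 2.
Proof.
pose S k := \sum_(i < n) truncated_stein (gk f k) i ^+ 2.
have cS : S k @[k --> \oo] --> \sum_(i < n) truncated_stein f i ^+ 2.
  apply: cvg_sum_ord => i.
  under eq_fun do rewrite expr2; rewrite expr2; apply: cvgM; exact: truncated_stein_cvg.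
have cm := gE_gk_cvg1 sf f0 iF f1.
have m0 k : 0 < gE (gk f k).
  have [M [L [L0 gV]]] := gk_pos_c11 sf f0 k.
  apply: (lt_le_trans (ak_gt0 k)); rewrite -[leLHS](@gE_cst R n).
  by apply: gE_le; [exact: gI_cst|apply: gI_bm; exact: gk_bm sf f0 k|exact: pos_c11_lo gV].
have := @gE_fatou R n (fun k x => gk f k x * ln (gk f k x) + 1) (fun x => f x * ln (f x) + 1)
  (fun k => ((1 + ak k) * gE (fq f (grad f)) + 32 * ak k) / 2
  - a ^+ 2 * (gE (@wgt R n) ^+ 2 / (8 * expR 4 * gE (gk f k))) * S k
  + gE (gk f k) * ln (gE (gk f k)) + 1)
  (((1 + 0) * gE (fq f (grad f)) + 32 * 0) / 2
  - a ^+ 2 * (gE (@wgt R n) ^+ 2 / (8 * expR 4 * 1)) * (\sum_(i < n) truncated_stein f i ^+ 2)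
  + 1 * ln 1 + 1).
have mf := gI_meas iF.
have xln (y : R) : 0 <= y -> 0 <= y * ln y + 1 :> R.
  rewrite le_eqVlt => /predU1P[<-|y0]; first by rewrite mul0r add0r.
  by have := entropy_tangent ltr01 y0; rewrite ln1 mulr0 subr0; lra.
case.
- move=> k; have [M [L [L0 gV]]] := gk_pos_c11 sf f0 k.
  by apply: gID; [apply: gI_bm; exact: pos_c11_bm_xln (ak_gt0 k) gV|exact: gI_cst].
- by apply: measurable_funD => //; apply: measurable_funM => //; exact: measurableT_comp.
- move=> k x; apply: xln; by have /andP[] := gk_le f0 k x.
- by move=> x; exact: xln.
- move=> x; apply: cvgD; last exact: cvg_cst.
  apply: xlnx_cvg => //; last exact: gk_cvg.
  move=> k; have [M [L [L0 gV]]] := gk_pos_c11 sf f0 k; exact: pos_c11_gt0 (ak_gt0 k) gV x.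
- exact: approx_stability.
- apply: cvgD; last exact: cvg_cst.
  apply: cvgD; last by apply: xlnx_cvg.
  apply: cvgB.
    apply: cvgM; last exact: cvg_cst.
    apply: cvgD.
      apply: cvgM; last exact: cvg_cst.
      by apply: cvgD; [exact: cvg_cst|exact: ak_cvg].
    by apply: cvgM; [exact: cvg_cst|exact: ak_cvg].
  apply: cvgM => //; apply: cvgM; first exact: cvg_cst.
  apply: cvgM; first exact: cvg_cst.
  apply: cvgV; first by rewrite mulr1 gt_eqF// mulr_gt0// expR_gt0.
  by apply: cvgM => //; exact: cvg_cst.
move=> iG; rewrite ln1 !mulr0 !addr0 mul1r mulr1 => H.
have i1 : gI (fun x => f x * ln (f x)).
  rewrite (_ : (fun x => _) = (fun x => (f x * ln (f x) + 1) - 1)); last first.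
    by apply/funext => x; rewrite addrK.
  by apply: gIB => //; exact: gI_cst.
split => //; move: H; rewrite gED//; last exact: gI_cst.
rewrite gE_cst; lra.
Qed.

End DensityStability.

(** * The Stein discrepancy *)

Section SteinBound.
Context {R : realType} {n : nat}.
Implicit Types (x : 'rV[R]_n).
Context (f : 'rV[R]_n -> R) (sf : smooth f) (f0 : forall x, 0 <= f x).
Context (iF : gI f) (f1 : gE f = 1) (iI : gI (fq f (grad f))).
Context (m : R) (m0 : 0 <= m) (i2 : gI (fun x => dotp x x * f x)) (m2 : gE (fun x => dotp x x * f x) <= m).

Let mf : measurable_fun setT f := gI_meas iF.

Lemma coord_le_dotp x i : `|x 0 i| <= 1 + dotp x x.
Proof.
have := coord_sqr_le x i; rewrite -real_normK ?num_real//.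
have := normr_ge0 (x 0 i); set u := `|_|; nra.
Qed.

Lemma gI_moment_le (C : R) (F : 'rV[R]_n -> R) : measurable_fun setT F ->
  (forall x, `|F x| <= C * (1 + dotp x x)) -> gI (fun x => F x * f x).
Proof.
move=> mF FC; apply: (@gI_dom _ _ _ (fun x => C * (f x + dotp x x * f x))).
- exact: measurable_funM.
- by apply: gIZ; exact: gID.
- move=> x; rewrite normrM (ger0_norm (f0 x)).
  rewrite (_ : C * _ = C * (1 + dotp x x) * f x); last by ring.
  by rewrite ler_wpM2r.
Qed.

Lemma gE_moment_le (A B : R) (F : 'rV[R]_n -> R) : 0 <= A -> 0 <= B -> measurable_fun setT F ->
  (forall x, `|F x| <= A * dotp x x + B) -> `|gE (fun x => F x * f x)| <= A * m + B.
Proof.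
move=> A0 B0 mF FC; apply: (@le_trans _ _ (gE (fun x => A * (dotp x x * f x) + B * f x))).
  apply: gE_norm_le.
  - apply: (@gI_moment_le (A + B)) => // x; apply: (le_trans (FC x)).
    have := dotp_ge0 x; nra.
  - by apply: gID; exact: gIZ.
  - move=> x; rewrite normrM (ger0_norm (f0 x)).
    rewrite (_ : _ + _ = (A * dotp x x + B) * f x); last by ring.
    by rewrite ler_wpM2r.
rewrite gED; [|exact: gIZ..]; rewrite !gEZ// f1 mulr1 lerD2r.
by rewrite ler_wpM2l.
Qed.

Lemma gI_coord i : gI (fun x => x 0 i * f x).
Proof.
apply: (@gI_moment_le 1); first exact: measurable_coord.
by move=> x; rewrite mul1r; exact: coord_le_dotp.
Qed.

Let b i := gE (fun x => x 0 i * f x).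

Lemma mean_coord_le i : `|b i| <= m + 1.
Proof.
rewrite -[X in X + _]mul1r; apply: gE_moment_le => //; first exact: measurable_coord.
by move=> x; rewrite mul1r addrC; exact: coord_le_dotp.
Qed.

Context (phi : 'rV[R]_n -> R) (Kp : R) (Kp0 : 0 <= Kp) (Gphi : 'rV[R]_n -> 'rV[R]_n) (cphi : c11on setT Kp phi Gphi).
Context (phi1 : forall x, `|phi x| <= 1) (G1 : forall x i, `|Gphi x 0 i| <= 1).

(** A Stein coordinate of the centred density, with the translation moved onto the test function:
    [phi] will be a test function evaluated at [x - b]. *)
Let D i := gE (fun x => ((x 0 i - b i) * phi x - Gphi x 0 i) * f x).

Let bphi : bm phi. Proof. by have [] := c11_bm cphi. Qed.
Let bgphi i : bm (fun x => Gphi x 0 i). Proof. by have [] := c11_bm cphi. Qed.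

Let mD i : measurable_fun setT (fun x => (x 0 i - b i) * phi x - Gphi x 0 i).
Proof.
apply: measurable_funB; last by have [] := bgphi i.
apply: measurable_funM; last by have [] := bphi.
by apply: measurable_funB => //; exact: measurable_coord.
Qed.

Let D_le x i : `|(x 0 i - b i) * phi x - Gphi x 0 i| <= 1 * dotp x x + (m + 3).
Proof.
apply: (le_trans (ler_normB _ _)); rewrite normrM.
have h1 := coord_le_dotp x i; have h2 := mean_coord_le i; have h3 := G1 x i.
have : `|x 0 i - b i| * `|phi x| <= `|x 0 i - b i| by rewrite ler_piMr.
have := ler_normB (x 0 i) (b i); lra.
Qed.

Lemma stein_coord_le i : `|D i| <= 2 * m + 3.
Proof.
rewrite (_ : 2 * m + 3 = 1 * m + (m + 3)); last by ring.
by apply: gE_moment_le => //; rewrite addr_ge0.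
Qed.

Context (a : R) (a0 : 0 < a) (a1 : a <= 2^-1).

Lemma cutoff_mass : 1 - 2 * a ^+ 2 * m <= gE (fun x => cutoff a x * f x).
Proof.
have [K [K0 H]] := @cutoff_c11 R n a a0; have [[mb _] _] := c11_bm H.
have ic : gI (fun x => cutoff a x * f x).
  apply: (@gI_moment_le 1) => // x; have /andP[h1 h2] := cutoff01 a x.
  by rewrite ger0_norm// mul1r (le_trans h2)// lerDl dotp_ge0.
rewrite lerBlDr -{1}f1; apply: (@le_trans _ _ (gE (fun x => cutoff a x * f x + 2 * a ^+ 2 * (dotp x x * f x)))).
  apply: gE_le => //; first by apply: gID => //; exact: gIZ.
  move=> x; have := ler_wpM2r (f0 x) (cutoff_lb a x); lra.
rewrite gED//; last exact: gIZ.
by rewrite gEZ// lerD2l ler_wpM2l// mulr_ge0// sqr_ge0.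
Qed.

Context (Z0 : 0 < gE (fun x => cutoff a x * f x)).

Let A i := truncated_stein phi Gphi a f i.

(** Both the centring and the choice of [c] enter. Since E[(x_i - b_i) f] = 0, [phi] may be replaced
    by [phi - c] in [D]; since E[chi (phi - c) f] = 0, [x_i] may be replaced by [x_i - b_i] in [A].
    What remains carries 1 - chi or the gradient of chi. *)
Lemma truncation_error i : `|D i - A i| <= a * ((2 * m + 7) * m + 8).
Proof.
have [K [K0 H]] := @cutoff_c11 R n a a0; have [bc bd] := c11_bm H.
pose chi := @cutoff R n a; rewrite -/chi in bc.
have ibm u : bm u -> gI (fun x => u x * f x).
  move=> [mu [C hC]]; apply: (@gI_moment_le `|C|) => // x.
  apply: (le_trans (hC x)); apply: (le_trans (ler_norm C)).
  by rewrite ler_peMr// lerDl dotp_ge0.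
pose c := gE (fun x => phi x * chi x * f x) / gE (fun x => chi x * f x).
have chi01 x : 0 <= chi x <= 1 := cutoff01 a x.
have c1 : `|c| <= 1.
  rewrite /c normrM normfV (gtr0_norm Z0) ler_pdivrMr// mul1r.
  apply: gE_norm_le; [by apply: ibm; exact: bm_mul|exact: ibm|move=> x].
  have /andP[h1 h2] := chi01 x.
  rewrite (normrM (phi x * chi x)) (normrM (phi x)) (ger0_norm h1) (ger0_norm (f0 x)).
  by rewrite ler_wpM2r// ler_piMl.
have bpc : bm (fun x => phi x - c) by apply: bmB => //; exact: bm_cst.
have E5 : gE (fun x => chi x * (phi x - c) * f x) = 0.
  rewrite (_ : (fun x => _) = (fun x => phi x * chi x * f x - c * (chi x * f x))); last first.
    by apply/funext => x; ring.
  rewrite gEB; [|by apply: ibm; exact: bm_mul|by apply: gIZ; exact: ibm].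
  by rewrite gEZ; [rewrite /c divfK ?subrr// gt_eqF|exact: ibm].
pose T x := (1 - chi x) * ((x 0 i - b i) * (phi x - c) - Gphi x 0 i) + (phi x - c) * dcutoff a x 0 i.
have DA : D i - A i = gE (fun x => T x * f x).
  have ip1 : gI (fun x => psi1 phi Gphi a i x * f x) by apply: ibm; exact (bm_psi1 cphi a0 i).
  have ip2 : gI (fun x => psi2 a i x * f x) by apply: ibm; exact (bm_psi2 a0 i).
  have iD : gI (fun x => ((x 0 i - b i) * phi x - Gphi x 0 i) * f x).
    apply: (@gI_moment_le (m + 3)) => // x; apply: (le_trans (D_le x i)).
    have := dotp_ge0 x; have := m0; nra.
  have i5 : gI (fun x => chi x * (phi x - c) * f x) by apply: ibm; exact: bm_mul.
  rewrite (_ : (fun x => T x * f x) = (fun x => ((x 0 i - b i) * phi x - Gphi x 0 i) * f x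
     - psi1 phi Gphi a i x * f x + c * (psi2 a i x * f x) + (- c) * (x 0 i * f x) + (c * b i) * f x
     + b i * (chi x * (phi x - c) * f x))); last first.
    by apply/funext => x; rewrite /T /psi1 /psi2 -/(chi x); ring.
  have j1 := gIB iD ip1; have j2 := gID j1 (gIZ c ip2).
  have j3 := gID j2 (gIZ (- c) (gI_coord i)); have j4 := gID j3 (gIZ (c * b i) iF).
  rewrite (gED j4 (gIZ _ i5)) (gED j3 (gIZ _ iF)) (gED j2 (gIZ _ (gI_coord i))) (gED j1 (gIZ _ ip2)) (gEB iD ip1).
  rewrite !gEZ ?E5 ?f1//; last exact: gI_coord.
  by rewrite /A /truncated_stein -/c -/(b i) -/(D i); ring.
rewrite DA (_ : a * _ = a * (2 * m + 7) * m + 8 * a); last by ring.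
have b1 := mean_coord_le i.
have a2 : 2 * a ^+ 2 <= a.
  by have := ler_wpM2l (ltW a0) a1; rewrite -expr2; lra.
have mc : measurable_fun setT (fun x => phi x - c) by have [] := bpc.
have mchi : measurable_fun setT chi by have [] := bc.
have mT : measurable_fun setT T.
  apply: measurable_funD; last by apply: measurable_funM => //; have [] := bd i.
  apply: measurable_funM; first exact: measurable_funB.
  apply: measurable_funB; last by have [] := bgphi i.
  by apply: measurable_funM => //; apply: measurable_funB => //; exact: measurable_coord.
apply: gE_moment_le => //; [by apply: mulr_ge0; [exact: ltW|rewrite addr_ge0// mulr_ge0]|by rewrite mulr_ge0// ltW|].
move=> x; rewrite /T; have /andP[h0 h1] := chi01 x; set p := 1 - chi x.
have p01 : 0 <= p <= 1 by rewrite /p; lra.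
have pq : p <= 2 * (a ^+ 2 * dotp x x) := cutoff_lb a x.
have q0 := dotp_ge0 x; set q := dotp x x in pq q0 *.
have xq : `|x 0 i| ^+ 2 <= q by rewrite real_normK ?num_real//; exact: coord_sqr_le.
have pc : `|phi x - c| <= 2 by have := ler_normB (phi x) c; have := phi1 x; lra.
have dc := dcutoff_le x i a0; have Gc := G1 x i.
apply: (le_trans (ler_normD _ _)); rewrite !normrM (ger0_norm (proj1 (andP p01))).
have H1 : `|(x 0 i - b i) * (phi x - c) - Gphi x 0 i| <= 2 * `|x 0 i| + (2 * m + 3).
  apply: (le_trans (ler_normB _ _)); rewrite normrM.
  have := ler_normB (x 0 i) (b i).
  have := ler_wpM2l (normr_ge0 (x 0 i - b i)) pc; lra.
have H2 : `|phi x - c| * `|dcutoff a x 0 i| <= 8 * a.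
  rewrite (_ : 8 * a = 2 * (4 * a)); last by ring.
  exact: ler_pM.
have /andP[p0 p1] := p01.
have H3 := ler_wpM2l p0 H1.
have apq : p <= a * q by apply: (le_trans pq); rewrite mulrA ler_wpM2r.
(* Here p <= 1 and p <= 2 a^2 q give p^2 <= 2 a^2 q, and 2 a p |x_i| <= p^2 + a^2 x_i^2. This
   interpolation makes the error linear in [a] using second moments only. *)
have H4 : p * `|x 0 i| <= 2 * (a * q).
  set u := `|x 0 i| in xq *; have u0 : 0 <= u by exact: normr_ge0.
  have pp : p ^+ 2 <= 2 * (a ^+ 2 * q) by apply: le_trans pq; rewrite expr2 ler_piMr.
  have uu : a ^+ 2 * u ^+ 2 <= a ^+ 2 * q by rewrite ler_wpM2l// sqr_ge0.
  have sq : 0 <= (p - a * u) ^+ 2 by exact: sqr_ge0.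
  have aq : 0 <= a ^+ 2 * q by rewrite mulr_ge0// sqr_ge0.
  rewrite -(@ler_pM2l _ (2 * a)); last exact: mulr_gt0.
  rewrite (_ : 2 * a * (p * u) = p ^+ 2 + a ^+ 2 * u ^+ 2 - (p - a * u) ^+ 2); last by ring.
  rewrite (_ : 2 * a * (2 * (a * q)) = 4 * (a ^+ 2 * q)); last by ring.
  lra.
have H5 : p * (2 * m + 3) <= a * q * (2 * m + 3) by rewrite ler_wpM2r// addr_ge0// mulr_ge0.
lra.
Qed.

End SteinBound.

Definition stein_rate (R : realType) (n : nat) : R := gE (@wgt R n) ^+ 2 / (8 * expR 4).
(** The first summand bounds the truncation error; the final 1 makes the cost positive. *)
Definition stein_cost (R : realType) (n : nat) (m : R) : R :=
  n%:R * ((2 * m + 7) * m + 8) ^+ 2 + n%:R * (2 * m + 3) ^+ 2 * (m + 1) ^+ 2 + 1.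

(** * Optimizing the cutoff scale *)

Section SteinQuartic.
Context {R : realType} {n : nat}.
Implicit Types (x : 'rV[R]_n).
Context (f : 'rV[R]_n -> R) (sf : smooth f) (f0 : forall x, 0 <= f x).
Context (iF : gI f) (f1 : gE f = 1) (iI : gI (fq f (grad f))).
Context (m : R) (m0 : 0 <= m) (i2 : gI (fun x => dotp x x * f x)) (m2 : gE (fun x => dotp x x * f x) <= m).
Context (phi : 'rV[R]_n -> R) (Kp : R) (Kp0 : 0 <= Kp) (Gphi : 'rV[R]_n -> 'rV[R]_n) (cphi : c11on setT Kp phi Gphi).
Context (phi1 : forall x, `|phi x| <= 1) (G1 : forall x i, `|Gphi x 0 i| <= 1).

Let b i := gE (fun x => x 0 i * f x).
Let D i := gE (fun x => ((x 0 i - b i) * phi x - Gphi x 0 i) * f x).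
Let C := (2 * m + 7) * m + 8.
Let delta := gE (fq f (grad f)) / 2 - gE (fun x => f x * ln (f x)).
Let q := \sum_(i < n) D i ^+ 2.

(** Below this scale both a <= 1/2 and 2 a^2 m < 1 hold, so the cutoff keeps positive mass. *)
Let a1 := (2 * (m + 1))^-1.
Let m10 : 0 < m + 1. Proof. by rewrite ltr_wpDl. Qed.
Let a10 : 0 < a1. Proof. by rewrite invr_gt0 mulr_gt0. Qed.
Let a12 : a1 <= 2^-1. Proof. by rewrite lef_pV2 ?posrE ?mulr_gt0// ler_peMr// lerDr. Qed.

Let mass a : 0 < a -> a <= a1 -> 0 < gE (fun x => cutoff a x * f x).
Proof.
move=> a0 aa1; apply: lt_le_trans (cutoff_mass f0 iF f1 i2 m2 a0).
have h : a * (2 * (m + 1)) <= 1 by rewrite -ler_pdivlMr ?mul1r// mulr_gt0.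
have : (a * (2 * (m + 1))) ^+ 2 <= 1 by rewrite exprn_ile1// mulr_ge0// ?ltW// mulr_gt0.
have : 0 <= a ^+ 2 by exact: sqr_ge0.
have h0 := m0; rewrite exprMn; set t := a ^+ 2; nra.
Qed.

Let rate_gt0 : 0 < stein_rate R n.
Proof. by rewrite divr_gt0 ?exprn_gt0 ?gE_wgt_gt0// mulr_gt0// expR_gt0. Qed.

Lemma stein_sum_le a : 0 < a -> a <= a1 ->
  stein_rate R n * a ^+ 2 * q <= 2 * delta + 2 * stein_rate R n * n%:R * C ^+ 2 * a ^+ 4.
Proof.
move=> a0 aa1; have aa2 := le_trans aa1 a12; have Z0 := mass a0 aa1.
have [_ H] := density_stability sf f0 iF f1 iI Kp0 cphi phi1 a0 aa2 Z0.
have DA i := truncation_error f0 iF f1 m0 i2 m2 cphi phi1 G1 a0 aa2 Z0 i.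
have q_le : q <= \sum_(i < n) (2 * truncated_stein phi Gphi a f i ^+ 2 + 2 * (a * C) ^+ 2).
  apply: ler_sum => i _.
  have : (D i - truncated_stein phi Gphi a f i) ^+ 2 <= (a * C) ^+ 2.
    by rewrite -real_normK ?num_real// lerXn2r ?nnegrE// (le_trans _ (DA i)).
  rewrite -/(b i) -/(D i); set A := truncated_stein _ _ _ _ _; have := sqr_ge0 (D i - 2 * A); nra.
have {}q_le : q <= 2 * \sum_(i < n) truncated_stein phi Gphi a f i ^+ 2 + 2 * (a * C) ^+ 2 * n%:R.
  by move: q_le; rewrite big_split/= -mulr_sumr sumr_const card_ord mulr_natr.
have k0 : 0 <= stein_rate R n * a ^+ 2 by rewrite mulr_ge0 ?sqr_ge0// ltW.
have := ler_wpM2l k0 q_le; rewrite /delta.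
move: H; rewrite -/(stein_rate R n); set S := \sum_(i < n) _; set E1 := gE _; set E2 := gE _.
rewrite (_ : stein_rate R n * a ^+ 2 * (2 * S + 2 * (a * C) ^+ 2 * n%:R) = 2 * (a ^+ 2 * stein_rate R n * S) + 2 * stein_rate R n * n%:R * C ^+ 2 * a ^+ 4); last by ring.
lra.
Qed.

Lemma deficit_ge0 : gI (fun x => f x * ln (f x)) /\ 0 <= delta.
Proof.
have [i H] := density_stability sf f0 iF f1 iI Kp0 cphi phi1 a10 a12 (mass a10 (lexx _)).
split => //; rewrite subr_ge0; apply: le_trans H; rewrite lerDl mulr_ge0//.
  by rewrite mulr_ge0 ?sqr_ge0// ltW.
by apply: sumr_ge0 => j _; exact: sqr_ge0.
Qed.

(* The free parameter is a^2 = q / (4 cost); the middle term of the cost keeps a below a1. *)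
Lemma stein_quartic : stein_rate R n * q ^+ 2 <= 16 * stein_cost n m * delta.
Proof.
have [_ d0] := deficit_ge0.
have q0 : 0 <= q by apply: sumr_ge0 => j _; exact: sqr_ge0.
have c1 : 1 <= stein_cost n m.
  rewrite lerDr; apply: addr_ge0; first by apply: mulr_ge0 => //; exact: sqr_ge0.
  by apply: mulr_ge0; [apply: mulr_ge0 => //; exact: sqr_ge0|exact: sqr_ge0].
have c0 : 0 < stein_cost n m by exact: lt_le_trans c1.
have [->|qn] := eqVneq q 0.
  by rewrite expr0n/= mulr0; apply: mulr_ge0 => //; apply: mulr_ge0 => //; exact: ltW.
have {}q0 : 0 < q by rewrite lt_def qn.
have qQ : q <= n%:R * (2 * m + 3) ^+ 2.
  rewrite (_ : n%:R * _ = \sum_(i < n) (2 * m + 3) ^+ 2); last first.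
    by rewrite sumr_const card_ord mulr_natl.
  apply: ler_sum => i _; have h := stein_coord_le f0 iF f1 m0 i2 m2 cphi phi1 G1 i.
  by rewrite -real_normK ?num_real// lerXn2r ?nnegrE// (le_trans _ h).
have cq : q * (m + 1) ^+ 2 <= stein_cost n m.
  have h1 : q * (m + 1) ^+ 2 <= n%:R * (2 * m + 3) ^+ 2 * (m + 1) ^+ 2.
    by apply: ler_wpM2r => //; exact: sqr_ge0.
  have h2 : 0 <= n%:R * ((2 * m + 7) * m + 8) ^+ 2 by apply: mulr_ge0 => //; exact: sqr_ge0.
  rewrite /stein_cost; lra.
have cC : n%:R * C ^+ 2 <= stein_cost n m.
  have h2 : 0 <= n%:R * (2 * m + 3) ^+ 2 * (m + 1) ^+ 2.
    by apply: mulr_ge0; [apply: mulr_ge0 => //; exact: sqr_ge0|exact: sqr_ge0].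
  rewrite /stein_cost /C; lra.
pose t := q / (4 * stein_cost n m).
have t0 : 0 < t by rewrite divr_gt0// mulr_gt0.
have a0 : 0 < Num.sqrt t by rewrite sqrtr_gt0.
have aa1 : Num.sqrt t <= a1.
  rewrite -(@ler_pXn2r _ 2) ?nnegrE ?sqrtr_ge0 ?(ltW a10)// sqr_sqrtr ?(ltW t0)//.
  rewrite /a1 exprVn ler_pdivrMr ?mulr_gt0// mulrC ler_pdivlMr ?exprn_gt0 ?mulr_gt0//.
  rewrite exprMn; lra.
have := stein_sum_le a0 aa1.
rewrite (_ : Num.sqrt t ^+ 4 = t ^+ 2); last by rewrite -[in RHS](sqr_sqrtr (ltW t0)) -exprM.
rewrite sqr_sqrtr ?(ltW t0)//.
(* With q = 4 cost t the left side of the bound is 4 rate cost t^2, twice the error term, so half of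
   it remains: rate cost t^2 <= delta. *)
have qt : q = 4 * stein_cost n m * t by rewrite /t mulrC divfK// gt_eqF// mulr_gt0.
have h : stein_rate R n * t ^+ 2 * (n%:R * C ^+ 2) <= stein_rate R n * t ^+ 2 * stein_cost n m.
  by rewrite ler_wpM2l// mulr_ge0 ?sqr_ge0// ltW.
move=> H; have {H h} : stein_rate R n * t ^+ 2 * stein_cost n m <= delta.
  rewrite qt in H; lra.
move=> /(ler_wpM2l (ltW c0)); rewrite qt; lra.
Qed.

End SteinQuartic.

(** * Shifted densities and test functions *)

Section Shift.
Context {R : realType} {n : nat}.
Implicit Types (x : 'rV[R]_n) (F f phi : 'rV[R]_n -> R).

Lemma measurable_funV_ge0 f : measurable_fun setT f -> (forall x, 0 <= f x) ->
  measurable_fun setT (fun x => (f x)^-1).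
Proof.
move=> mf f0; rewrite (_ : (fun x => _) = (fun x => if 0 < f x then expR (- ln (f x)) else 0)); last first.
  apply/funext => x; case: ifPn => [h|]; first by rewrite expRN lnK ?posrE.
  by rewrite lt_def f0 andbT negbK => /eqP ->; rewrite invr0.
apply: measurable_fun_ifT => //; first exact: measurable_fun_ltr.
by apply: measurableT_comp => //; apply: measurableT_comp => //; exact: measurableT_comp.
Qed.

Lemma smooth_measurable F : smooth F -> measurable_fun setT F.
Proof. by move=> sF; apply: continuous_measurable_rV; have [] := sF 0%N. Qed.

Lemma smooth_partial F i : smooth F -> smooth (partial i F).
Proof. by move=> sF k; have [_ [_ H]] := sF k.+1; exact: H. Qed.

Lemma smooth_diff F x : smooth F -> differentiable F x.
Proof. by move=> sF; have [_ [H _]] := sF 1%N; exact: H. Qed.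

Lemma gint_nn_fin F : measurable_fun setT F -> (forall x, 0 <= F x) ->
  (gint_nn (fun x => (F x)%:E) < +oo)%E ->
  gI F /\ gint_nn (fun x => (F x)%:E) = (gE F)%:E.
Proof.
move=> mF F0; have mE : measurable_fun setT (EFin \o F) by exact/measurable_EFinP.
rewrite gint_nnE; [|exact: mE|by move=> x; rewrite lee_fin].
move=> h; suff iF : gI F by split => //; rewrite EFin_gE.
apply/integrableP; split => //.
by under eq_integral do rewrite /= ger0_norm//.
Qed.

Lemma c11_shift K h V b : c11on setT K h V ->
  c11on setT K (fun x : 'rV[R]_n => h (x - b)) (fun x => V (x - b)).
Proof.
move=> hV; split.
- by move=> x _; exact (c11_h hV I).
- by move=> x i _; exact (c11_V hV i I).
- by move=> x w _ _; rewrite addrAC; exact (c11_lip hV I I).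
- by move=> x w i _ _; rewrite addrAC; exact (c11_Vlip hV i I I).
- by move=> x w _ _; rewrite [x + w - b]addrAC; exact (c11_taylor hV I I).
Qed.

Lemma coord_le_enorm x i : `|x 0 i| <= enorm x.
Proof.
rewrite -sqrtr_sqr /enorm ler_sqrt ?dotp_ge0//; exact: coord_sqr_le.
Qed.

Lemma le_sum_sqr (u : 'I_n -> 'I_n -> R) i j :
  u i j ^+ 2 <= \sum_(k < n) \sum_(l < n) u k l ^+ 2.
Proof.
rewrite (bigD1 i)//= (bigD1 j)//= -addrA lerDl addr_ge0//.
  by apply: sumr_ge0 => l _; exact: sqr_ge0.
by apply: sumr_ge0 => k _; apply: sumr_ge0 => l _; exact: sqr_ge0.
Qed.

Lemma testB_c11 phi : testB phi -> c11on setT 1 phi (grad phi).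
Proof.
move=> [s [p0 [p1 p2]]]; apply: c11_C2 => //.
- by move=> y; exact: smooth_diff.
- by move=> i y; apply: smooth_diff; exact: smooth_partial.
- move=> i x _; apply: le_trans (p1 x); have := coord_le_enorm (grad phi x) i.
  by rewrite mxE.
- move=> i j x _; apply: le_trans (p2 x).
  have := le_sum_sqr (fun i j => partial i (partial j phi) x) j i.
  rewrite /hess_HS -sqrtr_sqr; exact: ler_wsqrtr.
Qed.

(** Substitution x -> x + b: the exponential factor of [shift_dens] is exactly the weight
    [affine_dens b 1]. *)
Lemma stein_vec_shift f phi b i : measurable_fun setT f -> testB phi ->
  stein_vec (shift_dens f b) phi 0 i =
  gE (fun x => ((x 0 i - b 0 i) * phi (x - b) - grad phi (x - b) 0 i) * f x).
Proof.
move=> mf tphi; have [mphi mg] := c11_bm (c11_shift b (testB_c11 tphi)).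
set F := (fun x => _ * f x).
have mF : measurable_fun setT F.
  apply: measurable_funM => //; apply: measurable_funB; last by have [] := mg i.
  apply: measurable_funM; last by have [] := mphi.
  by apply: measurable_funB => //; exact: measurable_coord.
rewrite (gE_affine b ltr01 mF) mxE.
set G := (fun x : 'rV[R]_n => _ * shift_dens f b x).
have -> : G = (fun x => affine_dens b 1 x * F (b + 1 *: x)).
  apply/funext => x; rewrite /G /F /shift_dens affine_dens1 scale1r.
  by rewrite [b + x]addrC addrK !mxE addrK; ring.
rewrite gintR//.
apply: measurable_funM; first exact: measurable_affine_dens.
by apply: (measurable_comp _ _ mF) => //; exact: measurable_affine_cst.
Qed.

Lemma partial_cst (c : R) i : partial i (fun _ : 'rV[R]_n => c) = fun=> 0.
Proof. by apply/funext => x; rewrite /partial derive_cst. Qed.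

Lemma smooth_cst (c : R) : smooth (fun _ : 'rV[R]_n => c).
Proof.
have cc c' : continuous (fun _ : 'rV[R]_n => c' : R) by move=> x; exact: cst_continuous.
move=> k; elim: k c => [|k IH] c; split; [exact: cc|by []|exact: cc|].
split; first by move=> x; exact: differentiable_cst.
by move=> i; rewrite partial_cst.
Qed.

(** The zero function witnesses that the discrepancy is nonnegative, and it instantiates the
    stability estimate to show that the deficit is. *)
Lemma testB_cst0 : testB (fun _ : 'rV[R]_n => 0 : R).
Proof.
split; first exact: smooth_cst.
have g0 x : grad (fun _ : 'rV[R]_n => 0 : R) x = 0.
  by apply/rowP => i; rewrite !mxE partial_cst.
split; first by move=> x; rewrite normr0.
split => x.
  by rewrite g0 /enorm /dotp big1 ?sqrtr0// => i _; rewrite mxE mul0r.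
rewrite /hess_HS big1 ?sqrtr0// => i _; rewrite big1// => j _.
by rewrite !partial_cst expr0n.
Qed.

Lemma dotp_ebasis x i : dotp (ebasis i) x = x 0 i.
Proof.
rewrite /dotp (bigD1 i)//= big1 ?addr0 ?mxE ?eqxx ?mul1r// => j /negPf ji.
by rewrite mxE ji mul0r.
Qed.

Lemma enorm_ebasis i : enorm (ebasis i : 'rV[R]_n) = 1.
Proof. by rewrite /enorm dotp_ebasis mxE eqxx sqrtr1. Qed.

(** At the level -1 the truncation is always active, so basis directions give full coordinate second
    moments, and these add up to |x|^2. *)
Lemma UI_second_moment f (c : R) : measurable_fun setT f -> (forall x, 0 <= f x) ->
  (UI_tail f (- 1) <= c%:E)%E ->
  gI (fun x => dotp x x * f x) /\ gE (fun x => dotp x x * f x) <= n%:R * Num.max c 0.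
Proof.
move=> mf f0 H.
have mi i : measurable_fun setT (fun x => x 0 i ^+ 2 * f x).
  by apply: measurable_funM => //; apply: measurable_funX; exact: measurable_coord.
have fi0 i x : 0 <= x 0 i ^+ 2 * f x by rewrite mulr_ge0// sqr_ge0.
have Hi i : (gint_nn (fun x => (x 0 i ^+ 2 * f x)%:E) <= c%:E)%E.
  apply: le_trans H; apply: ereal_sup_ubound; exists (ebasis i); first exact: enorm_ebasis.
  congr gint_nn; apply/funext => x; rewrite dotp_ebasis ifT//.
  by rewrite (lt_le_trans (ltrN10 _)).
have iE i : gI (fun x => x 0 i ^+ 2 * f x) /\ gE (fun x => x 0 i ^+ 2 * f x) <= Num.max c 0.
  have [j E] := gint_nn_fin (mi i) (fi0 i) (le_lt_trans (Hi i) (ltry _)).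
  by split => //; move: (Hi i); rewrite E lee_fin le_max => ->.
have -> : (fun x => dotp x x * f x) = (fun x => \sum_(i < n) x 0 i ^+ 2 * f x).
  by apply/funext => x; rewrite /dotp mulr_suml; under eq_bigr do rewrite -expr2.
split; first by apply: gI_sum => i; exact: (iE i).1.
rewrite gE_sum; last by move=> i; exact: (iE i).1.
rewrite mulr_natl -[n in _ *+ n]card_ord -sumr_const; apply: ler_sum => i _; exact: (iE i).2.
Qed.

End Shift.

Theorem theorem1p2 (R : realType) (n : nat) (w : R -> R) :
  (forall e : R, 0 < e -> exists M : R, forall r : R, M <= r -> w r <= e) ->
  exists c : R, 0 < c /\
  forall (f : 'rV[R]_n -> R) (b : 'rV[R]_n),
    smooth_prob_density f ->
    (gint_nn (fun x => (dotp x x * f x)%:E) < +oo)%E ->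
    b = barycenter f ->
    (fisher f < +oo)%E ->
    (forall r : R, (UI_tail f r <= (w r)%:E)%E) ->
    (c%:E * stein_disc (shift_dens f b) ^+ 4 <= deficit f)%E.
Proof.
(* The moment bound must be fixed from [w] alone, before any [f] is given; the maximum with 0 is
   there because [w (- 1)] may have either sign. *)
move=> _; pose m := n%:R * Num.max (w (- 1)) 0.
have m0 : 0 <= m by rewrite mulr_ge0// le_max lexx orbT.
have cost0 : 0 < stein_cost n m.
  apply: ltr_wpDl => //; apply: addr_ge0; first by apply: mulr_ge0 => //; exact: sqr_ge0.
  by apply: mulr_ge0; [apply: mulr_ge0 => //; exact: sqr_ge0|exact: sqr_ge0].
have rate0 : 0 < stein_rate R n.
  by rewrite divr_gt0 ?exprn_gt0 ?gE_wgt_gt0// mulr_gt0// expR_gt0.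
exists (stein_rate R n / (16 * stein_cost n m)); split; first by rewrite divr_gt0// mulr_gt0.
move=> f b [sf [f0 f1]] _ bE fI UI.
have mf := smooth_measurable sf.
have [iF f1'] := gint_nn_fin mf f0 (eq_ind_r (fun z => z < +oo)%E (ltry _) f1).
have {f1 f1'}f1 : gE f = 1 by apply: EFin_inj; rewrite -f1'.
have [i2 m2] := UI_second_moment mf f0 (UI (- 1)).
have mfq : measurable_fun setT (fq f (grad f)).
  apply: measurable_funM; last exact: measurable_funV_ge0.
  have mG i : measurable_fun setT (fun x => grad f x 0 i).
    by under eq_fun do rewrite mxE; apply: smooth_measurable; exact: smooth_partial.
  rewrite /dotp; apply: measurable_sum => i; exact: measurable_funM.
have fq0 x : 0 <= fq f (grad f) x by rewrite divr_ge0// dotp_ge0.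
have [iI fE] := gint_nn_fin mfq fq0 fI.
have b_i i : b 0 i = gE (fun x => x 0 i * f x).
  rewrite bE mxE gintR//; apply: measurable_funM => //; exact: measurable_coord.
have quartic phi : testB phi ->
  stein_rate R n * enorm (stein_vec (shift_dens f b) phi) ^+ 4 <= 16 * stein_cost n m *
   (gE (fq f (grad f)) / 2 - gE (fun x => f x * ln (f x))).
  move=> tphi; have [_ [p0 [p1 _]]] := tphi.
  have G1 x i : `|grad phi (x - b) 0 i| <= 1.
    exact: le_trans (coord_le_enorm _ _) (p1 _).
  have := stein_quartic sf f0 iF f1 iI m0 i2 m2 ler01 (c11_shift b (testB_c11 tphi))
    (fun x => p0 (x - b)) G1.
  rewrite -[4%N]/(2 * 2)%N exprM /enorm sqr_sqrtr ?dotp_ge0//.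
  rewrite /dotp; congr (_ * _ ^+ 2 <= _); apply: eq_bigr => i _.
  by rewrite -expr2 stein_vec_shift// b_i.
have [iln d0] := deficit_ge0 sf f0 iF f1 iI m0 i2 m2 ler01 (testB_c11 testB_cst0)
  (fun x => testB_cst0.2.1 x).
have dE : deficit f = (gE (fq f (grad f)) / 2 - gE (fun x => f x * ln (f x)))%:E.
  rewrite /deficit /fisher fE /entropy gintEE; last by have := gI_meas iln.
  by rewrite -EFin_gE// mulrC.
rewrite dE; set delta := _ - _ in quartic d0 *.
set d := stein_disc _.
(* A real upper bound, the fourth root of the quartic estimate, shows that the supremum is finite;
   its fourth power can then be computed in the reals. *)
have ub : ubound [set (enorm (stein_vec (shift_dens f b) phi))%:E | phi in testB]
    (Num.sqrt (Num.sqrt (16 * stein_cost n m * delta / stein_rate R n)))%:E.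
  move=> _ [phi tphi <-]; rewrite lee_fin.
  have e0 : 0 <= enorm (stein_vec (shift_dens f b) phi) by exact: sqrtr_ge0.
  have X4 : enorm (stein_vec (shift_dens f b) phi) ^+ 4 <= 16 * stein_cost n m * delta / stein_rate R n.
    by rewrite ler_pdivlMr// mulrC; exact: quartic.
  rewrite -(ger0_norm e0) -sqrtr_sqr ler_wsqrtr//.
  by rewrite -(ger0_norm (sqr_ge0 (enorm _))) -sqrtr_sqr ler_wsqrtr// -exprM.
have dK : (d <= _)%E := ge_ereal_sup ub.
have d00 : (0 <= d)%E.
  apply: (le_trans _ (ereal_sup_ubound _)); last by exists (fun=> 0); [exact: testB_cst0|].
  by rewrite lee_fin sqrtr_ge0.
have dfin : d \is a fin_num by rewrite ge0_fin_numE// (le_lt_trans dK)// ltry.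
have X0 : 0 <= 16 * stein_cost n m * delta / stein_rate R n.
  by apply: divr_ge0; [apply: mulr_ge0 => //; apply: mulr_ge0 => //; exact: ltW|exact: ltW].
have r0 : 0 <= fine d by rewrite -lee_fin fineK.
have rK := dK; rewrite -(fineK dfin) lee_fin in rK.
rewrite -[in leLHS](fineK dfin) -EFin_expe -EFinM lee_fin.
have : fine d ^+ 4 <= 16 * stein_cost n m * delta / stein_rate R n.
  rewrite -[leRHS](sqr_sqrtr X0) -[Num.sqrt _ in leRHS]sqr_sqrtr ?sqrtr_ge0// -exprM.
  by rewrite lerXn2r ?nnegrE ?sqrtr_ge0.
move=> /(ler_wpM2l (ltW (divr_gt0 rate0 (mulr_gt0 (ltr0n R 16) cost0)))).
move/le_trans; apply; rewrite le_eqVlt; apply/orP; left; apply/eqP; field.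
by rewrite !gt_eqF.
Qed.
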